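(* For every $\beta,\varepsilon>0$, $$\mathrm{Dim}_{\rm H}\left\{\left(x,\exp(t^{2\varepsilon})\right)\in\mathbb{R}\times(e,\infty):\ Z(t,x)>\frac{\beta\,t^{(1/4)+\varepsilon}}{\pi^{1/4}}\right\}=\max\left\{1,\,2-\frac{\beta^2}{2}\right\}\qquad\text{almost surely.}$$
   Context: Let $\xi$ be space-time white noise on $(0,\infty)\times\mathbb{R}$, i.e. the centered generalized Gaussian field with $\mathrm{Cov}[\xi(t,x),\xi(s,y)]=\delta_0(t-s)\delta_0(x-y)$. $Z$ is the (continuous) solution of the linear stochastic heat equation $\dot Z(t,x)=\frac12Z''(t,x)+\xi(t,x)$ on $(0,\infty)\times\mathbb{R}$ with $Z(0,\cdot)\equiv0$, i.e. $Z(t,x)=\int_{(0,t)\times\mathbb{R}}p_{t-s}(y-x)\,\xi(ds\,dy)$ (Wiener integral), where $p_t(x)=e^{-x^2/(2t)}/\sqrt{2\pi t}$. Macroscopic Hausdorff dimension (Barlow–Taylor) on $\mathbb{R}^2$. For integers $k\ge0$ let $\mathcal{V}_k:=(-e^k,e^k]^2$, $\mathcal{S}_0:=\mathcal{V}_0$, $\mathcal{S}_{k+1}:=\mathcal{V}_{k+1}\setminus\mathcal{V}_k$. For $\rho>0$ and $A\subseteq\mathbb{R}^2$ let $\nu^k_\rho(A):=\inf\sum_{i=1}^m (r_i/e^{k+1})^\rho$, the infimum being over all finite coverings of $A\cap\mathcal{S}_k$ by squares $Q_1,\dots,Q_m\subseteq\mathcal{S}_k$, where $Q_i$ has the form $(x_1,x_1+r_i]\times(x_2,x_2+r_i]$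 with $r_i\ge1$. Then $\mathrm{Dim}_{\rm H}(A):=\inf\{\rho>0:\sum_{k=1}^\infty\nu^k_\rho(A)<\infty\}$. *)

(* Defs.v *)
From HB Require Import structures.
From mathcomp Require Import all_boot all_order all_algebra.
From mathcomp Require Import all_classical all_reals all_analysis.

Set Implicit Arguments.
Unset Strict Implicit.
Unset Printing Implicit Defensive.

Import Order.TTheory GRing.Theory Num.Theory.
Import numFieldNormedType.Exports.

Local Open Scope classical_set_scope.
Local Open Scope ring_scope.

Section macroscopic_hausdorff_dimension.
Context {R : realType}.
Implicit Types (A : set (R * R)) (z : R * R) (r rho : R).

Definition box (k : nat) : set (R * R) :=
  `](- expR k%:R), (expR k%:R)] `*` `](- expR k%:R), (expR k%:R)].

Definition shell (k : nat) : set (R * R) :=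
  if k is k'.+1 then box k'.+1 `\` box k' else box 0.

Definition square z r : set (R * R) :=
  `]z.1, (z.1 + r)] `*` `]z.2, (z.2 + r)].

Definition shell_cover A (k m : nat) (c : 'I_m -> R * R) (r : 'I_m -> R) :=
  (forall i, 1 <= r i /\ square (c i) (r i) `<=` shell k) /\
  A `&` shell k `<=` \bigcup_i square (c i) (r i).

Definition shell_content rho (k : nat) A : \bar R :=
  ereal_inf [set e | exists (m : nat) (c : 'I_m -> R * R) (r : 'I_m -> R),
    shell_cover A k c r /\
    e = (\sum_(i < m) (r i / expR k.+1%:R) `^ rho)%:E].

Definition macro_dimH A : \bar R :=
  ereal_inf [set rho%:E | rho in
    [set rho | 0 < rho /\
               (\sum_(1 <= k <oo) shell_content rho k A < +oo)%E]].

End macroscopic_hausdorff_dimension.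

Section white_noise.
Context {d : measure_display} {T : measurableType d} {R : realType}.
Variable P : probability T R.

(* The point mass is listed separately because normal_prob m 0 is the uniform
   law on [0, 1]. *)
Definition gaussian (X : T -> R) : Prop :=
  exists m s : R, forall A : set R, measurable A ->
    P (X @^-1` A) = if s == 0 then \d_m A else normal_prob m s A.

Definition gaussian_family (I : Type) (D : set I) (X : I -> T -> R) : Prop :=
  forall (n : nat) (f : 'I_n -> I) (a : 'I_n -> R), (forall i, D (f i)) ->
    gaussian (fun w => \sum_(i < n) a i * X (f i) w).

(* In pairs (s, y), s is time and y is space. *)
Definition space_time : set (R * R) := [set sy | 0 < sy.1].

Definition lebesgue2 :
    {measure set (measurableTypeR R * measurableTypeR R) -> \bar R} :=
  ((@lebesgue_measure R) \x (@lebesgue_measure R))%E.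

Definition square_integrable (f : R * R -> R) : Prop :=
  measurable_fun space_time f /\
  lebesgue2.-integrable space_time (fun sy => (f sy ^+ 2)%:E).

(* White noise as the isonormal process over L^2((0, oo) x R): for f square
   integrable, xi f is the Wiener integral of f, and the delta covariance reads
   Cov[xi f, xi g] = \int f g. Values of xi at other f are unconstrained. *)
Definition white_noise (xi : (R * R -> R) -> {RV P >-> R}) : Prop :=
  [/\ gaussian_family square_integrable (fun f => xi f : T -> R),
      forall f, square_integrable f -> 'E_P[xi f] = 0%E &
      forall f g, square_integrable f -> square_integrable g ->
        covariance P (xi f) (xi g) =
        \int[lebesgue2]_(sy in space_time) (f sy * g sy)%:E]%E.

Definition heat_kernel (t x : R) : R :=
  expR (- x ^+ 2 / (2 * t)) / Num.sqrt (2 * pi * t).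

Definition mild_integrand (t x : R) (sy : R * R) : R :=
  if 0 < sy.1 < t then heat_kernel (t - sy.1) (sy.2 - x) else 0.

(* Only the values Z t x with t >= 0 are relevant. *)
Definition continuous_mild_solution (xi : (R * R -> R) -> {RV P >-> R})
    (Z : R -> R -> {RV P >-> R}) : Prop :=
  [/\ forall t x, 0 < t -> {ae P, forall w, Z t x w = xi (mild_integrand t x) w},
      {ae P, forall w, forall x, Z 0 x w = 0} &
      {ae P, forall w, {within [set tx : R * R | 0 <= tx.1],
                        continuous (fun tx : R * R => Z tx.1 tx.2 w)}}].

End white_noise.

Definition tall_peaks {R : realType} (z : R -> R -> R) (beta eps : R) :
    set (R * R) :=
  [set p | exists t x : R,
    [/\ 0 < t,
        p = (x, expR (t `^ (2 * eps))),
        expR 1 < expR (t `^ (2 * eps)) &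
        z t x > beta * t `^ (1 / 4 + eps) / pi `^ (1 / 4)]].

(* Main.v *)
Require Import Defs.
From HB Require Import structures.
From mathcomp Require Import all_boot all_order all_algebra.
From mathcomp Require Import all_classical all_reals all_analysis.
From mathcomp Require Import measurable_realfun.
From mathcomp Require Import ring lra zify.
Import Order.TTheory GRing.Theory Num.Theory.
Import numFieldNormedType.Exports.
Local Open Scope classical_set_scope.
Local Open Scope ring_scope.

Set Implicit Arguments.
Unset Strict Implicit.
Unset Printing Implicit Defensive.

(** Why the theorem is true.

The variance of Z(t,x) is sqrt(t/pi), so the level beta t^(1/4+eps)/pi^(1/4)
is beta t^eps standard deviations.  A peak at time t is drawn at height
y = exp(t^(2 eps)), hence beta t^eps = beta sqrt(ln y): a prescribed point at
height y is a peak with probability y^(-beta^2/2), up to logarithms.  The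
solution decorrelates over distances of order sqrt t, a power of ln y, which
is negligible on the scale exp k of the k-th shell.  So the peaks behave like a
field of nearly independent unit squares, the one at height y being kept with
probability y^(-beta^2/2).  Over the bulk of the shell this leaves a set of
dimension 2 - beta^2/2; along its bottom edge, where y stays bounded, a positive
fraction of a line survives, which accounts for the 1 in the maximum.  The
equation enters only through the joint law of the solution at two points:
[heat_pair] says that it is centred normal, and [heat_cov_le] and
[heat_var_incr_le] bound the covariance and the variance of increments.

Upper bound.  By chaining ([chaining], [bad_chain_prob]) the solution over a
unit square exceeds its value at the corner by a small fraction of the level
only with negligible probability, because one unit of height is a bounded amount
of time; so a unit square at height y contains a peak with probability at most
C y^(-gam), for any gam < beta^2/2 ([square_prob]).  Unit squares cover a shell,
and the expected content obtained by keeping those that contain a peak decays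
geometrically when rho > 2 - gam and gam <= 1 ([summable_content]).

Lower bound.  Take b = 1 for the bulk and b = 0 for the bottom edge, and th
between b beta^2/2 and 1.  Shell k+1 contains about exp(b k) rows, each cut
into about exp(k (1 - th)) cells of length exp(k th).  A cell holds many sample
points that are far apart on the correlation scale, more of them than the
reciprocal exp(b k beta^2/2) of the probability of a peak, and a second moment
argument ([all_below_prob]) makes a cell without a peak exponentially unlikely
([bad_block_prob]).  Almost surely, at least half of the cells of every late
shell then contain a peak.  A square of side r meets at most a constant times
r^(1 + b - th) cells, so the content of the peaks in these shells stays bounded
below for rho = 1 + b - th ([content_ge], [infinite_content]).

The second moment argument uses the test function cos^(2n)((x - m)/M).  Being a
trigonometric polynomial, it has covariances that are read off from the
characteristic function of the normal law ([two_point_cos]). *)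

(** * Integrals against a Gaussian law *)

Section density.
Local Open Scope ereal_scope.
Context d (T : measurableType d) (R : realType).
Variables (mu nu : {measure set T -> \bar R}) (g : T -> R).
Hypothesis mg : measurable_fun setT g.
Hypothesis g0 : forall x, (0 <= g x)%R.
Hypothesis nug : forall A, measurable A -> nu A = \int[mu]_(x in A) (g x)%:E.

Import HBNNSimple.

Let integral_density_nnsfun (f : {nnsfun T >-> R}) :
  \int[nu]_x (f x)%:E = \int[mu]_x ((f x)%:E * (g x)%:E).
Proof.
under [LHS]eq_integral do rewrite fimfunE -fsumEFin//.
rewrite [LHS]ge0_integral_fsum//; last 2 first.
  - by move=> r; exact/measurable_EFinP/measurableT_comp.
  - by move=> n x _; rewrite EFinM nnfun_muleindic_ge0.
under [RHS]eq_integral.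
  move=> x xD; rewrite fimfunE -fsumEFin// muleC ge0_mule_fsumr; last first.
    by move=> r; rewrite EFinM nnfun_muleindic_ge0.
  over.
rewrite [RHS]ge0_integral_fsum//; last 2 first.
  - move=> r; apply: emeasurable_funM; first exact/measurable_EFinP.
    by apply/measurable_EFinP; do 2 apply/measurableT_comp => //.
  - move=> n x _; rewrite EFinM mule_ge0//; last by rewrite nnfun_muleindic_ge0.
    by rewrite lee_fin.
apply: eq_fsbigr => r _.
under [RHS]eq_integral do rewrite EFinM muleCA.
have [r0|r0] := ltP r 0%R.
  have E : f @^-1` [set r] = set0.
    rewrite -subset0 => x /= fx; move: r0; rewrite -fx ltNge => /negP; apply.
    exact: fun_ge0.
  rewrite E; under eq_integral do rewrite indic0 mulr0.
  by rewrite integral0; under eq_integral do rewrite indic0 mule0 mule0; rewrite integral0.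
have mr : measurable (f @^-1` [set r]) by exact: measurable_sfunP.
under [LHS]eq_integral do rewrite EFinM.
rewrite ge0_integralZl//; last first.
  exact/measurable_EFinP.
rewrite ge0_integralZl//; last 2 first.
- by apply: emeasurable_funM; exact/measurable_EFinP.
- by move=> x _; rewrite mule_ge0// lee_fin.
congr (_ * _); rewrite integral_indic// setIT nug// [LHS]integral_mkcond.
apply: eq_integral => x _; rewrite patchE indicE.
by case: (x \in _); rewrite ?mule1 ?mule0.
Qed.

(** Monotone convergence reduces this to simple functions, where it is the
assumption on [nu]. *)
Lemma integral_density (f : T -> \bar R) :
  measurable_fun setT f -> (forall x, 0 <= f x) ->
  \int[nu]_x f x = \int[mu]_x (f x * (g x)%:E).
Proof.
move=> mf f0.
pose f_ := nnsfun_approx measurableT mf.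
transitivity (lim (\int[nu]_x (f_ n x)%:E @[n --> \oo])).
  rewrite -monotone_convergence//=.
  - apply: eq_integral => ? /[!inE] xD; apply/esym/cvg_lim => //=.
    exact: cvg_nnsfun_approx.
  - by move=> n; exact/measurable_EFinP/measurable_funTS.
  - by move=> n ? _; rewrite lee_fin.
  - by move=> ? _ ? ? mn; rewrite lee_fin; exact/lefP/nd_nnsfun_approx.
rewrite [RHS](_ : _ = lim
    (\int[mu]_x ((f_ n x)%:E * (g x)%:E) @[n --> \oo])); last first.
  rewrite -monotone_convergence//=.
  - apply: eq_integral => x /[!inE] xD; apply/esym/cvg_lim => //.
    apply: cvgeZr => //.
    exact: cvg_nnsfun_approx.
  - by move=> n; apply: emeasurable_funM; exact/measurable_EFinP.
  - by move=> n ? _; rewrite mule_ge0// lee_fin.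
  - by move=> x _ a b ab; rewrite lee_wpmul2r// lee_fin//; exact/lefP/nd_nnsfun_approx.
by apply: congr_lim; apply/funext => n /=; exact: integral_density_nnsfun.
Qed.

End density.

Section law.
Local Open Scope ereal_scope.
Context d (T : measurableType d) (R : realType) (P : probability T R).
Variables (X : T -> R) (m s : R).
Hypothesis mX : measurable_fun setT X.
Hypothesis HX : forall A : set R, measurable A ->
  P (X @^-1` A) = if s == 0%R then \d_m A else normal_prob m s A.

Lemma law_integral (h : R -> \bar R) :
  measurable_fun setT h -> (forall x, 0 <= h x) ->
  \int[P]_w h (X w) = if s == 0%R then h m
    else \int[lebesgue_measure]_x (h x * (normal_pdf m s x)%:E).
Proof.
move=> mh h0.
pose X0 : {mfun T >-> R} := @mfun_Sub _ _ T R X (mem_set mX).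
have [s0|s0] := ifPn.
  rewrite -(ge0_integral_distribution X0 mh h0).
  rewrite (eq_measure_integral (\d_m)); last first.
    by move=> A mA _; have := HX mA; rewrite s0.
  by rewrite integral_dirac// diracT mul1e.
have mX' : @measurable_fun _ _ T (measurableTypeR R) setT X.
  by move=> _ Y mY; apply: mX.
pose X' : {mfun T >-> measurableTypeR R} :=
  @mfun_Sub _ _ T (measurableTypeR R) X (mem_set mX').
have mh' : @measurable_fun _ _ (measurableTypeR R) _ setT h by exact: mh.
rewrite -(@integral_density _ _ R lebesgue_measure (distribution P X') (normal_pdf m s))//.
- by rewrite (ge0_integral_distribution X').
- exact: measurable_normal_pdf.
- by move=> x; exact: normal_pdf_ge0.
- by move=> A mA; rewrite -[LHS]/(P (X @^-1` A)) HX// (negbTE s0).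
Qed.

End law.

Section shift.
Local Open Scope ereal_scope.
Context (R : realType).
(** Translation invariance, as the change of variable x + a. *)
Lemma ge0_integral_shift (G : R -> R) (a : R) : continuous G ->
  (forall x, 0 <= G x)%R ->
  \int[lebesgue_measure]_x (G x)%:E = \int[lebesgue_measure]_x (G (x + a)%R)%:E.
Proof.
move=> cG G0.
have dF (x : R^o) : derivable (fun x : R^o => x + a : R^o)%R x 1.
  by apply: derivableD => //.
have F' : ((fun x : R^o => x + a : R^o)%R^`())%classic = cst 1%R.
  apply/funext => x; rewrite derive1E deriveD//= derive_id derive_cst addr0//.
rewrite (@increasing_ge0_integration_by_substitutionT R (fun x => x + a)%R G)//.
- by apply: eq_integral => x _; rewrite F' /= fctE mulr1.
- by move=> x y xy; rewrite ltrD2r.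
- by rewrite F' => ?; exact: cvg_cst.
- by rewrite F'; exact: is_cvg_cst.
- by rewrite F'; exact: is_cvg_cst.
- exact: cvg_addrr_Ny.
- exact: cvg_addrr.
Qed.
End shift.

Section law2.
Local Open Scope ereal_scope.
Context d (T : measurableType d) (R : realType) (P : probability T R).
Variables (X : T -> R) (m s : R).
Hypothesis mX : measurable_fun setT X.
Hypothesis HX : forall A : set R, measurable A ->
  P (X @^-1` A) = if s == 0%R then \d_m A else normal_prob m s A.

(** Completing the square: tilting a Gaussian law by an exponential translates it
by r s^2.  The exponential moments, the tail bound and Gaussian integration by
parts are instances of it, for suitable h. *)
Lemma law_tilt (h : R -> R) (r : R) : continuous h -> (forall x, 0 <= h x)%R ->
  \int[P]_w (expR (r * X w) * h (X w))%:E =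
  (expR (r * m + r ^+ 2 * s ^+ 2 / 2))%:E * \int[P]_w (h (X w + r * s ^+ 2))%:E.
Proof.
move=> ch h0.
have ce : continuous (fun x : R => expR (r * x)).
  move=> x; apply: continuous_comp; last exact: continuous_expR.
  by apply: cvgM; [exact: cvg_cst|exact: cvg_id].
have mh : measurable_fun setT h by exact: continuous_measurable_fun.
have me : measurable_fun setT (fun x : R => expR (r * x)).
  exact: continuous_measurable_fun.
rewrite (@law_integral _ _ _ P X m s mX HX (fun x => (expR (r * x) * h x)%:E)); last 2 first.
- by apply/measurable_EFinP; exact: measurable_funM.
- by move=> x; rewrite lee_fin mulr_ge0// expR_ge0.
rewrite (@law_integral _ _ _ P X m s mX HX (fun x => (h (x + r * s ^+ 2))%:E)); last 2 first.
- apply/measurable_EFinP; apply: measurableT_comp => //; exact: measurable_funD.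
- by move=> x; rewrite lee_fin.
have [->|s0] := eqVneq s 0%R.
  by rewrite expr0n/= mulr0 mul0r !addr0 mulr0 addr0 EFinM.
pose G x := (expR (r * x) * h x * normal_pdf m s x)%R.
have cG : continuous G.
  move=> x; apply: cvgM; last exact: continuous_normal_pdf.
  by apply: cvgM; [exact: ce|exact: ch].
have G0 x : (0 <= G x)%R.
  by rewrite !mulr_ge0 ?expR_ge0// normal_pdf_ge0.
rewrite [LHS](_ : _ = \int[lebesgue_measure]_x (G x)%:E); last first.
  by apply: eq_integral => x _; rewrite -EFinM.
rewrite (ge0_integral_shift (r * s ^+ 2)%R cG G0) -ge0_integralZl//; last 2 first.
- apply: emeasurable_funM; apply/measurable_EFinP; last exact: measurable_normal_pdf.
  apply: measurableT_comp => //; exact: measurable_funD.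
- by move=> x _; rewrite mule_ge0// lee_fin ?normal_pdf_ge0.
apply: eq_integral => x _; rewrite -!EFinM; congr (_%:E).
rewrite /G mulrAC [RHS]mulrCA mulrC; congr (_ * _)%R.
rewrite !normal_pdfE// mulrCA [RHS]mulrCA; congr (_ * _)%R.
rewrite /normal_fun -!expRD; congr expR.
by field.
Qed.

(** Another Gaussian integral, of variance s^2/(1 + 2 c s^2).  It serves to identify
the parameter s with the standard deviation, so c may also be negative. *)
Lemma law_sqr (c : R) : (0 < 1 + 2 * c * s ^+ 2)%R ->
  \int[P]_w (expR (- c * (X w - m) ^+ 2))%:E =
  ((Num.sqrt (1 + 2 * c * s ^+ 2))^-1)%:E.
Proof.
move=> q0.
have me : measurable_fun setT (fun x : R => expR (- c * (x - m) ^+ 2)).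
  apply: measurableT_comp => //; apply: measurable_funM => //.
  by apply: measurable_funX; exact: measurable_funB.
rewrite (@law_integral _ _ _ P X m s mX HX (fun x => (expR (- c * (x - m) ^+ 2))%:E)); last 2 first.
- exact/measurable_EFinP.
- by move=> x; rewrite lee_fin expR_ge0.
have [s0|s0] := eqVneq s 0%R.
  by rewrite s0 subrr expr0n/= !mulr0 expR0 addr0 sqrtr1 invr1.
set q := (1 + 2 * c * s ^+ 2)%R in q0 *.
pose s' := (s / Num.sqrt q)%R.
have sq0 : (0 < Num.sqrt q)%R by rewrite sqrtr_gt0.
have s'0 : s' != 0%R by rewrite mulf_neq0// invr_neq0// gt_eqF.
rewrite [LHS](_ : _ = \int[lebesgue_measure]_x (((Num.sqrt q)^-1)%:E * (normal_pdf m s' x)%:E)).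
  rewrite ge0_integralZl//.
  - by rewrite integral_normal_pdf mule1.
  - by apply/measurable_EFinP; exact: measurable_normal_pdf.
  - by move=> x _; rewrite lee_fin normal_pdf_ge0.
apply: eq_integral => x _; rewrite -!EFinM; congr (_%:E).
have s'2 : (s' ^+ 2 = s ^+ 2 / q)%R.
  by rewrite /s' exprMn exprVn sqr_sqrtr// ltW.
rewrite !normal_pdfE// mulrCA [RHS]mulrA; congr (_ * _)%R.
  rewrite /normal_peak s'2 -invfM; congr (_^-1)%R.
  rewrite -sqrtrM ?ltW//; congr Num.sqrt.
  by rewrite !mulr2n; field; rewrite gt_eqF.
rewrite /normal_fun -expRD s'2; congr expR.
rewrite /q !mulr2n; field.
by rewrite gt_eqF//= gt_eqF// -mulr2n mulrn_wgt0// exprn_even_gt0.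
Qed.

End law2.

(** * Trigonometric estimates *)

Section trig.
Context {R : realType}.
Implicit Types x y t : R.

Lemma mvt_real (f df : R -> R) x : (forall t, is_derive t (1 : R) f (df t)) ->
  exists2 c, `|c| <= `|x| & f x - f 0 = df c * x.
Proof.
move=> H.
have cf : continuous f.
  by move=> t; apply/differentiable_continuous/derivable1_diffP; have [] := H t.
have [x0|x0] := leP 0 x.
  have [|c cx E] := @MVT_segment R f df 0 x x0 (fun t _ => H t).
  exact: continuous_subspaceT.
  move: cx; rewrite in_itv/= => /andP[c0 cx].
  by exists c; rewrite ?ger0_norm// E subr0.
have [|c cx E] := @MVT_segment R f df x 0 (ltW x0) (fun t _ => H t).
exact: continuous_subspaceT.
move: cx; rewrite in_itv/= => /andP[c0 cx].
exists c; first by rewrite !ler0_norm ?lerN2 ?(ltW x0).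
by rewrite -opprB E sub0r mulrN opprK.
Qed.

Lemma sin_mvt x : exists2 c, `|c| <= `|x| & sin x = cos c * x.
Proof.
have [c cx] := @mvt_real sin cos x (fun t => is_derive_sin t).
by rewrite sin0 subr0; exists c.
Qed.

Lemma norm_sin_le x : `|sin x| <= `|x|.
Proof.
have [c _ ->] := sin_mvt x.
by rewrite normrM ler_piMl// cos_max.
Qed.

Lemma cos_ge_sqr x : 1 - x ^+ 2 / 2 <= cos x.
Proof.
pose y := x / 2.
have -> : x = y + y by rewrite /y; field.
rewrite cosD -!expr2 sin2cos2.
have := norm_sin_le y; rewrite -ler_sqr ?nnegrE// !real_normK ?num_real//.
by rewrite sin2cos2; set u := cos _; nra.
Qed.

Lemma sin_sub_le x : `|sin x - x| <= 2 * x ^+ 2.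
Proof.
have [c cx ->] := sin_mvt x.
have -> : cos c * x - x = (cos c - 1) * x by ring.
rewrite normrM.
have h1 := cos_ge_sqr c; have h2 := cos_le1 c; have h3 := cos_geN1 c.
rewrite ler0_norm; last by lra.
rewrite -[x ^+ 2]real_normK ?num_real//.
have c2 : c ^+ 2 <= `|x| ^+ 2 by rewrite -[c ^+ 2]real_normK ?num_real// ler_sqr ?nnegrE.
have x0 := normr_ge0 x.
have [x1|x1] := leP `|x| 1; nra.
Qed.

Lemma cosD_taylor x y : `|cos (x + y) - cos x + y * sin x| <= 3 * y ^+ 2.
Proof.
rewrite cosD.
have -> : cos x * cos y - sin x * sin y - cos x + y * sin x =
  cos x * (cos y - 1) - sin x * (sin y - y) by ring.
apply: (le_trans (ler_normB _ _)); rewrite !normrM.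
have h1 := cos_ge_sqr y; have h2 := cos_le1 y.
have h3 := sin_sub_le y; have h4 := cos_max x; have h5 := sin_max x.
have h6 : `|cos y - 1| <= y ^+ 2 by rewrite ler0_norm; nra.
have h7 : `|cos x| * `|cos y - 1| <= `|cos y - 1| by rewrite ler_piMl.
have h8 : `|sin x| * `|sin y - y| <= `|sin y - y| by rewrite ler_piMl.
by lra.
Qed.

Lemma sinD_taylor x y : sin (x + y) <= sin x + y * cos x + 3 * y ^+ 2.
Proof.
rewrite sinD.
have h1 := cos_ge_sqr y; have h2 := cos_le1 y.
have h3 := sin_sub_le y; have h4 := cos_max x; have h5 := sin_max x.
have h6 : `|cos y - 1| <= y ^+ 2 by rewrite ler0_norm; nra.
have h7 : `|sin x * (cos y - 1)| <= y ^+ 2 by rewrite normrM (le_trans _ h6)// ler_piMl.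
have h8 : `|cos x * (sin y - y)| <= 2 * y ^+ 2 by rewrite normrM (le_trans _ h3)// ler_piMl.
move: h7 h8; rewrite !ler_norml => /andP[_ h7] /andP[_ h8].
by lra.
Qed.

(** Away from 0 the square of the cosine is below 1 by a definite amount; raised to
the power n this makes cos^(2n) negligible there. *)
Lemma cos2_le x : `|x| <= 1 -> cos x ^+ 2 <= expR (- (x ^+ 2 / 4)).
Proof.
move=> x1.
have [c cx E] := sin_mvt x.
have c1 : 1 / 2 <= cos c.
  have := cos_ge_sqr c.
  have : c ^+ 2 <= 1 ^+ 2 by rewrite -[c ^+ 2]real_normK ?num_real// ler_sqr ?nnegrE// (le_trans cx).
  by lra.
apply: (@le_trans _ _ (1 - x ^+ 2 / 4)); last exact: expR_ge1Dx.
have c4 : 1 / 4 <= cos c ^+ 2 by nra.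
by rewrite cos2sin2 E exprMn; have := sqr_ge0 x; nra.
Qed.

Lemma cos2_ge x : 1 - x ^+ 2 <= cos x ^+ 2.
Proof.
rewrite cos2sin2 lerD2l lerN2 -[leLHS]real_normK ?num_real// -[leRHS]real_normK ?num_real//.
by rewrite ler_sqr ?nnegrE// norm_sin_le.
Qed.

(** Linear terms beat quadratic ones near the origin.  This extracts a first-order
identity from an inequality that is valid for both signs of r, which replaces
differentiation under the integral sign. *)
Lemma tangent0 (D K e : R) : 0 < e ->
  (forall r, `|r| <= e -> r * D <= K * r ^+ 2) -> D = 0.
Proof.
move=> e0 H; apply/eqP; apply: contraT => D0.
have Dp : 0 < `|D| by rewrite normr_gt0.
pose M := `|D| / e + `|K| + 1.
have De : 0 < `|D| / e by rewrite divr_gt0.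
have M0 : 0 < M by rewrite /M; have := normr_ge0 K; lra.
have /H : `|D / M| <= e.
  rewrite normrM normfV (gtr0_norm M0) ler_pdivrMr// mulrC -ler_pdivrMr// /M.
  by have := normr_ge0 K; lra.
have -> : D / M * D = D ^+ 2 * M / M ^+ 2 by field; rewrite gt_eqF.
rewrite expr_div_n mulrA ler_pM2r ?invr_gt0 ?exprn_gt0// => H1.
have D2 : 0 < D ^+ 2 by rewrite -[_ ^+ _]real_normK ?num_real// exprn_gt0.
have : K < M by rewrite /M; have := ler_norm K; lra.
by nra.
Qed.

Lemma is_derive_quadratic (f : R -> R) (a l K : R) :
  (forall h, `|f (a + h) - f a - h * l| <= K * h ^+ 2) -> is_derive a (1 : R) f l.
Proof.
move=> H.
have L : h^-1 *: (f (h *: (1 : R) + a) - f a) @[h --> 0^'] --> l.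
  apply/cvgrPdist_le => e e0; near=> h.
  have h0 : h != 0 by near: h; exact: nbhs_dnbhs_neq.
  have := H h; rewrite addrC -[h *: 1]/(h * 1) mulr1 -[_ *: _]/(h^-1 * _) [a + h]addrC.
  set D := f (h + a) - f a => Hh.
  have -> : l - h^-1 * D = - (h^-1 * (D - h * l)) by field.
  have hp : 0 < `|h| by rewrite normr_gt0.
  have K1 : 0 < `|K| + 1 by rewrite ltr_wpDl.
  have he : `|h| <= e / (`|K| + 1).
    near: h; apply: dnbhs0_le; exact: divr_gt0.
  rewrite normrN normrM normfV mulrC ler_pdivrMr//.
  rewrite [D - _]addrC; apply: (le_trans Hh).
  apply: (@le_trans _ _ ((`|K| + 1) * `|h| * `|h|)); last first.
    by rewrite ler_wpM2r// mulrC -ler_pdivlMr.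
  rewrite -[h ^+ 2]real_normK ?num_real// expr2 mulrA ler_wpM2r// ler_wpM2r//.
  by have := ler_norm K; lra.
have E : 'D_1 f a = l by apply: cvg_lim.
by split => //; apply/cvg_ex; exists l.
Unshelve. all: by end_near. Qed.

End trig.

(** * Centred normal random variables *)

Section rint.
Context d (T : measurableType d) (R : realType) (P : probability T R).
Implicit Types f g X : T -> R.

Definition integrableR f := P.-integrable setT (EFin \o f).
Definition Ex f : R := (\int[P]_w f w)%R.

Lemma ExE f : integrableR f -> (\int[P]_w (f w)%:E)%E = (Ex f)%:E.
Proof. by move=> If; rewrite /Ex /Rintegral fineK//; exact: integrable_fin_num. Qed.

Lemma bounded_integrable f (M : R) : measurable_fun setT f ->
  (forall w, `|f w| <= M) -> integrableR f.
Proof.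
move=> mf fM; apply: (@le_integrable _ _ _ P setT measurableT _ (EFin \o cst M)).
- exact/measurable_EFinP.
- by move=> w _ /=; rewrite lee_fin (le_trans (fM w))// ler_norm.
- by apply: finite_measure_integrable_cst.
Qed.

Lemma integrableR_cst (c : R) : integrableR (fun=> c).
Proof. by apply: finite_measure_integrable_cst. Qed.

Lemma integrableR_D f g : integrableR f -> integrableR g -> integrableR (fun w => f w + g w).
Proof. by move=> If Ig; apply: (integrableD measurableT If Ig). Qed.

Lemma integrableR_B f g : integrableR f -> integrableR g -> integrableR (fun w => f w - g w).
Proof. by move=> If Ig; apply: (integrableB measurableT If Ig). Qed.

Lemma integrableR_Z (c : R) f : integrableR f -> integrableR (fun w => c * f w).
Proof. by move=> If; apply: (integrableZl measurableT c If). Qed.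

Lemma ExD f g : integrableR f -> integrableR g -> Ex (fun w => f w + g w) = Ex f + Ex g.
Proof. exact: RintegralD. Qed.

Lemma ExB f g : integrableR f -> integrableR g -> Ex (fun w => f w - g w) = Ex f - Ex g.
Proof. exact: RintegralB. Qed.

Lemma ExZ (c : R) f : integrableR f -> Ex (fun w => c * f w) = c * Ex f.
Proof. by move=> If; apply: RintegralZl. Qed.

Lemma Ex_cst (c : R) : Ex (fun=> c) = c.
Proof. by rewrite /Ex /Rintegral integral_cst//= probability_setT mule1. Qed.

Lemma Ex_le f g : integrableR f -> integrableR g -> (forall w, f w <= g w) -> Ex f <= Ex g.
Proof. by move=> If Ig fg; apply: le_Rintegral. Qed.

Lemma Ex_norm_le f g : integrableR f -> integrableR g ->
  (forall w, `|f w| <= g w) -> `|Ex f| <= Ex g.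
Proof.
move=> If Ig fg; rewrite ler_norml; apply/andP; split.
  rewrite -[leLHS]mulN1r -ExZ//; apply: Ex_le => //; first exact: integrableR_Z.
  by move=> w; have := fg w; rewrite mulN1r ler_norml => /andP[].
by apply: Ex_le => // w; have := fg w; rewrite ler_norml => /andP[].
Qed.

Lemma integrableR_le f g : measurable_fun setT f -> integrableR g ->
  (forall w, `|f w| <= g w) -> integrableR f.
Proof.
move=> mf Ig fg; apply: (le_integrable _ _ _ Ig) => //; first exact/measurable_EFinP.
by move=> w _ /=; rewrite lee_fin (le_trans (fg w))// ler_norm.
Qed.

End rint.

Section normal_rv.
Context d (T : measurableType d) (R : realType) (P : probability T R).
Implicit Types (X Y : T -> R) (v : R).

Definition normal_law X v := exists s, v = s ^+ 2 /\
  forall A : set R, measurable A ->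
    P (X @^-1` A) = if s == 0%R then \d_(0 : R) A else normal_prob 0 s A.

(** The moments are recorded together with the law, so that v is at once the
variance and the squared parameter of the law. *)
Definition centered_normal X v := measurable_fun setT X /\
  [/\ integrableR P X, Ex P X = 0, integrableR P (fun w => X w ^+ 2),
    Ex P (fun w => X w ^+ 2) = v & normal_law X v].

(** The notion of Gaussian variable leaves its parameters m and s unnamed; the mean
and the variance determine them.  With 1 + r X <= exp(r X), the tilting identity
gives 0 <= r m + r^2 s^2/2 for every r, so m = 0.  Similarly
1 + r X^2 <= exp(r X^2), for r of both signs, gives s^2 = v to the first order in r. *)
Lemma gaussian_centered_normal X v : measurable_fun setT X -> gaussian P X ->
  (\int[P]_w (X w)%:E = 0)%E -> (\int[P]_w (X w ^+ 2)%:E = v%:E)%E ->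
  centered_normal X v.
Proof.
move=> mX [m [s HX]] EX EX2.
have mX2 : measurable_fun setT (fun w => X w ^+ 2) by exact: measurable_funX.
have I2 : integrableR P (fun w => X w ^+ 2).
  apply/integrableP; split; first exact/measurable_EFinP.
  under eq_integral do rewrite /= ger0_norm ?sqr_ge0//.
  by rewrite EX2 ltry.
have I1 : integrableR P X.
  apply: (integrableR_le mX (integrableR_D (integrableR_cst P 1) I2)) => w.
  rewrite -[X w ^+ 2]real_normK ?num_real//; have := normr_ge0 (X w); nra.
have e1 : Ex P X = 0 by apply: EFin_inj; rewrite -ExE.
have e2 : Ex P (fun w => X w ^+ 2) = v by apply: EFin_inj; rewrite -ExE.
have v0 : 0 <= v.
  rewrite -lee_fin -EX2; apply: integral_ge0 => w _; by rewrite lee_fin sqr_ge0.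
have m0 : m = 0.
  have H r : 1 <= expR (r * m + r ^+ 2 * s ^+ 2 / 2).
    have := @law_tilt _ _ _ P X m s mX HX (fun=> 1) r (@cst_continuous R R (1:R)) (fun=> ler01).
    rewrite integral_cst//= probability_setT !mule1.
    under eq_integral do rewrite mulr1.
    move=> E.
    have Ie : integrableR P (fun w => expR (r * X w)).
      apply/integrableP; split.
        apply/measurable_EFinP.
        by apply: measurableT_comp => //; exact: measurable_funM.
      under eq_integral do rewrite /= ger0_norm ?expR_ge0//.
      by rewrite E ltry.
    move: E; rewrite ExE// => -[<-].
    have <- : Ex P (fun w => 1 + r * X w) = 1.
      by rewrite ExD ?ExZ ?Ex_cst ?e1 ?mulr0 ?addr0//; [exact: integrableR_cst|exact: integrableR_Z].
    apply: Ex_le => //.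
      by apply: integrableR_D; [exact: integrableR_cst|exact: integrableR_Z].
    by move=> w; exact: expR_ge1Dx.
  apply: (@tangent0 _ m (s ^+ 2 / 2) 1) => // r _.
  have := H (- r); rewrite -{1}expR0 ler_expR sqrrN mulNr; lra.
subst m; split=> //; split=> //; exists s; split=> //.
apply/eqP; rewrite -subr_eq0; apply/eqP.
pose S := s ^+ 2.
have S0 : 0 <= S by exact: sqr_ge0.
pose dl := (1 + 2 * S + 2 * v)^-1.
have dl0 : 0 < dl by rewrite invr_gt0; lra.
apply: (@tangent0 _ _ (2 * v * S + v ^+ 2 * S) dl) => // r.
rewrite ler_norml => /andP[r1 r2].
have dlE : dl * (1 + 2 * S + 2 * v) = 1 by rewrite mulVf// gt_eqF//; lra.
have dl1 : dl <= 1 by nra.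
have q0 : 0 < 1 + 2 * (- r) * S by nra.
have rv : 0 < 1 + r * v by nra.
have := @law_sqr _ _ _ P X 0 s mX HX (- r) q0; rewrite -/S.
under eq_integral do rewrite subr0 opprK.
set q := (1 + 2 * - r * S) in q0 * => E.
have Ie : integrableR P (fun w => expR (r * X w ^+ 2)).
  apply/integrableP; split.
    apply/measurable_EFinP.
    by apply: measurableT_comp => //; exact: measurable_funM.
  under eq_integral do rewrite /= ger0_norm ?expR_ge0//.
  by rewrite E ltry.
move: E; rewrite ExE// => -[E].
have : 1 + r * v <= (Num.sqrt q)^-1.
  rewrite -E -e2 -ExZ// -{1}(Ex_cst P 1) -ExD//; last 2 first.
  - exact: integrableR_cst.
  - exact: integrableR_Z.
  apply: Ex_le => //.
    by apply: integrableR_D; [exact: integrableR_cst|exact: integrableR_Z].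
  by move=> w; exact: expR_ge1Dx.
have sq0 : 0 < Num.sqrt q by rewrite sqrtr_gt0.
rewrite -[leRHS]mul1r ler_pdivlMr// => H.
have {}H : (1 + r * v) ^+ 2 * q <= 1.
  rewrite -(sqr_sqrtr (ltW q0)) -exprMn -[leRHS](expr1n _ 2).
  by rewrite ler_sqr ?nnegrE// mulr_ge0// ltW.
have r3 : - r <= 1 by lra.
have v2S : 0 <= r ^+ 2 * (v ^+ 2 * S) by rewrite mulr_ge0 ?sqr_ge0// mulr_ge0 ?sqr_ge0.
have : r * (r ^+ 2 * (v ^+ 2 * S)) <= r ^+ 2 * (v ^+ 2 * S) by nra.
have : 0 <= (r * v) ^+ 2 by exact: sqr_ge0.
by move: H; rewrite /q; nra.
Qed.

Section properties.
Variables (X : T -> R) (v : R).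
Hypothesis HX : centered_normal X v.

Let mX : measurable_fun setT X := HX.1.

Lemma centered_normal_var_ge0 : 0 <= v.
Proof. by case: HX => _ [_ _ _ _ [s [-> _]]]; exact: sqr_ge0. Qed.

Lemma centered_normal_tilt (h : R -> R) (r : R) : continuous h -> (forall x, 0 <= h x)%R ->
  (\int[P]_w (expR (r * X w) * h (X w))%:E =
  (expR (r ^+ 2 * v / 2))%:E * \int[P]_w (h (X w + r * v))%:E)%E.
Proof.
case: HX => _ [_ _ _ _ [s [-> Hs]]] ch h0.
by rewrite (@law_tilt _ _ _ P X 0 s mX Hs h r ch h0) mulr0 add0r.
Qed.

Lemma centered_normal_exp (r : R) :
  (\int[P]_w (expR (r * X w))%:E = (expR (r ^+ 2 * v / 2))%:E)%E.
Proof.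
have := @centered_normal_tilt (fun=> 1) r (@cst_continuous R R (1:R)) (fun=> ler01).
rewrite integral_cst//= probability_setT !mule1.
by under eq_integral do rewrite mulr1.
Qed.

(** Chernoff bound with the parameter u/V, optimal for variance V. *)
Lemma centered_normal_tail (V u : R) : v <= V -> 0 < V -> 0 <= u ->
  (P [set w | (u <= X w)%R] <= (expR (- (u ^+ 2 / (2 * V))))%:E)%E.
Proof.
move=> vV V0; rewrite le_eqVlt => /predU1P[<-|u0].
  rewrite expr0n/= mul0r oppr0 expR0; apply: probability_le1.
  rewrite -[X in measurable X]setTI; apply: measurable_fun_le => //.
pose X0 : {RV P >-> R} := @mfun_Sub _ _ T R X (mem_set mX).
apply: (le_trans (@chernoff _ _ _ P X0 (u / V) u _)); first exact: divr_gt0.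
rewrite /mmt_gen_fun unlock /=.
have -> : (\int[P]_w (expR (X w * (u / V)))%:E)%E = (expR ((u / V) ^+ 2 * v / 2))%:E.
  by rewrite -centered_normal_exp; under eq_integral do rewrite mulrC.
rewrite -EFinM lee_fin -expRD ler_expR.
have -> : - (u / V * u) = - (u ^+ 2 / (2 * V)) - (u / V) ^+ 2 * V / 2.
  by field; rewrite gt_eqF.
rewrite addrCA gerDl subr_le0 ler_pM2r// ler_pM2l// exprn_gt0// divr_gt0//.
Qed.

Let bnd (h : R -> R) : continuous h -> (forall x, `|h x| <= 1) -> integrableR P (fun w => h (X w)).
Proof.
move=> ch h1; apply: (@bounded_integrable _ _ _ _ _ 1) => //.
by apply: measurableT_comp => //; exact: continuous_measurable_fun.
Qed.

Let caff (a b : R) : continuous (fun x : R => a * x + b).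
Proof. by move=> x; apply: cvgD; [apply: cvgM; [exact: cvg_cst|exact: cvg_id]|exact: cvg_cst]. Qed.

Let ccos (a b : R) : continuous (fun x : R => cos (a * x + b)).
Proof. by move=> x; apply: continuous_comp; [exact: caff|exact: continuous_cos]. Qed.

Let csin (a b : R) : continuous (fun x : R => sin (a * x + b)).
Proof. by move=> x; apply: continuous_comp; [exact: caff|exact: continuous_sin]. Qed.

Let I1 : integrableR P X. Proof. by case: HX => _ []. Qed.
Let e1 : Ex P X = 0. Proof. by case: HX => _ []. Qed.
Let I2 : integrableR P (fun w => X w ^+ 2). Proof. by case: HX => _ []. Qed.
Let e2 : Ex P (fun w => X w ^+ 2) = v. Proof. by case: HX => _ []. Qed.

Let Icos a b : integrableR P (fun w => cos (a * X w + b)).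
Proof. exact: (@bnd (fun x => cos (a * x + b)) (@ccos a b) (fun x => cos_max _)). Qed.

Let Isin a b : integrableR P (fun w => sin (a * X w + b)).
Proof. exact: (@bnd (fun x => sin (a * x + b)) (@csin a b) (fun x => sin_max _)). Qed.

Let IXsin a b : integrableR P (fun w => X w * sin (a * X w + b)).
Proof.
apply: (@integrableR_le _ _ _ _ _ (fun w => 1 + X w ^+ 2)).
- apply: measurable_funM => //.
  by apply: (measurableT_comp (continuous_measurable_fun (@csin a b))).
- by apply: integrableR_D => //; exact: integrableR_cst.
- move=> w; rewrite normrM; have h1 := sin_max (a * X w + b).
  rewrite (le_trans (ler_piMr _ h1))//.
  rewrite -[X w ^+ 2]real_normK ?num_real//; have := normr_ge0 (X w); nra.
Qed.

(* Gaussian integration by parts, read off from the first order in r of the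
   exponential tilt. *)
Let stein a b :
  Ex P (fun w => X w * sin (a * X w + b)) = a * v * Ex P (fun w => cos (a * X w + b)).
Proof.
apply/eqP; rewrite -subr_eq0; apply/eqP.
set Q := Ex P _; set C := Ex P _.
pose S := Ex P (fun w => sin (a * X w + b)).
have v0 := centered_normal_var_ge0.
pose A := a * v; pose B := v / 2 * expR (v / 2).
apply: (@tangent0 _ _ (B * (2 + `|A| + 3 * A ^+ 2) + 3 * A ^+ 2) 1) => // r r1.
have r21 : r ^+ 2 <= 1.
  by rewrite -[r ^+ 2]real_normK ?num_real// expr_le1.
have B0 : 0 <= B by rewrite mulr_ge0 ?expR_ge0// divr_ge0.
have eB : expR (r ^+ 2 * v / 2) <= 1 + r ^+ 2 * B.
  set z := r ^+ 2 * v / 2.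
  have z0 : 0 <= z by rewrite /z divr_ge0// mulr_ge0// sqr_ge0.
  have zv : z <= v / 2 by rewrite /z ler_pM2r// ler_piMl.
  have : expR z * (1 - z) <= 1.
    by rewrite -[leRHS](expRxMexpNx_1 z) ler_pM2l ?expR_gt0// expR_ge1Dx.
  have : z * expR z <= z * expR (v / 2) by rewrite ler_wpM2l// ler_expR.
  have -> : r ^+ 2 * B = z * expR (v / 2) by rewrite /z /B; field.
  by lra.
have := @centered_normal_tilt (fun x => 1 + sin (a * x + b)) r.
have c1 : continuous (fun x : R => 1 + sin (a * x + b)).
  by move=> x; apply: cvgD; [exact: cvg_cst|exact: csin].
have p1 (x : R) : 0 <= 1 + sin (a * x + b).
  by have := sin_geN1 (a * x + b); lra.
have eqs w : 1 + sin (a * (X w + r * v) + b) = 1 + sin (a * X w + (a * r * v + b)).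
  by congr (1 + sin _); ring.
move=> /(_ c1 p1); under [in RHS]eq_integral do rewrite eqs.
have I3 : integrableR P (fun w => 1 + sin (a * X w + (a * r * v + b))).
  by apply: integrableR_D => //; exact: integrableR_cst.
have I4 : integrableR P (fun w => 1 + sin (a * X w + b)).
  by apply: integrableR_D => //; exact: integrableR_cst.
rewrite (ExE I3) -EFinM => E.
have I5 : integrableR P (fun w => expR (r * X w) * (1 + sin (a * X w + b))).
  apply/integrableP; split.
    apply/measurable_EFinP; apply: measurable_funM.
      by apply: measurableT_comp => //; exact: measurable_funM.
    by apply: (measurableT_comp (continuous_measurable_fun c1)).
  under eq_integral do rewrite /= ger0_norm ?mulr_ge0 ?expR_ge0//.
  by rewrite E ltry.
move: E; rewrite (ExE I5) => -[] E.
have L : 1 + S + r * Q <= Ex P (fun w => expR (r * X w) * (1 + sin (a * X w + b))).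
  have -> : 1 + S + r * Q = Ex P (fun w => (1 + sin (a * X w + b)) + r * (X w + X w * sin (a * X w + b))).
    rewrite ExD//; last by apply: integrableR_Z; exact: integrableR_D.
    rewrite ExD//; last exact: integrableR_cst.
    by rewrite Ex_cst ExZ ?ExD ?e1 ?add0r//; exact: integrableR_D.
  apply: Ex_le => //.
    by apply: integrableR_D => //; apply: integrableR_Z; exact: integrableR_D.
  move=> w; have -> : (1 + sin (a * X w + b)) + r * (X w + X w * sin (a * X w + b)) =
    (1 + r * X w) * (1 + sin (a * X w + b)) by ring.
  by apply: ler_wpM2r => //; exact: expR_ge1Dx.
have U : Ex P (fun w => 1 + sin (a * X w + (a * r * v + b))) <= 1 + S + r * A * C + 3 * (r * A) ^+ 2.
  have -> : 1 + S + r * A * C + 3 * (r * A) ^+ 2 = Ex P (fun w => (1 + sin (a * X w + b))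
     + (r * A * cos (a * X w + b) + 3 * (r * A) ^+ 2)).
    rewrite ExD//; last by apply: integrableR_D; [exact: integrableR_Z|exact: integrableR_cst].
    rewrite ExD//; last exact: integrableR_cst.
    rewrite ExD ?Ex_cst ?ExZ//; [|exact: integrableR_Z|exact: integrableR_cst].
    by rewrite -/S -/C; ring.
  apply: Ex_le => //.
    by apply: integrableR_D => //; apply: integrableR_D; [exact: integrableR_Z|exact: integrableR_cst].
  move=> w; have := sinD_taylor (a * X w + b) (r * A).
  have -> : a * X w + (a * r * v + b) = a * X w + b + r * A by rewrite /A; ring.
  by lra.
have S1 : `|S| <= 1.
  rewrite -(Ex_cst P 1); apply: Ex_norm_le => //; first exact: integrableR_cst.
  by move=> w; exact: sin_max.
have C1 : `|C| <= 1.
  rewrite -(Ex_cst P 1); apply: Ex_norm_le => //; first exact: integrableR_cst.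
  by move=> w; exact: cos_max.
have rA : (r * A) ^+ 2 <= A ^+ 2.
  by rewrite exprMn ler_piMl// sqr_ge0.
have rAC : `|r * A * C| <= `|A|.
  rewrite !normrM -[leRHS]mulr1 ler_pM// ?mulr_ge0// ler_piMl//.
pose W := 1 + S + r * A * C + 3 * (r * A) ^+ 2.
have W2 : W <= 2 + `|A| + 3 * A ^+ 2.
  by move: S1 rAC; rewrite !ler_norml => /andP[_ ?] /andP[_ ?]; rewrite /W; lra.
have : 1 + S + r * Q <= W + r ^+ 2 * B * (2 + `|A| + 3 * A ^+ 2).
  apply: (le_trans L); rewrite E.
  apply: (@le_trans _ _ (expR (r ^+ 2 * v / 2) * W)).
    by rewrite ler_pM2l ?expR_gt0.
  have K0 : 0 <= r ^+ 2 * B by rewrite mulr_ge0// sqr_ge0.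
  have W0 : 0 <= W.
    apply: (le_trans _ U); rewrite -(Ex_cst P 0); apply: Ex_le => //; first exact: integrableR_cst.
  apply: (@le_trans _ _ ((1 + r ^+ 2 * B) * W)); first by rewrite ler_wpM2r.
  by rewrite mulrDl mul1r lerD2l ler_wpM2l.
rewrite /W -/A exprMn; lra.
Qed.

(** With F a the expectation of cos (a X + b), Gaussian integration by parts reads
F' a = - a v F a, hence F a exp (a^2 v/2) is constant. *)
Lemma centered_normal_cos b : Ex P (fun w => cos (X w + b)) = expR (- (v / 2)) * cos b.
Proof.
pose F a := Ex P (fun w => cos (a * X w + b)).
have dF (a : R) : is_derive a (1 : R) F (- (a * v * F a)).
  apply: (@is_derive_quadratic _ _ _ _ (3 * v)) => h.
  rewrite mulrN opprK -stein -ExZ//.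
  have IB : integrableR P (fun w => cos ((a + h) * X w + b) - cos (a * X w + b)).
    exact: integrableR_B.
  rewrite /F -ExB// -ExD//; last exact: integrableR_Z.
  have -> : 3 * v * h ^+ 2 = Ex P (fun w => 3 * h ^+ 2 * X w ^+ 2).
    by rewrite ExZ// e2; ring.
  apply: Ex_norm_le => [||w].
  - by apply: integrableR_D => //; exact: integrableR_Z.
  - exact: integrableR_Z.
  have := cosD_taylor (a * X w + b) (h * X w).
  have -> : (a + h) * X w + b = a * X w + b + h * X w by ring.
  by rewrite exprMn !mulrA.
pose G a := F a * expR (a ^+ 2 * v / 2).
have dG (a : R) : is_derive a (1 : R) G 0.
  have d1 : is_derive a (1 : R) (fun a : R => (v / 2) *: (a ^+ 2 : R)) (v * a).
    by apply: is_derive_eq; rewrite /GRing.scale/=; field.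
  have d2 : is_derive a (1 : R) (expR \o (fun a : R => (v / 2) *: (a ^+ 2 : R)))
      (expR ((v / 2) *: (a ^+ 2 : R)) * (v * a)).
    exact: is_derive1_comp.
  have -> : G = F * (expR \o (fun a : R => (v / 2) *: (a ^+ 2 : R))).
    apply/funext => z; rewrite /G mulrfctE /=; congr (_ * expR _).
    by rewrite /GRing.scale/=; ring.
  have d0 := dF a.
  by apply: is_derive_eq; rewrite /GRing.scale/=; ring.
have := @is_derive_0_is_cst _ G 1 0 dG.
rewrite /G expr1n expr0n/= !mul0r expR0 mulr1 mul1r => E.
have -> : Ex P (fun w => cos (X w + b)) = F 1.
  by rewrite /F; congr Ex; apply/funext => w; rewrite mul1r.
have -> : cos b = F 0.
  rewrite -(Ex_cst P (cos b)) /F; congr Ex; apply/funext => w.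
  by rewrite mul0r add0r.
by rewrite -E mulrCA -expRD addNr expR0 mulr1.
Qed.

(** The density is at least its value at the right end of the interval. *)
Lemma centered_normal_lower (u h : R) : 0 < v -> 0 <= u -> 0 <= h ->
  ((h / Num.sqrt (2 * pi * v) * expR (- ((u + h) ^+ 2 / (2 * v))))%:E
   <= P [set w | (u <= X w <= u + h)%R])%E.
Proof.
move=> v0 u0 h0.
case: HX => _ [_ _ _ _ [s [vE Hs]]].
have s0 : s != 0 by apply/eqP => sE; move: v0; rewrite vE sE expr0n/= ltxx.
have -> : [set w | (u <= X w <= u + h)%R] = X @^-1` `[u, u + h].
  by apply/seteqP; split => w /=; rewrite in_itv.
rewrite Hs; last exact: measurable_itv.
rewrite (negbTE s0).
have H : (\int[lebesgue_measure]_(x in `[u, (u + h)%R]) (cst ((Num.sqrt (2 * pi * v))^-1 *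
    expR (- ((u + h) ^+ 2 / (2 * v))))%:E x) <= normal_prob 0%R s `[u, (u + h)%R])%E.
  apply: ge0_le_integral => //.
  - by move=> x _; rewrite lee_fin mulr_ge0 ?expR_ge0.
  - apply: measurable_funTS; apply/measurable_EFinP; exact: measurable_normal_pdf.
  - move=> x /=; rewrite in_itv/= => /andP[ux xuh]; rewrite lee_fin normal_pdfE//.
    rewrite /normal_peak /normal_fun subr0 vE.
    have -> : (s ^+ 2 * pi *+ 2) = 2 * pi * s ^+ 2 by ring.
    rewrite ler_wpM2l// ler_expR mulNr lerN2 -[s ^+ 2 *+ 2]mulr_natl.
    have q0 : 0 <= (2 * s ^+ 2)^-1 by rewrite invr_ge0 mulr_ge0// sqr_ge0.
    apply: (ler_wpM2r q0).
    by rewrite ler_sqr ?nnegrE//; lra.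
apply: le_trans H; rewrite integral_cst//= lebesgue_measure_itv/= lte_fin ltrDl.
have [->|hn0] := eqVneq h 0; first by rewrite ltxx mul0r mul0r mule0.
rewrite lt_neqAle eq_sym hn0 h0/= -EFinB -EFinM lee_fin.
by rewrite le_eqVlt; apply/orP; left; apply/eqP; ring.
Qed.
End properties.
End normal_rv.

(** * Covariance of the solution of the heat equation *)

Section ftc_singular.
Context {R : realType}.
Local Notation mu := (@lebesgue_measure R).

(** The integrand may blow up at b, as (b - r)^(-1/2) does: the integral is
the limit of the integrals over [0, b - b/(n+2)]. *)
Lemma ge0_FTC2_left (f F : R -> R) (b : R) : 0 < b -> continuous F ->
  (forall x, x < b -> is_derive x (1 : R) F (f x)) ->
  (forall x, x < b -> {for x, continuous f}) ->
  (forall x, 0 < x -> x < b -> 0 <= f x) ->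
  (\int[mu]_(x in `]0%R, b[) (f x)%:E = (F b - F 0)%R%:E)%E.
Proof.
move=> b0 cF dF cf f0.
have f00 : 0 <= f 0.
  rewrite leNgt; apply/negP => f0lt.
  have /(_ b0)/cvgrPdist_lt/(_ (- f 0)) := cf 0.
  rewrite oppr_gt0 => /(_ f0lt) [e /= e0 He].
  pose x := Num.min (e / 2) (b / 2).
  have x0 : 0 < x by rewrite lt_min !divr_gt0.
  have xe : x < e by rewrite gt_min ltr_pdivrMr// mulr_natr mulr2n ltrDl e0.
  have xb : x < b by rewrite gt_min [b / 2 < _]ltr_pdivrMr// [b * _]mulr_natr mulr2n ltrDl b0 orbT.
  have := He x; rewrite /= sub0r normrN gtr0_norm// => /(_ xe).
  have := f0 x x0 xb; rewrite ltr_norml => ? /andP[]; lra.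
pose c n : R := b - b / (n.+2)%:R.
have c0 n : 0 < c n.
  rewrite subr_gt0 ltr_pdivrMr ?ltr0n// -[X in X < _]mulr1 ltr_pM2l//.
  by rewrite ltr1n.
have cb n : c n < b by rewrite gtrBl divr_gt0 ?ltr0n.
pose E n : set R := [set` `[0, c n]].
have nd : {homo c : n m / (n <= m)%N >-> n <= m}.
  move=> n m nm; rewrite lerD2l lerN2 ler_pM2l// lef_pV2 ?posrE ?ltr0n//.
  by rewrite ler_nat.
have UE : \bigcup_n E n = `[0, b[%classic.
  apply/seteqP; split => [x [n _]|x]; rewrite /E /= !in_itv/=.
    by move=> /andP[-> xc]; rewrite (le_lt_trans xc).
  move=> /andP[x0 xb].
  pose n := Num.truncn (b / (b - x)).
  exists n => //=; rewrite in_itv/= x0/=.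
  have : b / (b - x) < (n.+2)%:R.
    apply: (@lt_trans _ _ (n.+1)%:R); last by rewrite ltr_nat.
    exact: truncnS_gt.
  rewrite ltr_pdivrMr ?subr_gt0// => H; rewrite /c lerBrDr -lerBrDl.
  by rewrite ler_pdivrMr ?ltr0n// mulrC; apply/ltW.
have fE n : (\int[mu]_(x in E n) (f x)%:E = (F (c n) - F 0)%R%:E)%E.
  rewrite (@continuous_FTC2 _ f F 0 (c n))//.
  - apply: continuous_in_subspaceT => x; rewrite inE/= in_itv/= => /andP[_ xc].
    by apply: cf; apply: (le_lt_trans xc).
  - split.
    + move=> x; rewrite in_itv/= => /andP[_ xc].
      by have [] := dF x (lt_trans xc (cb n)).
    + by apply: cvg_at_right_filter; exact: cF.
    + by apply: cvg_at_left_filter; exact: cF.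
  - move=> x; rewrite in_itv/= => /andP[_ xc].
    by rewrite derive1E; have [_ ->] := dF x (lt_trans xc (cb n)).
have mf : forall n, measurable_fun (E n) (EFin \o f).
  move=> n; apply/measurable_EFinP; rewrite /E; apply: subspace_continuous_measurable_fun => //.
  apply: (@continuous_in_subspaceT _ _ [set` `[0, c n]] f) => x; rewrite inE/= in_itv/= => /andP[_ xc].
  by apply: cf; apply: (le_lt_trans xc).
have fge0 : forall n x, E n x -> (0 <= (EFin \o f) x)%E.
  move=> n x; rewrite /E /= in_itv/= => /andP[x0 xc]; rewrite lee_fin.
  move: x0; rewrite le_eqVlt => /predU1P[<-//|x0].
  by apply: f0 => //; apply: (le_lt_trans xc).
have cv := @ge0_nondecreasing_set_cvg_integral _ (measurableTypeR R) R E (EFin \o f) mu _ _ mf fge0.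
have {}cv : (\int[mu]_(x in E i) (EFin \o f) x @[i --> \oo] --> \int[mu]_(x in `[0%R, b[) (EFin \o f) x)%E.
  rewrite -UE; apply: cv; last by move=> n; exact: measurable_itv.
  move=> n m nm; apply/subsetPset => x; rewrite /E /= !in_itv/= => /andP[-> /le_trans]; apply.
  exact: nd.
have -> : (\int[mu]_(x in `]0%R, b[) (f x)%:E = \int[mu]_(x in `[0%R, b[) (f x)%:E)%E.
  apply: (@integral_itv_obnd_cbnd R 0 (BLeft b) (EFin \o f)).
  apply/measurable_EFinP; apply: open_continuous_measurable_fun => //.
  by move=> x; rewrite inE/= in_itv/= => /andP[_ xb]; exact: cf.
rewrite -(cvg_lim (@ereal_hausdorff R) cv); apply: cvg_lim => //.
rewrite (_ : (fun i => _) = (fun n => (F (c n) - F 0)%:E)); last first.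
  by apply/funext => n; exact: fE.
apply: cvg_EFin; first by near=> n.
apply: cvgB; last exact: cvg_cst.
have ccb : c n @[n --> \oo] --> b.
  have : c n @[n --> \oo] --> b - b * 0.
    apply: cvgB; first exact: cvg_cst.
    apply: cvgM; first exact: cvg_cst.
    have := @cvg_harmonic R; rewrite -(cvg_shiftn 1).
    rewrite [X in X @ _](_ : _ = (fun n => (n.+2%:R)^-1))//.
    by apply/funext => n /=; rewrite /harmonic /= addn1.
  by rewrite mulr0 subr0.
exact: (cvg_comp c F ccb (cF b)).
Unshelve. all: by end_near. Qed.

End ftc_singular.

Section heat.
Context {R : realType}.
Implicit Types (t s x y h a b c : R).
Local Notation mu := (@lebesgue_measure R).

Lemma heat_kernel_ge0 t x : 0 <= heat_kernel t x.
Proof. by rewrite /heat_kernel mulr_ge0 ?expR_ge0// invr_ge0. Qed.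

(** Semigroup property: the product of two kernels is a kernel in x - y times a
normal density in z. *)
Lemma heat_kernel_conv a b x y : 0 < a -> 0 < b ->
  (\int[mu]_z (heat_kernel a (z - x) * heat_kernel b (z - y))%:E =
   (heat_kernel (a + b) (x - y))%:E)%E.
Proof.
move=> a0 b0.
have ab0 : 0 < a + b by rewrite addr_gt0.
pose sg := Num.sqrt (a * b / (a + b)).
have q0 : 0 < a * b / (a + b) by rewrite divr_gt0// mulr_gt0.
have sg0 : sg != 0 by rewrite gt_eqF// sqrtr_gt0.
have sg2 : sg ^+ 2 = a * b / (a + b) by rewrite sqr_sqrtr// ltW.
pose m := (x * b + y * a) / (a + b).
have p0 := @pi_gt0 R.
transitivity (\int[mu]_z ((heat_kernel (a + b) (x - y))%:E * (normal_pdf m sg z)%:E))%E.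
  apply: eq_integral => z _; rewrite -EFinM; congr (_%:E).
  rewrite normal_pdfE// /normal_peak /normal_fun sg2 /heat_kernel.
  have nn u : 0 < u -> 0 <= 2 * pi * u by move=> u0; rewrite mulr_ge0 ?mulr_ge0 ?pi_ge0// ltW.
  have ES : Num.sqrt (2 * pi * a) * Num.sqrt (2 * pi * b) =
      Num.sqrt (2 * pi * (a + b)) * Num.sqrt (a * b / (a + b) * pi *+ 2).
    rewrite -!sqrtrM ?nn//; congr Num.sqrt; field; rewrite gt_eqF//.
  have EE : expR (- (z - x) ^+ 2 / (2 * a)) * expR (- (z - y) ^+ 2 / (2 * b)) =
      expR (- (x - y) ^+ 2 / (2 * (a + b))) * expR (- (z - m) ^+ 2 / (a * b / (a + b) *+ 2)).
    rewrite -!expRD; congr expR; rewrite /m; field.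
    by rewrite !gt_eqF.
  rewrite mulrACA EE.
  rewrite (_ : _^-1 * _^-1 = (Num.sqrt (2 * pi * (a + b)))^-1 * (Num.sqrt (a * b / (a + b) * pi *+ 2))^-1).
    by rewrite mulrACA; congr (_ * _); exact: mulrC.
  by rewrite -!invfM ES.
rewrite ge0_integralZl//.
- by rewrite integral_normal_pdf mule1.
- by apply/measurable_EFinP; exact: measurable_normal_pdf.
- by move=> z _; rewrite lee_fin normal_pdf_ge0.
- by rewrite lee_fin heat_kernel_ge0.
Qed.

Let cont_aff c : continuous (fun r : R => c - 2 * r).
Proof.
move=> r; apply: cvgB; first exact: cvg_cst.
by apply: cvgM; [exact: cvg_cst|exact: cvg_id].
Qed.

Let d_aff c r : is_derive r (1 : R) (fun r : R => c - 2 * r) (- 2).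
Proof.
have -> : (fun r : R => c - 2 * r) = (cst c - (2 : R) *: id) by [].
by apply: is_derive_eq; rewrite /GRing.scale/=; ring.
Qed.

Lemma integral_inv_sqrt c b : 0 < b -> 2 * b <= c ->
  (\int[mu]_(r in `]0%R, b[) ((Num.sqrt (c - 2 * r))^-1)%:E =
   (Num.sqrt c - Num.sqrt (c - 2 * b))%:E)%E.
Proof.
move=> b0 bc.
pose F (r : R) : R := - Num.sqrt (c - 2 * r).
have cs : continuous (fun r : R => Num.sqrt (c - 2 * r)).
  by move=> r; apply: continuous_comp; [exact: cont_aff|exact: sqrt_continuous].
have cF : continuous F by move=> r; apply: cvgN; exact: cs.
have dF (r : R) : r < b -> is_derive r (1 : R) F (Num.sqrt (c - 2 * r))^-1.
  move=> rb; have u0 : 0 < c - 2 * r by lra.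
  have d1 := d_aff c r.
  have d2 := is_derive1_sqrt u0.
  have d3 : is_derive r (1 : R) (Num.sqrt \o (fun r : R => c - 2 * r)) ((2 * Num.sqrt (c - 2 * r))^-1 * (- 2)).
    exact: is_derive1_comp.
  have d4 := is_deriveN d3.
  have -> : F = - (Num.sqrt \o (fun r : R => c - 2 * r)) by [].
  apply: (is_derive_eq d4).
  by field; rewrite gt_eqF// sqrtr_gt0.
rewrite (ge0_FTC2_left b0 cF dF).
- by rewrite /F mulr0 subr0 opprK addrC.
- move=> r rb; have u0 : 0 < c - 2 * r by lra.
  by apply: cvgV; [rewrite gt_eqF// sqrtr_gt0|exact: cs].
- by move=> r _ _; rewrite invr_ge0.
Qed.

Lemma integral_inv_sqrt_sqrt c b : 0 < b -> 2 * b <= c ->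
  (\int[mu]_(r in `]0%R, b[)
     ((Num.sqrt (c - 2 * r) * Num.sqrt (Num.sqrt (c - 2 * r)))^-1)%:E =
   (2 * (Num.sqrt (Num.sqrt c) - Num.sqrt (Num.sqrt (c - 2 * b))))%:E)%E.
Proof.
move=> b0 bc.
pose F (r : R) : R := (- 2) * Num.sqrt (Num.sqrt (c - 2 * r)).
have cs : continuous (fun r : R => Num.sqrt (c - 2 * r)).
  by move=> r; apply: continuous_comp; [exact: cont_aff|exact: sqrt_continuous].
have css : continuous (fun r : R => Num.sqrt (Num.sqrt (c - 2 * r))).
  by move=> r; apply: (@continuous_comp _ _ _ (fun r : R => Num.sqrt (c - 2 * r)) Num.sqrt); [exact: cs|exact: sqrt_continuous].
have cF : continuous F by move=> r; apply: cvgM; [exact: cvg_cst|exact: css].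
have dF (r : R) : r < b -> is_derive r (1 : R) F
    (Num.sqrt (c - 2 * r) * Num.sqrt (Num.sqrt (c - 2 * r)))^-1.
  move=> rb; have u0 : 0 < c - 2 * r by lra.
  have d1 := d_aff c r.
  have d2 := is_derive1_sqrt u0.
  have s0 : 0 < Num.sqrt (c - 2 * r) by rewrite sqrtr_gt0.
  have d3 : is_derive r (1 : R) (Num.sqrt \o (fun r : R => c - 2 * r)) ((2 * Num.sqrt (c - 2 * r))^-1 * (- 2)).
    exact: is_derive1_comp.
  have d3' := is_derive1_sqrt s0.
  have d4 : is_derive r (1 : R) (Num.sqrt \o (Num.sqrt \o (fun r : R => c - 2 * r)))
     ((2 * Num.sqrt (Num.sqrt (c - 2 * r)))^-1 * ((2 * Num.sqrt (c - 2 * r))^-1 * (- 2))).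
    exact: is_derive1_comp.
  have d5 := is_deriveZ (- 2 : R) d4.
  have -> : F = (- 2 : R) *: (Num.sqrt \o (Num.sqrt \o (fun r : R => c - 2 * r))) by [].
  apply: (is_derive_eq d5).
  rewrite /GRing.scale/=; field; rewrite !gt_eqF// sqrtr_gt0//.
rewrite (ge0_FTC2_left b0 cF dF).
- by rewrite /F mulr0 subr0; congr (_%:E); ring.
- move=> r rb; have u0 : 0 < c - 2 * r by lra.
  apply: cvgV; first by rewrite gt_eqF// mulr_gt0 ?sqrtr_gt0.
  by apply: cvgM; [exact: cs|exact: css].
- by move=> r _ _; rewrite invr_ge0 mulr_ge0.
Qed.

End heat.

Section measurability.
Context {R : realType} d (D : measurableType d).

(** The inverse as x exp (- ln (x^2)), an expression which is also correct at 0. *)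
Lemma measurable_invr : measurable_fun setT (fun x : R => x^-1).
Proof.
have -> : (fun x : R => x^-1) = (fun x => x * expR (- ln (x ^+ 2))).
  apply/funext => x; have [->|x0] := eqVneq x 0; first by rewrite invr0 mul0r.
  rewrite expRN lnK; last by rewrite posrE -real_normK ?num_real// exprn_gt0// normr_gt0.
  by rewrite expr2 invfM mulrA divff// mul1r.
apply: measurable_funM => //; apply: measurableT_comp => //.
apply: measurableT_comp => //.
apply: (@measurableT_comp _ _ _ _ _ _ (@ln R)); first exact: measurable_ln.
exact: measurable_funX.
Qed.

Lemma measurable_heat_kernel (u v : D -> R) : measurable_fun setT u -> measurable_fun setT v ->
  measurable_fun setT (fun w => heat_kernel (u w) (v w)).
Proof.
move=> mu mv; rewrite /heat_kernel; apply: measurable_funM.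
  apply: measurableT_comp => //; apply: measurable_funM.
    by apply: measurableT_comp => //; exact: measurable_funX.
  by apply: (measurableT_comp measurable_invr); exact: measurable_funM.
apply: (measurableT_comp measurable_invr).
apply: (measurableT_comp (continuous_measurable_fun (@sqrt_continuous R))).
exact: measurable_funM.
Qed.

Lemma measurable_mild_integrand (t x : R) (u v : D -> R) :
  measurable_fun setT u -> measurable_fun setT v ->
  measurable_fun setT (fun w => mild_integrand t x (u w, v w)).
Proof.
move=> mu mv; rewrite /mild_integrand /=.
apply: measurable_fun_ifT => //.
- by apply: measurable_and; exact: measurable_fun_ltr.
- by apply: measurable_heat_kernel; exact: measurable_funB.
Qed.

End measurability.

Section kint.
Context {R : realType}.
Implicit Types (s t h : R).
Local Notation mu := (@lebesgue_measure R).

(** The space integral of a product of two kernels is a kernel, so what remains of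
the covariance of Z(t,x) and Z(s,y), for s <= t and h = x - y, is this time integral. *)
Definition kint t s h : \bar R :=
  (\int[mu]_(r in `]0%R, s[) (heat_kernel (t + s - 2 * r) h)%:E)%E.

Let mh t s h : measurable_fun (`]0, s[ : set R) (fun r : R => heat_kernel (t + s - 2 * r) h).
Proof.
apply: measurable_funTS; apply: measurable_heat_kernel => //.
by apply: measurable_funB => //; exact: measurable_funM.
Qed.

Let Q : R := (Num.sqrt (2 * pi))^-1.
Let Q0 : 0 <= Q. Proof. by rewrite invr_ge0. Qed.

Let hE u h : 0 < u -> heat_kernel u h = Q * (Num.sqrt u)^-1 * expR (- h ^+ 2 / (2 * u)).
Proof.
move=> u0; rewrite /heat_kernel mulrC sqrtrM ?invfM//.
by rewrite mulr_ge0// pi_ge0.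
Qed.

Lemma kint_ge0 t s h : (0 <= kint t s h)%E.
Proof. by apply: integral_ge0 => r _; rewrite lee_fin heat_kernel_ge0. Qed.

Let ms c b : measurable_fun (`]0, b[ : set R) (fun r : R => (Num.sqrt (c - 2 * r))^-1).
Proof.
apply: measurable_funTS; apply: (measurableT_comp measurable_invr).
apply: (measurableT_comp (continuous_measurable_fun (@sqrt_continuous R))).
by apply: measurable_funB => //; exact: measurable_funM.
Qed.

Let mss c b : measurable_fun (`]0, b[ : set R) (fun r : R => (Num.sqrt (c - 2 * r) * Num.sqrt (Num.sqrt (c - 2 * r)))^-1).
Proof.
apply: measurable_funTS; apply: (measurableT_comp measurable_invr).
have m1 : measurable_fun setT (fun r : R => Num.sqrt (c - 2 * r)).
  apply: (measurableT_comp (continuous_measurable_fun (@sqrt_continuous R))).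
  by apply: measurable_funB => //; exact: measurable_funM.
apply: measurable_funM => //.
by apply: (measurableT_comp (continuous_measurable_fun (@sqrt_continuous R))).
Qed.

Ltac measurable_kernel := first [exact: mh | exact: ms | exact: mss].

Lemma kint0 t s : 0 < s -> s <= t ->
  kint t s 0 = (Q * (Num.sqrt (t + s) - Num.sqrt (t - s)))%:E.
Proof.
move=> s0 st; rewrite /kint.
transitivity (\int[mu]_(r in `]0%R, s[) (Q%:E * ((Num.sqrt (t + s - 2 * r))^-1)%:E))%E.
  apply: eq_integral => r; rewrite inE/= in_itv/= => /andP[r0 rs].
  by rewrite hE ?expr0n/= ?oppr0 ?mul0r ?expR0 ?mulr1 ?EFinM//; lra.
rewrite ge0_integralZl//.
- rewrite integral_inv_sqrt// -?EFinM; last lra.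
  by have -> : t + s - 2 * s = t - s by ring.
- by apply/measurable_EFinP; exact: ms.
Qed.

(** In the range of integration the kernel runs for a time at most t + s, which
bounds its Gaussian factor. *)
Lemma kint_le t s h : 0 < s -> s <= t ->
  (kint t s h <= (expR (- h ^+ 2 / (2 * (t + s))))%:E * kint t s 0)%E.
Proof.
move=> s0 st; rewrite /kint -ge0_integralZl//; last 2 first.
- apply/measurable_EFinP; measurable_kernel.
- by move=> r _; rewrite lee_fin heat_kernel_ge0.
apply: ge0_le_integral => //.
- by move=> r _; rewrite lee_fin heat_kernel_ge0.
- apply/measurable_EFinP; measurable_kernel.
- by apply: emeasurable_funM => //; apply/measurable_EFinP; measurable_kernel.
- move=> r; rewrite /= in_itv/= => /andP[r0 rs]; rewrite -EFinM lee_fin.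
  have u0 : 0 < t + s - 2 * r by lra.
  rewrite !hE// expr0n/= oppr0 mul0r expR0 mulr1 mulrC ler_wpM2r//.
    by rewrite mulr_ge0// invr_ge0.
  rewrite ler_expR !mulNr lerN2 ler_wpM2l ?sqr_ge0//.
  by rewrite lef_pV2 ?posrE ?mulr_gt0//; lra.
Qed.

Let exp_sqrt4 (z : R) : 0 <= z -> 1 - Num.sqrt (Num.sqrt z) <= expR (- z).
Proof.
move=> z0; have [z1|z1] := leP z 1.
  apply: (@le_trans _ _ (1 - z)); last exact: expR_ge1Dx.
  rewrite lerD2l lerN2.
  have sz1 : Num.sqrt z <= 1 by rewrite -(sqrtr1 R) ler_wsqrtr.
  have ssz1 : Num.sqrt (Num.sqrt z) <= 1 by rewrite -(sqrtr1 R) ler_wsqrtr.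
  rewrite -{1}(sqr_sqrtr z0) expr2 (le_trans (ler_piMr _ sz1))//.
  by rewrite -{1}(sqr_sqrtr (sqrtr_ge0 z)) expr2 ler_piMr.
apply: (@le_trans _ _ 0); last exact: expR_ge0.
rewrite subr_le0 -(sqrtr1 R) ler_wsqrtr// -(sqrtr1 R) ler_wsqrtr// ltW//.
Qed.

(** The inequality 1 - exp (- z) <= z^(1/4) pays for the Gaussian factor.  A small
power of z is used since it turns the singularity u^(-1/2) of the kernel into
u^(-3/4), which is still integrable. *)
Lemma kint_ge t s h : 0 < s -> s <= t ->
  (kint t s 0 <= kint t s h +
    (Q * (2 * Num.sqrt `|h| * Num.sqrt (Num.sqrt (t + s))))%:E)%E.
Proof.
move=> s0 st.
apply: (@le_trans _ _ (kint t s h + \int[mu]_(r in `]0%R, s[)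
  ((Q * Num.sqrt `|h|)%:E * ((Num.sqrt (t + s - 2 * r) * Num.sqrt (Num.sqrt (t + s - 2 * r)))^-1)%:E))%E).
  rewrite /kint -ge0_integralD//; last 4 first.
  - by move=> r _; rewrite lee_fin heat_kernel_ge0.
  - apply/measurable_EFinP; measurable_kernel.
  - by move=> r _; rewrite -EFinM lee_fin !mulr_ge0// invr_ge0 mulr_ge0.
  - by apply: emeasurable_funM => //; apply/measurable_EFinP; measurable_kernel.
  apply: ge0_le_integral => //.
  - by move=> r _; rewrite lee_fin heat_kernel_ge0.
  - apply/measurable_EFinP; measurable_kernel.
  - apply: emeasurable_funD; first by (apply/measurable_EFinP; measurable_kernel).
    by apply: emeasurable_funM => //; apply/measurable_EFinP; measurable_kernel.
  - move=> r; rewrite /= in_itv/= => /andP[r0 rs]; rewrite -EFinM -EFinD lee_fin.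
    have u0 : 0 < t + s - 2 * r by lra.
    set u := t + s - 2 * r in u0 *.
    rewrite !hE// expr0n/= oppr0 mul0r expR0 mulr1.
    have su0 : 0 < Num.sqrt u by rewrite sqrtr_gt0.
    have ssu0 : 0 < Num.sqrt (Num.sqrt u) by rewrite sqrtr_gt0.
    have -> : Q * Num.sqrt `|h| * (Num.sqrt u * Num.sqrt (Num.sqrt u))^-1 =
      Q * (Num.sqrt u)^-1 * (Num.sqrt `|h| / Num.sqrt (Num.sqrt u)).
      by rewrite invfM; ring.
    rewrite -mulrDr -[leLHS]mulr1 ler_wpM2l//.
      by rewrite mulr_ge0// invr_ge0.
    have z0 : 0 <= h ^+ 2 / (2 * u) by rewrite divr_ge0 ?sqr_ge0// mulr_ge0// ltW.
    have := exp_sqrt4 z0; rewrite -mulNr.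
    suff : Num.sqrt (Num.sqrt (h ^+ 2 / (2 * u))) <= Num.sqrt `|h| / Num.sqrt (Num.sqrt u) by lra.
    rewrite -sqrtrV ?sqrtr_ge0// -sqrtrV ?(ltW u0)// -sqrtrM// ler_wsqrtr//.
    rewrite -sqrtr_sqr -sqrtrM ?sqr_ge0// ler_wsqrtr// ler_wpM2l ?sqr_ge0//.
    by rewrite lef_pV2 ?posrE ?mulr_gt0//; lra.
rewrite leeD2l// ge0_integralZl//.
- rewrite integral_inv_sqrt_sqrt//; last lra.
  rewrite -EFinM lee_fin -!mulrA ler_wpM2l// mulrCA ler_wpM2l// ler_wpM2l//.
  by rewrite gerBl.
- apply/measurable_EFinP; measurable_kernel.
- by rewrite lee_fin mulr_ge0.
Qed.

End kint.

Section mild.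
Context {R : realType}.
Implicit Types (s t x y h : R).
Local Notation mu := (@lebesgue_measure R).

Let mm (t x s y : R) : measurable_fun
    [set: (measurableTypeR R * measurableTypeR R)%type]
    (fun z : (measurableTypeR R * measurableTypeR R)%type =>
       mild_integrand t x z * mild_integrand s y z).
Proof.
have H t' x' : measurable_fun [set: (measurableTypeR R * measurableTypeR R)%type]
    (fun z : (measurableTypeR R * measurableTypeR R)%type => mild_integrand t' x' (z.1, z.2)).
  apply: (@measurable_mild_integrand R _ (measurableTypeR R * measurableTypeR R)%type).
    exact: measurable_fst.
  exact: measurable_snd.
apply: measurable_funM.
  by have := H t x; congr (measurable_fun _ _); apply/funext => -[].
by have := H s y; congr (measurable_fun _ _); apply/funext => -[].
Qed.

Lemma mild_integrand_ge0 t x z : 0 <= mild_integrand t x z.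
Proof. by rewrite /mild_integrand; case: ifP => // _; exact: heat_kernel_ge0. Qed.

(** Tonelli, integrating over space first. *)
Lemma integral_mild_mul t x s y : 0 < s -> s <= t ->
  (\int[@lebesgue2 R]_(z in space_time) (mild_integrand t x z * mild_integrand s y z)%:E
   = kint t s (x - y))%E.
Proof.
move=> s0 st.
rewrite integral_mkcond.
rewrite (_ : _ \_ _ = (fun z => (mild_integrand t x z * mild_integrand s y z)%:E)); last first.
  apply/funext => z; rewrite patchE; case: ifPn => //.
  rewrite notin_setE /space_time/= => /negP; rewrite -leNgt => z0.
  by rewrite /mild_integrand; case: ifP; rewrite ?mul0r// => /andP[]; rewrite ltNge z0.
rewrite /lebesgue2 fubini_tonelli1; last 2 first.
- by apply/measurable_EFinP; exact: mm.
- by move=> z; rewrite lee_fin mulr_ge0// mild_integrand_ge0.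
rewrite /kint [RHS]integral_mkcond; apply: eq_integral => r _.
rewrite /fubini_F patchE; case: ifPn.
  rewrite inE/= in_itv/= => /andP[r0 rs].
  rewrite /mild_integrand/= r0 rs (lt_le_trans rs st)/=.
  rewrite heat_kernel_conv; [|rewrite subr_gt0; exact: lt_le_trans rs st|by rewrite subr_gt0].
  by rewrite (_ : t - r + (s - r) = t + s - 2 * r)//; ring.
rewrite notin_setE/= in_itv/= => /negP rs.
transitivity (\int[mu]_(y0 in setT) (cst 0%E y0))%E; last by rewrite integral0.
apply: eq_integral => z _; rewrite /mild_integrand/=.
by rewrite (negbTE rs) mulr0.
Qed.

Lemma kint_fin_num t s h : 0 < s -> s <= t -> kint t s h \is a fin_num.
Proof.
move=> s0 st; rewrite ge0_fin_numE ?kint_ge0//.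
apply: (le_lt_trans (kint_le h s0 st)).
by rewrite kint0// -EFinM ltry.
Qed.

Lemma square_integrable_mild t x : 0 < t -> square_integrable (mild_integrand t x).
Proof.
move=> t0; split.
  apply: measurable_funTS.
  have H := @measurable_mild_integrand R _ (R * R)%type t x fst snd.
  rewrite (_ : mild_integrand t x = (fun w => mild_integrand t x (w.1, w.2))).
    by apply: H; [exact: measurable_fst|exact: measurable_snd].
  by apply/funext => -[].
apply/integrableP; split.
  apply: (@measurable_funTS _ _ (measurableTypeR R * measurableTypeR R)%type); apply/measurable_EFinP.
  by have := mm t x t x; congr (measurable_fun _ _); apply/funext => z; rewrite expr2.
under eq_integral do rewrite gee0_abs ?lee_fin ?sqr_ge0// expr2.
by rewrite integral_mild_mul// -ge0_fin_numE ?kint_ge0// kint_fin_num.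
Qed.

End mild.

Section aeq.
Context d (T : measurableType d) (R : realType) (P : probability T R).
Implicit Types (X Y : T -> R) (v : R).

Lemma ae_eq_probability (A B : set T) : measurable A -> measurable B ->
  {ae P, forall w, A w <-> B w} -> P A = P B.
Proof.
move=> mA mB AB; rewrite -[A]setIT -[B]setIT -!integral_indic//.
apply: ae_eq_integral => //.
- exact/measurable_EFinP/measurable_indic.
- exact/measurable_EFinP/measurable_indic.
apply: filterS AB => w AB _; congr (_%:E); rewrite !indicE; congr (nat_of_bool _)%:R.
by apply/idP/idP; rewrite !inE; apply AB.
Qed.

(** The solution equals a Wiener integral only almost surely, at each point. *)
Lemma centered_normal_ae X Y v : measurable_fun setT Y ->
  {ae P, forall w, Y w = X w} -> centered_normal P X v -> centered_normal P Y v.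
Proof.
move=> mY XY [mX [I1 e1 I2 e2 [s [vE Hs]]]].
have mX2 : measurable_fun setT (fun w => X w ^+ 2) by exact: measurable_funX.
have mY2 : measurable_fun setT (fun w => Y w ^+ 2) by exact: measurable_funX.
have E1 : (\int[P]_w (Y w)%:E = \int[P]_w (X w)%:E)%E.
  apply: ae_eq_integral => //; [exact/measurable_EFinP|exact/measurable_EFinP|].
  by apply: filterS XY => w -> _.
have E2 : (\int[P]_w (Y w ^+ 2)%:E = \int[P]_w (X w ^+ 2)%:E)%E.
  apply: ae_eq_integral => //; [exact/measurable_EFinP|exact/measurable_EFinP|].
  by apply: filterS XY => w -> _.
apply: gaussian_centered_normal => //.
- exists 0, s => A mA; rewrite -Hs//; apply: ae_eq_probability.
  + by rewrite -[X in measurable X]setTI; exact: mY.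
  + by rewrite -[X in measurable X]setTI; exact: mX.
  + by apply: filterS XY => w /= ->.
- by rewrite E1 ExE// e1.
- by rewrite E2 ExE// e2.
Qed.

End aeq.

Section noise.
Context d (T : measurableType d) (R : realType) (P : probability T R).
Variable xi : (R * R -> R) -> {RV P >-> R}.
Hypothesis hxi : white_noise xi.

Lemma white_noise_mul f g : square_integrable f -> square_integrable g ->
  (\int[P]_w (xi f w * xi g w)%:E =
   \int[@lebesgue2 R]_(z in space_time) (f z * g z)%:E)%E.
Proof.
move=> sf sg; case: hxi => _ h0 hc; rewrite -hc//.
rewrite unlock !h0//= unlock; apply: eq_integral => w _.
by rewrite !fctE /= !subr0.
Qed.

Lemma white_noise_pair f g (A B C a b : R) : square_integrable f -> square_integrable g ->
  (\int[@lebesgue2 R]_(z in space_time) (f z * f z)%:E = A%:E)%E ->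
  (\int[@lebesgue2 R]_(z in space_time) (g z * g z)%:E = B%:E)%E ->
  (\int[@lebesgue2 R]_(z in space_time) (f z * g z)%:E = C%:E)%E ->
  centered_normal P (fun w => a * xi f w + b * xi g w)
    (a ^+ 2 * A + b ^+ 2 * B + 2 * (a * b) * C).
Proof.
move=> sf sg; rewrite -!white_noise_mul// => HA HB HC.
have [hg h0 _] := hxi.
have mf : measurable_fun setT (xi f) by exact: measurable_funPT.
have mg : measurable_fun setT (xi g) by exact: measurable_funPT.
have If2 : integrableR P (fun w => xi f w * xi f w).
  apply/integrableP; split; first by apply/measurable_EFinP; exact: measurable_funM.
  by under eq_integral do rewrite gee0_abs ?lee_fin -?expr2 ?sqr_ge0//;
    rewrite (eq_integral (fun w => (xi f w * xi f w)%:E)) ?HA ?ltry//.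
have Ig2 : integrableR P (fun w => xi g w * xi g w).
  apply/integrableP; split; first by apply/measurable_EFinP; exact: measurable_funM.
  by under eq_integral do rewrite gee0_abs ?lee_fin -?expr2 ?sqr_ge0//;
    rewrite (eq_integral (fun w => (xi g w * xi g w)%:E)) ?HB ?ltry//.
have Ifg : integrableR P (fun w => xi f w * xi g w).
  apply: (@integrableR_le _ _ _ _ _ (fun w => xi f w * xi f w + xi g w * xi g w)).
  - exact: measurable_funM.
  - exact: integrableR_D.
  - move=> w; rewrite ler_norml; set x := xi f w; set y := xi g w.
    by have := sqr_ge0 (x - y); have := sqr_ge0 (x + y); nra.
have I1 h : square_integrable h -> integrableR P (xi h) -> Ex P (xi h) = 0.
  by move=> sh Ih; apply: EFin_inj; rewrite -ExE//; have := h0 h sh; rewrite unlock.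
have Isq (h : T -> R) : measurable_fun setT h -> integrableR P (fun w => h w * h w) -> integrableR P h.
  move=> mh Ih; apply: (@integrableR_le _ _ _ _ _ (fun w => 1 + h w * h w)) => //.
    by apply: integrableR_D => //; exact: integrableR_cst.
  by move=> w; rewrite ler_norml; set x := h w; nra.
have Jf := Isq _ mf If2; have Jg := Isq _ mg Ig2.
apply: gaussian_centered_normal.
- by apply: measurable_funD; exact: measurable_funM.
- have := hg 2%N (fun i : 'I_2 => if i == ord0 then f else g) (fun i => if i == ord0 then a else b).
  have -> : (fun w => \sum_(i < 2) (if i == ord0 then a else b) * xi (if i == ord0 then f else g) w) =
    (fun w => a * xi f w + b * xi g w).
    by apply/funext => w; rewrite !big_ord_recl big_ord0 /= addr0.
  by apply => i; case: ifP.
- rewrite ExE; last by apply: integrableR_D; exact: integrableR_Z.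
  rewrite ExD; [|exact: integrableR_Z|exact: integrableR_Z].
  by rewrite !ExZ// !I1// !mulr0 addr0.
- have -> : (fun w => ((a * xi f w + b * xi g w) ^+ 2)%:E) = (fun w =>
    (a ^+ 2 * (xi f w * xi f w) + b ^+ 2 * (xi g w * xi g w) + 2 * (a * b) * (xi f w * xi g w))%:E).
    by apply/funext => w; congr (_%:E); ring.
  rewrite ExE; last first.
    by apply: integrableR_D; [apply: integrableR_D|]; exact: integrableR_Z.
  rewrite ExD; [|by apply: integrableR_D; exact: integrableR_Z|exact: integrableR_Z].
  rewrite ExD; [|exact: integrableR_Z|exact: integrableR_Z].
  rewrite !ExZ//; congr (_ * _ + _ * _ + _ * _)%:E; apply: EFin_inj; rewrite -ExE//.
Qed.

Variable Z : R -> R -> {RV P >-> R}.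
Hypothesis hZ : continuous_mild_solution xi Z.

Definition heat_cov (t s h : R) : R := fine (kint t s h).

(** Only linear combinations of two values of the solution ever matter: they give
the tails of the values and of the increments, and all two-point characteristic
functions. *)
Lemma heat_pair (t x s y a b : R) : 0 < s -> s <= t ->
  centered_normal P (fun w => a * Z t x w + b * Z s y w)
   (a ^+ 2 * heat_cov t t 0 + b ^+ 2 * heat_cov s s 0 + 2 * (a * b) * heat_cov t s (x - y)).
Proof.
move=> s0 st; have t0 := lt_le_trans s0 st.
have [hz _ _] := hZ.
have st2 := square_integrable_mild x t0.
have ss2 := square_integrable_mild y s0.
have M u z : measurable_fun setT (Z u z) by exact: measurable_funPT.
apply: (@centered_normal_ae _ _ _ _
   (fun w => a * xi (mild_integrand t x) w + b * xi (mild_integrand s y) w)).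
- by apply: measurable_funD; exact: measurable_funM.
- apply: filterS2 (hz t x t0) (hz s y s0) => w -> ->//.
- apply: white_noise_pair => //; rewrite integral_mild_mul ?subrr// fineK// kint_fin_num//.
Qed.

End noise.

Section cov_bounds.
Context {R : realType}.
Implicit Types (t s h : R).

Let Q : R := (Num.sqrt (2 * pi))^-1.

Lemma heat_cov_diag t : 0 < t -> heat_cov t t 0 = Num.sqrt (t / pi).
Proof.
move=> t0; rewrite /heat_cov kint0//= subrr sqrtr0 subr0 mulrC -sqrtrV ?mulr_ge0 ?pi_ge0//.
rewrite -sqrtrM; last lra.
congr Num.sqrt; move: (@pi_gt0 R); generalize (@pi R) => p p0.
by field; rewrite gt_eqF.
Qed.

Lemma heat_cov_ge0 t s h : 0 <= heat_cov t s h.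
Proof. by rewrite /heat_cov fine_ge0// kint_ge0. Qed.

(** At equal times, points further apart than sqrt t are almost uncorrelated. *)
Lemma heat_cov_le t h : 0 < t ->
  heat_cov t t h <= expR (- h ^+ 2 / (4 * t)) * Num.sqrt (t / pi).
Proof.
move=> t0; rewrite -heat_cov_diag// -lee_fin EFinM !fineK ?kint_fin_num//.
have -> : 4 * t = 2 * (t + t) by ring.
exact: kint_le.
Qed.

(** The true order in space is |h|; the weaker sqrt |h| is enough for chaining, at
the price of the factor t^(1/4). *)
Lemma heat_var_incr_le t s h : 0 < s -> s <= t ->
  heat_cov t t 0 + heat_cov s s 0 - 2 * heat_cov t s h <=
  Num.sqrt (t - s) + 4 * Num.sqrt `|h| * Num.sqrt (Num.sqrt t).
Proof.
move=> s0 st; have t0 := lt_le_trans s0 st.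
have H : Q * (Num.sqrt (t + s) - Num.sqrt (t - s)) <=
   heat_cov t s h + Q * (2 * Num.sqrt `|h| * Num.sqrt (Num.sqrt (t + s))).
  by rewrite -lee_fin EFinD fineK ?kint_fin_num// -kint0//; exact: kint_ge.
have D u : 0 < u -> heat_cov u u 0 = Q * Num.sqrt (2 * u).
  by move=> u0; rewrite /heat_cov kint0//= subrr sqrtr0 subr0; congr (_ * Num.sqrt _); ring.
rewrite !D//.
have Q0 : 0 < Q by rewrite invr_gt0 sqrtr_gt0 mulr_gt0 ?pi_gt0.
have Q2 : Q <= 2^-1.
  rewrite lef_pV2 ?posrE ?sqrtr_gt0 ?mulr_gt0 ?pi_gt0//.
  have -> : (2 : R) = Num.sqrt (2 ^+ 2) by rewrite sqrtr_sqr gtr0_norm.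
  by rewrite ler_wsqrtr//; have := @pi_ge2 R; rewrite sqrtr_sqr gtr0_norm//; lra.
have C : Num.sqrt (2 * t) + Num.sqrt (2 * s) <= 2 * Num.sqrt (t + s).
  rewrite -ler_sqr ?nnegrE ?addr_ge0 ?mulr_ge0//.
  have e1 : Num.sqrt (2 * t) ^+ 2 = 2 * t by rewrite sqr_sqrtr// mulr_ge0// ltW.
  have e2 : Num.sqrt (2 * s) ^+ 2 = 2 * s by rewrite sqr_sqrtr// mulr_ge0// ltW.
  have e3 : Num.sqrt (t + s) ^+ 2 = t + s by rewrite sqr_sqrtr// addr_ge0// ltW.
  have := sqr_ge0 (Num.sqrt (2 * t) - Num.sqrt (2 * s)).
  by rewrite exprMn e3; nra.
have S : Num.sqrt (Num.sqrt (t + s)) <= 2 * Num.sqrt (Num.sqrt t).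
  have -> : (2 : R) = Num.sqrt (Num.sqrt (16)).
    have -> : (16 : R) = (2 ^+ 2) ^+ 2 by ring.
    by rewrite !sqrtr_sqr gtr0_norm// ?exprn_gt0// sqrtr_sqr gtr0_norm.
  rewrite -sqrtrM ?sqrtr_ge0// -sqrtrM//.
  by rewrite !ler_wsqrtr//; lra.
have h0 := sqrtr_ge0 `|h|.
have K : 2 * Num.sqrt `|h| * Num.sqrt (Num.sqrt (t + s)) <= 4 * Num.sqrt `|h| * Num.sqrt (Num.sqrt t).
  by have := ler_wpM2l h0 S; lra.
have KK : 0 <= 4 * Num.sqrt `|h| * Num.sqrt (Num.sqrt t) by rewrite !mulr_ge0.
have ts := sqrtr_ge0 (t - s).
set A := 2 * Num.sqrt `|h| * Num.sqrt (Num.sqrt (t + s)) in H K.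
set B := 4 * Num.sqrt `|h| * Num.sqrt (Num.sqrt t) in K KK *.
have H1 : Q * A <= Q * B by rewrite ler_pM2l.
have H2 : Q * (Num.sqrt (2 * t) + Num.sqrt (2 * s)) <= Q * (2 * Num.sqrt (t + s)) by rewrite ler_pM2l.
have H3 : Q * (2 * (Num.sqrt (t - s) + B)) <= 2^-1 * (2 * (Num.sqrt (t - s) + B)).
  by rewrite ler_wpM2r// mulr_ge0// addr_ge0.
by lra.
Qed.

End cov_bounds.

Section Zbounds.
Context d (T : measurableType d) (R : realType) (P : probability T R).
Variables (xi : (R * R -> R) -> {RV P >-> R}) (Z : R -> R -> {RV P >-> R}).
Hypotheses (hxi : white_noise xi) (hZ : continuous_mild_solution xi Z).

Lemma heat_tail (t x u : R) : 0 < t -> 0 <= u ->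
  (P [set w | (u <= Z t x w)%R] <= (expR (- (u ^+ 2 / (2 * Num.sqrt (t / pi)))))%:E)%E.
Proof.
move=> t0 u0.
have H := heat_pair hxi hZ x x 1 0 t0 (lexx t).
have := @centered_normal_tail _ _ _ _ _ _ H (Num.sqrt (t / pi)) u.
have -> : [set w | (u <= 1 * Z t x w + 0 * Z t x w)%R] = [set w | (u <= Z t x w)%R].
  by apply/seteqP; split => w /=; rewrite mul1r mul0r addr0.
apply => //; last by rewrite sqrtr_gt0 divr_gt0// pi_gt0.
by rewrite heat_cov_diag// expr1n expr0n/= mul1r !mulr0 !mul0r !addr0.
Qed.

Lemma heat_incr_tail (t x s y u V : R) : 0 < s -> s <= t -> 0 <= u -> 0 < V ->
  Num.sqrt (t - s) + 4 * Num.sqrt `|x - y| * Num.sqrt (Num.sqrt t) <= V ->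
  (P [set w | (u <= `|Z t x w - Z s y w|)%R] <= (2 * expR (- (u ^+ 2 / (2 * V))))%:E)%E.
Proof.
move=> s0 st u0 V0 HV.
have M t' x' : measurable_fun setT (Z t' x') by exact: measurable_funPT.
have mle (f : T -> R) : measurable_fun setT f -> measurable [set w | (u <= f w)%R].
  by move=> mf; rewrite -[X in measurable X]setTI; apply: measurable_fun_le.
have V1 : heat_cov t t 0 + heat_cov s s 0 - 2 * heat_cov t s (x - y) <= V.
  exact: le_trans (heat_var_incr_le _ s0 st) HV.
have H1 := heat_pair hxi hZ x y 1 (-1) s0 st.
have H2 := heat_pair hxi hZ x y (-1) 1 s0 st.
have B1 := @centered_normal_tail _ _ _ _ _ _ H1 V u.
have B2 := @centered_normal_tail _ _ _ _ _ _ H2 V u.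
apply: (@le_trans _ _ (P [set w | (u <= 1 * Z t x w + -1 * Z s y w)%R] +
   P [set w | (u <= -1 * Z t x w + 1 * Z s y w)%R])%E).
  have m1 : measurable_fun setT (fun w => 1 * Z t x w + -1 * Z s y w).
    by apply: measurable_funD; exact: measurable_funM.
  have m2 : measurable_fun setT (fun w => -1 * Z t x w + 1 * Z s y w).
    by apply: measurable_funD; exact: measurable_funM.
  apply: (@le_trans _ _ (P ([set w | (u <= 1 * Z t x w + -1 * Z s y w)%R] `|`
      [set w | (u <= -1 * Z t x w + 1 * Z s y w)%R]))); last first.
    by apply: measureU2; exact: mle.
  apply: le_measure; rewrite ?inE//.
  - apply: mle; apply: measurableT_comp => //; exact: measurable_funB.
  - by apply: measurableU; exact: mle.
  - move=> w /=; rewrite !mul1r !mulN1r ler_normr => /orP[|]; first by left.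
    by rewrite opprB [Z s y w - _]addrC; right.
rewrite mulr_natl mulr2n EFinD; apply: leeD.
- by apply: B1 => //; move: V1; lra.
- by apply: B2 => //; move: V1; lra.
Qed.

End Zbounds.

(** * Chaining on the unit square *)

Section grid.
Context {R : realType}.
Implicit Types (a : R) (n i : nat).

(** The mesh 64^(-n) has square root 8^(-n), which is the decay of the variance of
increments of the solution between consecutive levels. *)
Definition grid n i : R := i%:R / 64 ^+ n.
Definition grid_index n a : nat := Num.truncn (64 ^+ n * a).

Let p64 n : 0 < 64 ^+ n :> R. Proof. exact: exprn_gt0. Qed.

Lemma grid_ge0 n i : 0 <= grid n i.
Proof. by rewrite divr_ge0// exprn_ge0. Qed.

Lemma grid_lt1 n i : (i < 64 ^ n)%N -> grid n i < 1.
Proof. by move=> H; rewrite ltr_pdivrMr ?p64// mul1r -natrX ltr_nat. Qed.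

Lemma grid_index_itv n a : 0 <= a ->
  (grid_index n a)%:R <= 64 ^+ n * a < (grid_index n a).+1%:R.
Proof. by move=> a0; apply: truncn_itv; rewrite mulr_ge0// exprn_ge0. Qed.

Lemma grid_index_lt n a : 0 <= a -> a < 1 -> (grid_index n a < 64 ^ n)%N.
Proof.
move=> a0 a1; have /andP[H _] := grid_index_itv n a0.
rewrite -(ltr_nat R) natrX (le_lt_trans H)// -[ltRHS]mulr1 ltr_pM2l//.
Qed.

Lemma grid_index_le n a : 0 <= a -> grid n (grid_index n a) <= a.
Proof.
move=> a0; have /andP[H _] := grid_index_itv n a0.
by rewrite /grid ler_pdivrMr// mulrC.
Qed.

Lemma grid_index_gt n a : 0 <= a -> a - (64 ^+ n)^-1 < grid n (grid_index n a).
Proof.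
move=> a0; have /andP[_ H] := grid_index_itv n a0.
rewrite /grid ltr_pdivlMr// mulrBl mulVf ?gt_eqF// mulrC ltrBlDr.
by rewrite natr1.
Qed.

Lemma grid_indexS n a : 0 <= a -> (grid_index n.+1 a %/ 64)%N = grid_index n a.
Proof.
move=> a0; have /andP[H1 H2] := grid_index_itv n.+1 a0.
rewrite [RHS]/grid_index; apply: esym; apply: truncn_def.
set m := grid_index n.+1 a in H1 H2 *.
have e : 64 ^+ n.+1 * a = 64 * (64 ^+ n * a) by rewrite exprS mulrA.
rewrite e in H1 H2.
have k1 : ((m %/ 64) * 64 <= m)%N by exact: leq_divM.
have k2 : (m.+1 <= (m %/ 64).+1 * 64)%N by rewrite ltn_ceil.
rewrite -(ler_nat R) natrM in k1; rewrite -(ler_nat R) natrM in k2.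
by apply/andP; split; lra.
Qed.

Lemma grid_parent n i : grid n (i %/ 64) <= grid n.+1 i /\
  grid n.+1 i - grid n (i %/ 64) <= (64 ^+ n)^-1.
Proof.
have k1 : ((i %/ 64) * 64 <= i)%N by exact: leq_divM.
have k2 : (i.+1 <= (i %/ 64).+1 * 64)%N by rewrite ltn_ceil.
rewrite -(ler_nat R) natrM in k1; rewrite -(ler_nat R) natrM -!natr1 in k2.
have -> : grid n.+1 i = (i%:R / 64) / 64 ^+ n.
  by rewrite /grid exprS invfM mulrA.
rewrite /grid -mulrBl; split.
  by rewrite ler_pM2r ?invr_gt0//; lra.
by rewrite -[leRHS]mul1r ler_pM2r ?invr_gt0//; lra.
Qed.

Lemma grid_cvg a : 0 <= a -> (fun n => grid n (grid_index n a)) @ \oo --> a.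
Proof.
move=> a0.
apply: (@squeeze_cvgr _ _ _ _ (fun n => a - (64 ^+ n)^-1) (fun=> a)).
- by near=> n; rewrite grid_index_le// andbT ltW// grid_index_gt.
- rewrite -[X in _ --> X]subr0; apply: cvgB; first exact: cvg_cst.
  rewrite (_ : (fun n => _) = (fun n => (64^-1 : R) ^+ n)).
    apply: cvg_expr; rewrite ger0_norm ?invr_ge0// invf_lt1//; lra.
  by apply/funext => n; rewrite exprVn.
- exact: cvg_cst.
Unshelve. all: by end_near. Qed.

End grid.

Section chaining.
Context d (T : measurableType d) (R : realType) (P : probability T R).
Variable Y : R -> R -> T -> R.
Hypothesis mY : forall a b, measurable_fun setT (Y a b).
Variable G : R.
Hypothesis G0 : 0 < G.
Hypothesis Hincr : forall n (a b a' b' u : R),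
  0 <= a' -> a' <= a -> a < 1 -> 0 <= b' -> b' <= b -> b < 1 ->
  a - a' <= (64 ^+ n)^-1 -> b - b' <= (64 ^+ n)^-1 -> 0 <= u ->
  (P [set w | (u <= `|Y a b w - Y a' b' w|)%R] <=
    (2 * expR (- (u ^+ 2 * 8 ^+ n / (2 * G))))%:E)%E.

Variable lam : R.
Hypothesis lam0 : 0 < lam.
Hypothesis lamG : 8 * G <= lam ^+ 2.

Let step n : R := lam / (2 ^ n.+1)%:R.

(** The number p encodes a grid point of level n+1 by the quotient and the remainder
modulo 64^(n+1); the quotients by 64 give its parent in the grid of level n. *)
Definition bad_pair n p : set T := [set w | (step n <=
  `|Y (grid n.+1 (p %/ 64 ^ n.+1)) (grid n.+1 (p %% 64 ^ n.+1)) w -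
    Y (grid n (p %/ 64 ^ n.+1 %/ 64)) (grid n (p %% 64 ^ n.+1 %/ 64)) w|)%R].

Definition bad_level n : set T := \big[setU/set0]_(p < 4096 ^ n.+1) bad_pair n p.

Definition bad_chain : set T := \bigcup_n bad_level n.

Let m_pair n p : measurable (bad_pair n p).
Proof.
rewrite -[X in measurable X]setTI; apply: measurable_fun_le => //.
by apply: measurableT_comp => //; exact: measurable_funB.
Qed.

Let m_level n : measurable (bad_level n).
Proof. by apply: bigsetU_measurable => p _. Qed.

Lemma measurable_bad_chain : measurable bad_chain.
Proof. by apply: bigcupT_measurable. Qed.

Definition chain_const : R := 16384 * 26 ^+ 13.

Lemma chain_const_ge0 : 0 <= chain_const.
Proof. by apply: mulr_ge0; [exact: ler0n|apply: exprn_ge0; exact: ler0n]. Qed.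

Let e4096 n : (4096 ^ n.+1 = 64 ^ n.+1 * 64 ^ n.+1)%N.
Proof. by rewrite -expnMn. Qed.

Let P_pair n p : (p < 4096 ^ n.+1)%N ->
  (P (bad_pair n p) <= (2 * expR (- (lam ^+ 2 / (8 * G) * 2 ^+ n)))%:E)%E.
Proof.
rewrite e4096 => pN.
have N0 : (0 < 64 ^ n.+1)%N by rewrite expn_gt0.
have i1 : (p %/ 64 ^ n.+1 < 64 ^ n.+1)%N by rewrite ltn_divLR.
have j1 : (p %% 64 ^ n.+1 < 64 ^ n.+1)%N by rewrite ltn_mod.
have [g1 g2] := @grid_parent R n (p %/ 64 ^ n.+1).
have [g3 g4] := @grid_parent R n (p %% 64 ^ n.+1).
have s0 : 0 <= step n by rewrite divr_ge0// ltW.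
apply: (le_trans (@Hincr n _ _ _ _ (step n) _ g1 _ _ g3 _ g2 g4 s0)); rewrite ?grid_ge0 ?grid_lt1//.
rewrite lee_fin ler_pM2l// ler_expR lerN2.
rewrite le_eqVlt; apply/orP; left; apply/eqP.
rewrite /step natrX [2 ^+ n.+1]exprS.
have -> : (8 : R) ^+ n = 2 ^+ n * (2 ^+ n * 2 ^+ n).
  by rewrite -!exprMn; congr (_ ^+ _); ring.
by field; rewrite gt_eqF//= expf_neq0.
Qed.

Let P_level n : (P (bad_level n) <=
  (chain_const * expR (- (lam ^+ 2 / (16 * G))) / (2 ^ n.+1)%:R)%:E)%E.
Proof.
apply: (le_trans (@Boole_inequality _ _ _ P (bad_pair n) (4096 ^ n.+1) (fun i _ => m_pair n i))).
apply: (@le_trans _ _ (\sum_(i < 4096 ^ n.+1) (2 * expR (- (lam ^+ 2 / (8 * G) * 2 ^+ n)))%:E)%E).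
  by apply: lee_sum => i _; exact: P_pair.
rewrite sumEFin lee_fin sumr_const card_ord -[leLHS]mulr_natl.
set L := lam ^+ 2 / (8 * G).
have L1 : 1 <= L by rewrite ler_pdivlMr ?mul1r// mulr_gt0.
have -> : lam ^+ 2 / (16 * G) = L / 2 by rewrite /L; field; rewrite gt_eqF.
pose z : R := 2 ^+ n.
have z1 : 1 <= z by rewrite exprn_ege1//; lra.
have H1 : expR (- (L * z)) <= expR (- (L / 2)) * expR (- (z / 2)).
  by rewrite -expRD ler_expR; nra.
(* The 13th power of exp (z/26) >= z/26: since 4096 = 2^12, this absorbs the number of
   pairs and leaves a factor 2^(-n). *)
have H2 : expR (- (z / 2)) <= (26 / z) ^+ 13.
  rewrite expRN -[leRHS]invrK lef_pV2 ?posrE ?expR_gt0 ?invr_gt0 ?exprn_gt0 ?divr_gt0//; try lra.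
  rewrite -exprVn invf_div.
  have -> : z / 2 = 13%:R * (z / 26) by field.
  rewrite expRM_natl lerXn2r ?nnegrE ?expR_ge0 ?divr_ge0//; try lra.
  by apply: le_trans (expR_ge1Dx _); rewrite lerDr.
have e0 := expR_ge0 (- (L / 2)).
have -> : (4096 ^ n.+1)%:R = 4096 * z ^+ 12 :> R.
  by rewrite natrX exprS /z exprAC; congr (_ * _ ^+ _); ring.
have -> : ((2 ^ n.+1)%:R : R) = 2 * z by rewrite natrX exprS.
have z0 : 0 <= z by exact: le_trans ler01 z1.
have c0 : 0 <= 4096 * z ^+ 12 by apply: mulr_ge0; [exact: ler0n|exact: exprn_ge0].
have H3 : expR (- (L * z)) <= expR (- (L / 2)) * (26 / z) ^+ 13.
  by apply: (le_trans H1); apply: ler_wpM2l.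
apply: (@le_trans _ _ (4096 * z ^+ 12 * (2 * (expR (- (L / 2)) * (26 / z) ^+ 13)))).
  by apply: (ler_wpM2l c0); rewrite ler_pM2l.
rewrite le_eqVlt; apply/orP; left; apply/eqP.
rewrite /chain_const expr_div_n; set E := expR _.
have zn : z != 0 by rewrite gt_eqF//; lra.
rewrite [z ^+ 13]exprS; field.
by rewrite expf_neq0.
Qed.

(** The thresholds lam/2^(n+1) sum to lam.  At level n the squared threshold over the
variance is of order 2^n lam^2/G, and exp (- 2^n) beats the number 4096^(n+1) of
pairs. *)
Lemma bad_chain_prob :
  (P bad_chain <= (chain_const * expR (- (lam ^+ 2 / (16 * G))))%:E)%E.
Proof.
apply: (le_trans (@generalized_Boole_inequality _ _ _ P bad_level m_level measurable_bad_chain)).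
apply: le_trans (epsilon_trick0 xpredT _); last first.
  by apply: mulr_ge0; [exact: chain_const_ge0|exact: expR_ge0].
apply: lee_nneseries => [n _ _|n _]; [exact: measure_ge0|exact: P_level].
Qed.

(** Walk from the origin to (a, b) along the grid points below it, each a child of
the previous one, and pass to the limit by continuity of the path. *)
Lemma chaining w (a b : R) : 0 <= a -> a < 1 -> 0 <= b -> b < 1 ->
  (forall u v : nat -> R, (forall n, 0 <= u n < 1) -> (forall n, 0 <= v n < 1) ->
    u @ \oo --> a -> v @ \oo --> b -> (fun n => Y (u n) (v n) w) @ \oo --> Y a b w) ->
  ~ bad_chain w -> Y a b w <= Y 0 0 w + lam.
Proof.
move=> a0 a1 b0 b1 cY nb.
pose u n := grid n (grid_index n a) : R.
pose v n := grid n (grid_index n b) : R.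
have hu n : 0 <= u n < 1 by rewrite grid_ge0 (le_lt_trans (grid_index_le n a0)).
have hv n : 0 <= v n < 1 by rewrite grid_ge0 (le_lt_trans (grid_index_le n b0)).
have cv := cY u v hu hv (grid_cvg a0) (grid_cvg b0).
have step1 n : `|Y (u n.+1) (v n.+1) w - Y (u n) (v n) w| < step n.
  rewrite ltNge; apply/negP => H; apply: nb; exists n => //.
  pose p := (grid_index n.+1 a * 64 ^ n.+1 + grid_index n.+1 b)%N.
  have ia := grid_index_lt n.+1 a0 a1; have ib := grid_index_lt n.+1 b0 b1.
  have N0 : (0 < 64 ^ n.+1)%N by rewrite expn_gt0.
  have pN : (p < 4096 ^ n.+1)%N.
    rewrite e4096 /p; set N := (64 ^ n.+1)%N in ia ib N0 *.
    by rewrite (@leq_trans (grid_index n.+1 a * N + N))%N ?ltn_add2l// -mulSnr leq_mul2r ia orbT.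
  rewrite /bad_level -bigcup_mkord; exists p => //=.
  by rewrite /bad_pair/= divnMDl// divn_small// addn0 modnMDl modn_small// !grid_indexS.
have bound n : Y (u n) (v n) w <= Y 0 0 w + lam * (1 - (2 ^+ n)^-1).
  elim: n => [|n IH].
    rewrite expr0 invr1 subrr mulr0 addr0 /u /v /grid_index expr0 !mul1r.
    have -> : Num.truncn a = 0%N by apply/eqP; rewrite truncn_eq// a0.
    have -> : Num.truncn b = 0%N by apply/eqP; rewrite truncn_eq// b0.
    by rewrite /grid !mul0r.
  have := step1 n; rewrite ltr_norml => /andP[_ H].
  move: IH H; rewrite /step natrX.
  have z0 : 0 < (2 : R) ^+ n by exact: exprn_gt0.
  have -> : lam / 2 ^+ n.+1 = lam * (2 ^+ n)^-1 / 2 by rewrite exprS; field; rewrite gt_eqF.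
  have -> : (2 ^+ n.+1)^-1 = (2 ^+ n)^-1 / 2 :> R by rewrite exprS; field; rewrite gt_eqF.
  by lra.
rewrite -(cvg_lim _ cv)//; apply: limr_le; first by apply/cvg_ex; exists (Y a b w).
near=> n; apply: (le_trans (bound n)).
by rewrite lerD2l ler_piMr ?(ltW lam0)// gerBl invr_ge0 exprn_ge0.
Unshelve. all: by end_near. Qed.

End chaining.

(** * Level and time as functions of the height *)

Section level.
Context {R : realType}.
Implicit Types (t y L beta eps a : R).

Definition level beta eps t := beta * t `^ (1 / 4 + eps) / pi `^ (1 / 4).

Definition height_time eps y := (ln y) `^ (1 / (2 * eps)).

Lemma height_timeK eps t : 0 < eps -> 0 < t -> height_time eps (expR (t `^ (2 * eps))) = t.
Proof.
move=> e0 t0; rewrite /height_time expRK -powRrM.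
have -> : 2 * eps * (1 / (2 * eps)) = 1 by field; rewrite gt_eqF.
by rewrite powRr1// ltW.
Qed.

Lemma height_time_pow eps y : 0 < eps -> 1 < y -> (height_time eps y) `^ (2 * eps) = ln y.
Proof.
move=> e0 y1; rewrite /height_time -powRrM.
have -> : 1 / (2 * eps) * (2 * eps) = 1 by field; rewrite gt_eqF.
by rewrite powRr1// ltW// ln_gt0.
Qed.

Lemma height_time_gt0 eps y : 1 < y -> 0 < height_time eps y.
Proof. by move=> y1; rewrite powR_gt0// ln_gt0. Qed.

Lemma height_time_ge1 eps y : 0 < eps -> expR 1 <= y -> 1 <= height_time eps y.
Proof.
move=> e0 ye; rewrite /height_time.
have E : 1 `^ (1 / (2 * eps)) = 1 :> R by rewrite powR1.
rewrite -[leLHS]E.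
have l1 : 1 <= ln y by rewrite -[leLHS]expRK ler_ln// posrE ?expR_gt0// (lt_le_trans (expR_gt0 1)).
apply: ge0_ler_powR => //; rewrite ?nnegrE//; last lra.
by rewrite divr_ge0// mulr_ge0// ltW.
Qed.

Lemma ler_height_time eps x y : 0 < eps -> 1 < x -> x <= y -> height_time eps x <= height_time eps y.
Proof.
move=> e0 x1 xy; have y1 := lt_le_trans x1 xy.
apply: ge0_ler_powR; rewrite ?nnegrE ?(ltW (ln_gt0 _))//.
  by rewrite divr_ge0// mulr_ge0// ltW.
by rewrite ler_ln// posrE; lra.
Qed.

Lemma level_ge0 beta eps t : 0 < beta -> 0 <= level beta eps t.
Proof. by move=> b0; rewrite /level divr_ge0 ?powR_ge0// mulr_ge0 ?powR_ge0// ltW. Qed.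

Lemma level_gt0 beta eps t : 0 < beta -> 0 < t -> 0 < level beta eps t.
Proof. by move=> b0 t0; rewrite /level divr_gt0 ?powR_gt0 ?pi_gt0// mulr_gt0 ?powR_gt0. Qed.

Lemma ler_level beta eps s t : 0 < beta -> 0 < eps -> 0 <= s -> s <= t ->
  level beta eps s <= level beta eps t.
Proof.
move=> b0 e0 s0 st; rewrite /level ler_pM2r ?invr_gt0 ?powR_gt0 ?pi_gt0// ler_pM2l//.
by apply: ge0_ler_powR; rewrite ?nnegrE//; lra.
Qed.

(** The last factor is the variance, so the level over the standard deviation is
beta t^eps, that is beta sqrt (ln y) at the corresponding height y. *)
Lemma level_sqr beta eps t : 0 < t ->
  level beta eps t ^+ 2 = beta ^+ 2 * t `^ (2 * eps) * Num.sqrt (t / pi).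
Proof.
move=> t0; rewrite /level expr_div_n exprMn.
have sq (x p : R) : 0 < x -> (x `^ p) ^+ 2 = x `^ (2 * p).
  move=> x0; rewrite mulrC mulr_natr mulr2n powRD -?expr2//.
  by rewrite (gt_eqF x0) implybT.
rewrite !sq ?pi_gt0//.
have -> : 2 * (1 / 4 + eps) = 2 * eps + 2^-1 :> R by field.
have -> : 2 * (1 / 4) = 2^-1 :> R by field.
rewrite powRD; last by rewrite (gt_eqF t0) implybT.
rewrite !powR12_sqrt ?pi_ge0 ?(ltW t0)//.
by rewrite sqrtrM ?(ltW t0)// sqrtrV ?pi_ge0// !mulrA.
Qed.

(** The derivative of (ln y)^a is a (ln y)^(a-1)/y, which is bounded for y >= e.
Hence a unit square in the picture is, in space and time, a rectangle of bounded
size, whatever its height. *)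
Lemma height_time_step eps : 0 < eps -> exists2 C : R, 0 < C & forall y y' : R,
  expR 1 <= y -> y <= y' -> y' <= y + 1 ->
  height_time eps y' - height_time eps y <= C.
Proof.
move=> e0; pose a : R := 1 / (2 * eps).
have a0 : 0 < a by rewrite divr_gt0// mulr_gt0.
(* a mean value bound, with sup_y (ln y)^a/y = exp (a ln a - a) *)
exists (a * expR a * expR (a * ln a - a)); first by apply: mulr_gt0; [apply: mulr_gt0|]; rewrite ?expR_gt0.
move=> y y' ye yy' y'y; rewrite /height_time -/a.
have e2 : 2 <= expR 1 :> R by have := @expR_ge1Dx R 1; lra.
have y1 : 1 < y by lra.
have y0 : 0 < y by lra.
have y'0 : 0 < y' by lra.
set L := ln y.
have L1 : 1 <= L by rewrite -[leLHS]expRK ler_ln// posrE ?expR_gt0.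
have L0 : 0 < L by lra.
have yE : y = expR L by rewrite /L lnK.
have L'le : ln y' <= L * (1 + y^-1).
  have h1 : ln y' <= ln (y * (1 + y^-1)).
    rewrite ler_ln ?posrE//; last by rewrite mulr_gt0// addr_gt0// invr_gt0.
    by rewrite mulrDr mulr1 divff// gt_eqF.
  apply: (le_trans h1); rewrite lnM ?posrE//; last by rewrite addr_gt0// invr_gt0.
  have iy0 : 0 < y^-1 by rewrite invr_gt0.
  have := @le_ln1Dx R y^-1; rewrite -/L => H.
  have {}H : ln (1 + y^-1) <= y^-1 by apply: H; lra.
  by nra.
have iy0 : 0 < y^-1 by rewrite invr_gt0.
have iy1 : y^-1 <= 1 by rewrite invf_le1//; lra.
have L'0 : 0 <= ln y' by rewrite ltW// ln_gt0//; lra.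
have H1 : (ln y') `^ a <= L `^ a * (1 + y^-1) `^ a.
  rewrite -powRM; [|lra|lra]; apply: ge0_ler_powR; rewrite ?nnegrE ?(ltW a0)//.
  by rewrite mulr_ge0//; lra.
have H2 : (1 + y^-1) `^ a <= 1 + a * y^-1 * expR a.
  rewrite /powR gt_eqF; last lra.
  apply: (@le_trans _ _ (expR (a * y^-1))).
    by rewrite ler_expR ler_pM2l// le_ln1Dx//; lra.
  set z := a * y^-1.
  have z0 : 0 <= z by rewrite mulr_ge0// ltW.
  have za : z <= a by rewrite /z ler_piMr// ltW.
  have : expR z * (1 - z) <= 1.
    by rewrite -[leRHS](expRxMexpNx_1 z) ler_pM2l ?expR_gt0// expR_ge1Dx.
  have : z * expR z <= z * expR a by rewrite ler_wpM2l// ler_expR.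
  by lra.
have La : L `^ a * y^-1 <= expR (a * ln a - a).
  rewrite /powR gt_eqF// yE -expRN -expRD ler_expR.
  have : ln (L / a) <= L / a - 1.
    have La0 : 0 < L / a by rewrite divr_gt0.
    have := @le_ln1Dx R (L / a - 1); rewrite [1 + _]addrC subrK; apply; lra.
  rewrite ln_div ?posrE// => H.
  have : a * (ln L - ln a) <= a * (L / a - 1) by rewrite ler_pM2l.
  have -> : a * (L / a - 1) = L - a by field; rewrite gt_eqF.
  by lra.
have Lp : 0 <= L `^ a by exact: powR_ge0.
have : L `^ a * (1 + y^-1) `^ a <= L `^ a * (1 + a * y^-1 * expR a) by rewrite ler_wpM2l.
have : L `^ a * y^-1 * (a * expR a) <= expR (a * ln a - a) * (a * expR a).
  by rewrite ler_wpM2r// mulr_ge0 ?expR_ge0// ltW.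
by lra.
Qed.

End level.

(** * Peaks in a unit square *)

Section square_prob.
Context d (T : measurableType d) (R : realType) (P : probability T R).
Variables (xi : (R * R -> R) -> {RV P >-> R}) (Z : R -> R -> {RV P >-> R}).
Hypotheses (hxi : white_noise xi) (hZ : continuous_mild_solution xi Z).
Variables (beta eps : R).
Hypotheses (hbeta : 0 < beta) (heps : 0 < eps).

Definition continuous_path (w : T) := {within [set tx : R * R | 0 <= tx.1],
   continuous (fun tx : R * R => Z tx.1 tx.2 w)}.

Lemma continuous_path_cvg w (t x : R) (u v : nat -> R) : continuous_path w -> 0 < t ->
  u @ \oo --> t -> v @ \oo --> x -> (fun n => Z (u n) (v n) w) @ \oo --> Z t x w.
Proof.
move=> cw t0 ut vx.
pose A : set (R * R) := [set tx : R * R | 0 < tx.1].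
have oA : open A.
  have -> : A = fst @^-1` [set z : R | 0 < z] by [].
  apply: open_comp; last exact: open_gt.
  by move=> z _; exact: cvg_fst.
have cA : {within A, continuous (fun tx : R * R => Z tx.1 tx.2 w)}.
  by apply: continuous_subspaceW cw => z /ltW.
move: cA; rewrite continuous_open_subspace// => cA.
have cp : {for (t, x), continuous (fun tx : R * R => Z tx.1 tx.2 w)}.
  by apply: cA; rewrite inE.
exact: (cvg_comp (fun n => (u n, v n)) (fun tx : R * R => Z tx.1 tx.2 w) (cvg_pair ut vx) cp).
Qed.

Variable gam : R.
Hypothesis gam0 : 0 <= gam.
Hypothesis gamb : gam < beta ^+ 2 / 2.

Let sqrt64 n : Num.sqrt ((64 ^+ n)^-1) = (8 ^+ n)^-1 :> R.
Proof.
rewrite sqrtrV ?exprn_ge0//; congr (_^-1).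
have -> : (64 : R) ^+ n = (8 ^+ n) ^+ 2 by rewrite exprAC; congr (_ ^+ _); ring.
by rewrite sqrtr_sqr ger0_norm// exprn_ge0.
Qed.

(** A peak in the square forces either the solution at the corner above 1 - dl times
the level, or an oscillation above dl times the level.  The first event has
probability y0^(- (1 - dl)^2 beta^2/2); for the second the chaining bound is
exp (- ka (ln y0) t0^(1/4)), which is smaller than any power of y0 once t0 is
large.  Below that time the constant exceeds y0^gam and the bound is trivial. *)
Lemma square_prob : exists2 C : R, 0 <= C & forall x0 y0 : R, expR 1 <= y0 ->
  exists E : set T, [/\ measurable E, (P E <= (C * y0 `^ (- gam))%:E)%E &
   forall w, continuous_path w -> ~ E w -> forall p, square (x0, y0) 1 p ->
     ~ tall_peaks (fun t x => Z t x w) beta eps p].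
Proof.
have [C1 C10 HC1] := height_time_step heps.
have b20 : 0 < beta ^+ 2 by rewrite exprn_gt0.
(* chosen so that (1 - dl)^2 beta^2/2 is still at least gam *)
pose dl := (1 - 2 * gam / beta ^+ 2) / 2.
have dl0 : 0 < dl.
  by rewrite divr_gt0// subr_gt0 ltr_pdivrMr// mul1r mulrC -ltr_pdivlMr.
have dl1 : dl < 1.
  have : 0 <= 2 * gam / beta ^+ 2 by rewrite divr_ge0 ?mulr_ge0// ltW.
  by rewrite /dl; lra.
have dlg : gam <= (1 - dl) ^+ 2 * (beta ^+ 2 / 2).
  have -> : gam = (1 - 2 * dl) * (beta ^+ 2 / 2) by rewrite /dl; field; rewrite gt_eqF.
  by rewrite ler_pM2r ?divr_gt0//; have := sqr_ge0 dl; lra.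
pose K := Num.sqrt (2 * C1) + 6 * (1 + 2 * C1).
have K0 : 0 < K by rewrite ltr_wpDl// mulr_gt0//; lra.
have p0 := @pi_gt0 R.
have sp0 : 0 < Num.sqrt pi :> R by rewrite sqrtr_gt0.
pose ka := dl ^+ 2 * beta ^+ 2 / (16 * Num.sqrt pi * K).
have ka0 : 0 < ka.
  by apply: divr_gt0; [apply: mulr_gt0 => //; exact: exprn_gt0|apply: mulr_gt0 => //; exact: mulr_gt0].
pose q1 := gam / ka + 1 / (2 * ka).
have q10 : 0 < q1.
  apply: ltr_wpDl; first by rewrite divr_ge0// ltW.
  by rewrite divr_gt0// mulr_gt0.
pose L1 := (q1 ^+ 4) `^ (2 * eps).
exists (1 + chain_const R + expR (gam * L1)).
  by rewrite addr_ge0 ?expR_ge0// addr_ge0// chain_const_ge0.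
move=> x0 y0 ye.
have e2 : 2 <= expR 1 :> R by have := @expR_ge1Dx R 1; lra.
have y1 : 1 < y0 by lra.
pose t0 := height_time eps y0.
have t01 : 1 <= t0 by exact: height_time_ge1.
have t00 : 0 < t0 by lra.
pose L := ln y0.
have L1' : 1 <= L by rewrite -[leLHS]expRK ler_ln// posrE ?expR_gt0//; lra.
have tL : t0 `^ (2 * eps) = L by exact: height_time_pow.
have yE : y0 `^ (- gam) = expR (- (gam * L)).
  by rewrite /powR gt_eqF ?mulNr//; lra.
pose q := Num.sqrt (Num.sqrt t0).
have q_ge1 : 1 <= q.
  by rewrite /q -(sqrtr1 R) ler_wsqrtr// -(sqrtr1 R) ler_wsqrtr.
have [qq|qq] := ltP q q1.
  exists setT; split; [exact: measurableT| |by move=> w _ /(_ I)].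
  rewrite probability_setT lee_fin yE.
  have LL : L <= L1.
    rewrite -tL /L1; apply: ge0_ler_powR; rewrite ?nnegrE ?(ltW t00) ?mulr_ge0 ?exprn_ge0 ?(ltW heps) ?(ltW q10)//.
    have -> : t0 = q ^+ 4.
      have -> : q ^+ 4 = (q ^+ 2) ^+ 2 by ring.
      by rewrite /q !sqr_sqrtr// ltW.
    by rewrite lerXn2r ?nnegrE ?(ltW q10) ?(ltW qq)//; lra.
  apply: (@le_trans _ _ (expR (gam * L1) * expR (- (gam * L)))).
    rewrite -expRD -[leLHS]expR0 ler_expR.
    have gL : gam * L <= gam * L1 by rewrite ler_wpM2l.
    by lra.
  rewrite ler_wpM2r ?expR_ge0// lerDr addr_ge0// chain_const_ge0//.
pose lam0 := level beta eps t0.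
have lam00 : 0 < lam0 by exact: level_gt0.
have lam0E : lam0 ^+ 2 = beta ^+ 2 * L * Num.sqrt (t0 / pi) by rewrite /lam0 level_sqr// tL.
have sg : Num.sqrt (t0 / pi) = q ^+ 2 / Num.sqrt pi.
  by rewrite /q sqr_sqrtr// sqrtrM ?sqrtrV ?pi_ge0// ltW.
pose Y (a b : R) (w : T) : R := Z (t0 + 2 * C1 * a) (x0 + 2 * b) w.
pose G := K * q.
have G0 : 0 < G by rewrite mulr_gt0//; lra.
pose lam := dl * lam0.
have lam_gt0 : 0 < lam by rewrite mulr_gt0.
have mY a b : measurable_fun setT (Y a b) by exact: measurable_funPT.
have LG : lam ^+ 2 / (16 * G) = ka * L * q.
  rewrite /lam exprMn lam0E sg /ka /G; field.
  by rewrite !gt_eqF//; lra.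
have kq : gam + 2^-1 <= ka * q.
  have -> : gam + 2^-1 = ka * q1.
    by rewrite /q1; field; rewrite gt_eqF.
  by rewrite ler_pM2l.
have lamG : 8 * G <= lam ^+ 2.
  have -> : lam ^+ 2 = (ka * L * q) * (16 * G) by rewrite -LG; field; rewrite gt_eqF//; lra.
  have g0 := gam0.
  have : 2^-1 <= ka * L * q.
    rewrite mulrAC; apply: (@le_trans _ _ (ka * q)); first by lra.
    by rewrite ler_peMr// mulr_ge0 ?(ltW ka0)//; lra.
  by nra.
have Hincr n (a b a' b' u : R) : 0 <= a' -> a' <= a -> a < 1 -> 0 <= b' -> b' <= b -> b < 1 ->
  a - a' <= (64 ^+ n)^-1 -> b - b' <= (64 ^+ n)^-1 -> 0 <= u ->
  (P [set w | (u <= `|Y a b w - Y a' b' w|)%R] <=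
    (2 * expR (- (u ^+ 2 * 8 ^+ n / (2 * G))))%:E)%E.
  move=> a'0 a'a a1 b'0 b'b b1 aa bb u0.
  have e8 : 0 < 8 ^+ n :> R by exact: exprn_gt0.
  have -> : u ^+ 2 * 8 ^+ n / (2 * G) = u ^+ 2 / (2 * (G / 8 ^+ n)).
    by field; rewrite !gt_eqF//; lra.
  have ca' : 0 <= C1 * a' by rewrite mulr_ge0// ltW.
  have caa : C1 * a' <= C1 * a by rewrite ler_wpM2l// ltW.
  have ca : C1 * a <= C1 by rewrite ler_piMr// ltW.
  apply: (heat_incr_tail hxi hZ) => //; [lra|lra|exact: divr_gt0|].
  have -> : t0 + 2 * C1 * a - (t0 + 2 * C1 * a') = (2 * C1) * (a - a') by ring.
  have -> : x0 + 2 * b - (x0 + 2 * b') = 2 * (b - b') by ring.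
  rewrite [`|_|]ger0_norm; last by rewrite mulr_ge0//; lra.
  have H1 : Num.sqrt ((2 * C1) * (a - a')) <= Num.sqrt (2 * C1) / 8 ^+ n.
    rewrite -sqrt64 -sqrtrM; last by rewrite mulr_ge0// ltW.
    by rewrite ler_wsqrtr// ler_wpM2l// mulr_ge0// ltW.
  have H2 : Num.sqrt (2 * (b - b')) <= 3 / 2 / 8 ^+ n.
    apply: (@le_trans _ _ (Num.sqrt ((3 / 2) ^+ 2 * (64 ^+ n)^-1))).
      rewrite ler_wsqrtr//; apply: ler_pM => //; [lra|lra].
    rewrite sqrtrM ?sqr_ge0// sqrtr_sqr sqrt64 ger0_norm//.
  have H3 : Num.sqrt (Num.sqrt (t0 + 2 * C1 * a)) <= (1 + 2 * C1) * q.
    apply: (@le_trans _ _ (Num.sqrt (Num.sqrt (((1 + 2 * C1) ^+ 2) ^+ 2 * t0)))).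
      rewrite !ler_wsqrtr//.
      have h1 : 1 <= 1 + 2 * C1 by lra.
      have : 1 + 2 * C1 <= ((1 + 2 * C1) ^+ 2) ^+ 2.
        by rewrite -exprM; apply: ler_eXnr.
      by nra.
    rewrite sqrtrM ?sqr_ge0// sqrtr_sqr ger0_norm ?sqr_ge0//.
    rewrite sqrtrM ?sqr_ge0// sqrtr_sqr ger0_norm//; lra.
  apply: (@le_trans _ _ (Num.sqrt (2 * C1) / 8 ^+ n + 4 * (3 / 2 / 8 ^+ n) * ((1 + 2 * C1) * q))).
    by apply: lerD => //; apply: ler_pM => //; rewrite ler_pM2l.
  rewrite /G /K.
  have -> : (Num.sqrt (2 * C1) + 6 * (1 + 2 * C1)) * q / 8 ^+ n =
    Num.sqrt (2 * C1) * q / 8 ^+ n + 4 * (3 / 2 / 8 ^+ n) * ((1 + 2 * C1) * q).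
    by field; rewrite gt_eqF.
  by rewrite lerD2r ler_pM2r ?invr_gt0// ler_peMr.
pose E1 := [set w | ((1 - dl) * lam0 <= Z t0 x0 w)%R].
have mE1 : measurable E1.
  by rewrite -[X in measurable X]setTI; apply: measurable_fun_le => //; exact: measurable_funPT.
have mE2 := measurable_bad_chain mY lam.
exists (E1 `|` bad_chain Y lam); split.
- exact: measurableU.
- apply: (@le_trans _ _ (P E1 + P (bad_chain Y lam))%E); first exact: measureU2.
  have PE2 := bad_chain_prob mY G0 Hincr lam_gt0 lamG.
  have PE1 : (P E1 <= (expR (- (((1 - dl) * lam0) ^+ 2 / (2 * Num.sqrt (t0 / pi)))))%:E)%E.
    by apply: (heat_tail hxi hZ) => //; rewrite mulr_ge0 ?(ltW lam00)//; lra.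
  apply: (le_trans (leeD PE1 PE2)).
  rewrite -EFinD lee_fin yE [leRHS]mulrDl [X in _ <= X + _]mulrDl mul1r -addrA; apply: lerD; last first.
    rewrite -[leLHS]addr0; apply: lerD; last by rewrite mulr_ge0 ?expR_ge0.
    apply: ler_wpM2l; first exact: chain_const_ge0.
    rewrite ler_expR lerN2 LG mulrAC ler_wpM2r//; have g0 := gam0; lra.
  rewrite ler_expR lerN2 exprMn lam0E.
  have -> : (1 - dl) ^+ 2 * (beta ^+ 2 * L * Num.sqrt (t0 / pi)) / (2 * Num.sqrt (t0 / pi)) =
    (1 - dl) ^+ 2 * (beta ^+ 2 / 2) * L.
    by field; rewrite gt_eqF// sqrtr_gt0 divr_gt0.
  by rewrite ler_wpM2r//; lra.
- move=> w cw nE p; rewrite /square /= => -[]; rewrite !in_itv/= => /andP[px1 px2] /andP[py1 py2].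
  move=> [t [x [tp pE te Zt]]].
  have xE : p.1 = x by rewrite pE.
  have yE' : p.2 = expR (t `^ (2 * eps)) by rewrite pE.
  rewrite xE in px1 px2.
  have tE : t = height_time eps p.2 by rewrite yE' height_timeK.
  have tt0 : t0 <= t by rewrite tE; apply: ler_height_time => //; exact: ltW.
  have ttC : t - t0 <= C1 by rewrite tE; apply: HC1 => //; exact: ltW.
  pose a := (t - t0) / (2 * C1); pose b := (x - x0) / 2.
  have taE : t0 + 2 * C1 * a = t by rewrite /a; field; rewrite gt_eqF.
  have xbE : x0 + 2 * b = x by rewrite /b; field.
  have a0 : 0 <= a by rewrite divr_ge0 ?subr_ge0// mulr_ge0// ltW.
  have a1 : a < 1 by rewrite ltr_pdivrMr ?mulr_gt0//; lra.
  have b0 : 0 <= b by rewrite /b; lra.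
  have b1 : b < 1 by rewrite /b; lra.
  have nE1 : Z t0 x0 w < (1 - dl) * lam0.
    by rewrite ltNge; apply/negP => H; apply: nE; left.
  have nE2 : ~ bad_chain Y lam w by move=> H; apply: nE; right.
  have := chaining lam_gt0 a0 a1 b0 b1 _ nE2.
  have cvY (u v : nat -> R) : (forall n, 0 <= u n < 1) -> (forall n, 0 <= v n < 1) ->
    u @ \oo --> a -> v @ \oo --> b -> (fun n => Y (u n) (v n) w) @ \oo --> Y a b w.
    move=> _ _ ua vb; apply: continuous_path_cvg => //.
    - by rewrite taE.
    - by apply: cvgD; [exact: cvg_cst|apply: cvgM => //; exact: cvg_cst].
    - by apply: cvgD; [exact: cvg_cst|apply: cvgM => //; exact: cvg_cst].
  move=> /(_ cvY); rewrite /Y !mulr0 !addr0 taE xbE.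
  have lt : lam0 <= level beta eps t by apply: ler_level => //; exact: ltW.
  move: Zt; rewrite -/(level beta eps t) /lam; lra.
Qed.

End square_prob.

(** * Covering a shell by unit squares *)

Section unit_cover.
Context {R : realType}.
Implicit Types (a b x gam : R).

(** Unit steps from a, the last interval being pushed back inside [a, b]. *)
Definition start a b (j : nat) : R := Num.min (a + j%:R) (b - 1).

Definition starts a b : seq R := [seq start a b j | j <- iota 0 (Num.truncn (b - a)).+1].

Lemma mem_starts a b x : 1 <= b - a -> x \in starts a b -> a <= x /\ x + 1 <= b.
Proof.
move=> ab /mapP[j]; rewrite mem_iota add0n => /andP[_ jn] ->.
rewrite /start; have j0 := ler0n R j; split.
  by rewrite le_min; apply/andP; split; lra.
have : Num.min (a + j%:R) (b - 1) <= b - 1 by rewrite ge_min lexx orbT.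
by lra.
Qed.

Lemma starts_cover a b x : 1 <= b - a -> a < x -> x <= b ->
  exists2 s, s \in starts a b & s < x <= s + 1.
Proof.
move=> ab ax xb.
have [j [j1 j2]] : exists j : nat, j%:R < x - a /\ x - a <= j.+1%:R.
  have xa0 : 0 <= x - a by lra.
  have := truncn_itv xa0; set m := Num.truncn _ => /andP[h1 h2].
  move: h1; rewrite le_eqVlt => /predU1P[h|h1]; last by exists m; split => //; apply: ltW.
  case: m h h2 => [|m] h h2; first by move: h; rewrite /= => h; exfalso; lra.
  by exists m; rewrite -h ltr_nat.
exists (start a b j).
  apply: map_f; rewrite mem_iota add0n ltnS /=.
  by rewrite truncn_ge_nat; lra.
rewrite -natr1 in j2.
rewrite /start; apply/andP; split; first by rewrite gt_min; apply/orP; left; lra.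
case: (leP (a + j%:R) (b - 1)) => h; lra.
Qed.

Lemma size_starts a b : size (starts a b) = (Num.truncn (b - a)).+1.
Proof. by rewrite size_map size_iota. Qed.

Lemma harmonic_le n : \sum_(0 <= j < n.+1) (j.+1%:R)^-1 <= 1 + ln (n.+1%:R) :> R.
Proof.
elim: n => [|n IH]; first by rewrite big_nat1 invr1 ln1 addr0.
rewrite big_nat_recr//=.
have n1 : 0 < n.+1%:R :> R by rewrite ltr0n.
have n2 : 0 < n.+2%:R :> R by rewrite ltr0n.
have : ln (n.+1%:R / n.+2%:R) <= - (n.+2%:R)^-1 :> R.
  have -> : n.+1%:R / n.+2%:R = 1 + - (n.+2%:R)^-1 :> R.
    have frac (u : R) : u + 1 != 0 -> u / (u + 1) = 1 + - (u + 1)^-1 by move=> ?; field.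
    by have := frac n.+1%:R; rewrite natr1; apply; rewrite gt_eqF.
  apply: le_ln1Dx; rewrite ltrN2 invf_lt1// ltr1n//.
rewrite ln_div ?posrE// => H.
by rewrite (le_trans (lerD IH (lexx _)))// -addrA lerD2l -lerBrDr -lerBlDl.
Qed.

(** Comparison with a harmonic sum: j^(- gam) <= n^(1 - gam)/j for 1 <= j <= n. *)
Lemma sum_starts_powR a b gam (M : R) : 1 <= b - a -> 2 <= a -> 0 <= gam -> gam <= 1 -> 
  b - a + 1 <= expR M ->
  \sum_(y <- starts a b) y `^ (- gam) <= expR (M * (1 - gam)) * (1 + M).
Proof.
move=> ab a2 g0 g1 baM.
have ba0 : 0 <= b - a by lra.
set n := Num.truncn (b - a).
have nba : n%:R <= b - a by have /andP[] := truncn_itv ba0.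
have nM : n.+1%:R <= expR M by rewrite -natr1; lra.
have M0 : 0 <= M by rewrite -ler_expR expR0 (le_trans _ nM)// ler1n.
rewrite /starts big_map -/n -[iota 0 n.+1]/(index_iota 0 n.+1).
apply: (@le_trans _ _ (\sum_(0 <= j < n.+1) expR (M * (1 - gam)) * (j.+1%:R)^-1)).
  rewrite !big_nat; apply: ler_sum => j /andP[_ jn].
  have j0 : 0 < j.+1%:R :> R by rewrite ltr0n.
  have jn' : j%:R <= n%:R :> R by rewrite ler_nat.
  have sj : j.+1%:R <= start a b j.
    by rewrite -natr1 /start le_min; apply/andP; split; lra.
  have s0 : 0 < start a b j by exact: lt_le_trans sj.
  apply: (@le_trans _ _ (j.+1%:R `^ (- gam))).
    by rewrite !powRN lef_pV2 ?posrE ?powR_gt0// ge0_ler_powR// nnegrE ltW.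
  have -> : j.+1%:R `^ (- gam) = j.+1%:R `^ (1 - gam) * (j.+1%:R)^-1 :> R.
    rewrite powRD; last by rewrite (gt_eqF j0) implybT.
    by rewrite powRr1 ?ltW// mulrAC divff ?mul1r// gt_eqF.
  rewrite ler_wpM2r ?invr_ge0 ?(ltW j0)// expRM.
  apply: ge0_ler_powR; rewrite ?nnegrE ?expR_ge0 ?(ltW j0)//; first lra.
  by rewrite (le_trans _ nM)// ler_nat.
rewrite -mulr_sumr ler_wpM2l ?expR_ge0//.
apply: (le_trans (harmonic_le n)); rewrite lerD2l.
by rewrite -[leRHS]expRK ler_ln// posrE ?expR_gt0// ltr0n.
Qed.

End unit_cover.

Section corners.
Context {R : realType}.
Implicit Types (a b x gam rho : R) (k : nat).
Local Notation E k := (expR k%:R : R).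

Definition rect_corners a b c e : seq (R * R) :=
  [seq (x, y) | x <- starts a b, y <- starts c e].

(** Above height e, shell k+1 is made of a slab on top of the box of side exp k and
of two slabs on its sides.  The sides are empty for k <= 1, and so is the top for k = 0. *)
Definition corners k : seq (R * R) :=
  (if (1 <= k)%N then rect_corners (- E k.+1) (E k.+1) (E k) (E k.+1) else [::]) ++
  (if (2 <= k)%N then rect_corners (- E k.+1) (- E k) (expR 1) (E k) ++
     rect_corners (E k) (E k.+1) (expR 1) (E k) else [::]).

Let e2 : 2 <= expR 1 :> R. Proof. by have := @expR_ge1Dx R 1; lra. Qed.

Let ES k : E k.+1 = expR 1 * E k.
Proof. by rewrite -expRD addrC natr1. Qed.

Let E1 k : 1 <= E k. Proof. by rewrite -expR0 ler_expR. Qed.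

Let Egap k : 1 <= E k.+1 - E k.
Proof. by rewrite ES; have := E1 k; have := e2; nra. Qed.

Let Egap2 k : (2 <= k)%N -> 1 <= E k - expR 1.
Proof.
move=> k2; have : E 2 <= E k by rewrite ler_expR ler_nat.
have -> : E 2 = expR 1 * expR 1 by rewrite -expRD.
by have := e2; nra.
Qed.

Let Ele k : (1 <= k)%N -> expR 1 <= E k.
Proof. by move=> k1; rewrite ler_expR -[leLHS]/(1%:R) ler_nat. Qed.

Lemma mem_rect_corners a b c e z : 1 <= b - a -> 1 <= e - c -> z \in rect_corners a b c e ->
  [/\ a <= z.1, z.1 + 1 <= b, c <= z.2 & z.2 + 1 <= e].
Proof.
move=> ab ce /allpairsP[[x y] /= [xs ys ->]] /=.
by have [] := mem_starts ab xs; have [] := mem_starts ce ys.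
Qed.

Lemma rect_corners_cover a b c e (p : R * R) : 1 <= b - a -> 1 <= e - c ->
  a < p.1 -> p.1 <= b -> c < p.2 -> p.2 <= e ->
  exists2 z, z \in rect_corners a b c e & square z 1 p.
Proof.
move=> ab ce h1 h2 h3 h4.
have [x xs hx] := starts_cover ab h1 h2.
have [y ys hy] := starts_cover ce h3 h4.
exists (x, y); first by apply/allpairsP; exists (x, y).
by split; rewrite /= in_itv.
Qed.

Lemma corners_shell k z : z \in corners k ->
  square z 1 `<=` shell k.+1 /\ expR 1 <= z.2.
Proof.
have g := Egap k; have h1 := E1 k; have h2 := e2.
rewrite /corners mem_cat => /orP[].
  case: ifP => // k1 /mem_rect_corners[]; [lra|lra|] => z1 z2 z3 z4; split; last by have := Ele k1; lra.
  move=> p []; rewrite /= !in_itv/= => /andP[p1 p2] /andP[p3 p4]; split.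
    by split; rewrite /= in_itv/=; apply/andP; split; lra.
  by move=> []; rewrite /= !in_itv/= => _ /andP[_]; lra.
case: ifP => // k2; have g2 := Egap2 k2; rewrite mem_cat => /orP[] /mem_rect_corners[]; (try lra) => z1 z2 z3 z4; (split; last by []).
- move=> p []; rewrite /= !in_itv/= => /andP[p1 p2] /andP[p3 p4]; split.
    by split; rewrite /= in_itv/=; apply/andP; split; lra.
  by move=> []; rewrite /= !in_itv/= => /andP[h _] _; lra.
- move=> p []; rewrite /= !in_itv/= => /andP[p1 p2] /andP[p3 p4]; split.
    by split; rewrite /= in_itv/=; apply/andP; split; lra.
  by move=> []; rewrite /= !in_itv/= => /andP[_ h] _; lra.
Qed.

Lemma corners_cover k (p : R * R) : shell k.+1 p -> expR 1 < p.2 ->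
  exists2 z, z \in corners k & square z 1 p.
Proof.
move=> [[]]; rewrite /= !in_itv/= => /andP[p1 p2] /andP[p3 p4] nb pe.
have g := Egap k; have h1 := E1 k; have h2 := e2.
have k1 : (1 <= k)%N.
  rewrite lt0n; apply/eqP => k0; move: p4; rewrite k0; lra.
have [py|py] := ltP (E k) p.2.
  have [||||||z zs sz] := @rect_corners_cover (- E k.+1) (E k.+1) (E k) (E k.+1) p; rewrite //; try lra.
  by exists z => //; rewrite /corners k1 mem_cat zs.
have k2 : (2 <= k)%N.
  rewrite ltn_neqAle k1 andbT; apply/eqP => k0; move: py; rewrite -k0; lra.
have g2 := Egap2 k2.
have [px|px] := ltP (E k) p.1.
  have [||||||z zs sz] := @rect_corners_cover (E k) (E k.+1) (expR 1) (E k) p; rewrite //; try lra.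
  by exists z => //; rewrite /corners k2 mem_cat [X in _ || X]mem_cat zs !orbT.
have px' : p.1 <= - E k.
  rewrite leNgt; apply/negP => h; apply: nb; split; rewrite /= in_itv/=; apply/andP; split; lra.
have [||||||z zs sz] := @rect_corners_cover (- E k.+1) (- E k) (expR 1) (E k) p; rewrite //; try lra.
by exists z => //; rewrite /corners k2 mem_cat [X in _ || X]mem_cat zs !orbT.
Qed.

Let sum_rect a b c e gam (M : R) (N : R) : 1 <= b - a -> 1 <= e - c -> 2 <= c -> 0 <= gam -> gam <= 1 ->
  e - c + 1 <= expR M -> b - a + 1 <= N ->
  \sum_(z <- rect_corners a b c e) z.2 `^ (- gam) <= N * (expR (M * (1 - gam)) * (1 + M)).
Proof.
move=> ab ce c2 g0 g1 eM bN.
rewrite /rect_corners big_allpairs /=.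
rewrite (eq_bigr (fun=> \sum_(y <- starts c e) y `^ (- gam)))//.
rewrite big_const_seq count_predT size_starts iter_addr_0 -[leLHS]mulr_natl.
apply: ler_pM => //; first by apply: sumr_ge0 => y _; exact: powR_ge0.
  apply: le_trans bN; rewrite -natr1 lerD2r.
  by rewrite truncn_le; lra.
exact: sum_starts_powR.
Qed.

Lemma corners_sum k gam : 0 <= gam -> gam <= 1 ->
  \sum_(z <- corners k) z.2 `^ (- gam) <=
  3 * (E k.+3 * (expR (k.+2%:R * (1 - gam)) * k.+3%:R)).
Proof.
move=> g0 g1.
have g := Egap k; have h1 := E1 k; have h2 := e2.
have ES1 := ES k; have ES2 := ES k.+1; have ES3 := ES k.+2.
have h3 := E1 k.+1; have h4 := E1 k.+2.
have b1 : E k.+1 + 1 <= E k.+2 by nra.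
have b2 : 2 * E k.+1 + 1 <= E k.+3 by nra.
set B := E k.+3 * _.
have B0 : 0 <= B by rewrite !mulr_ge0 ?expR_ge0.
have BE : E k.+3 * (expR (k.+2%:R * (1 - gam)) * (1 + k.+2%:R)) = B.
  by rewrite /B (_ : 1 + k.+2%:R = k.+3%:R)// addrC natr1.
have -> : 3 * B = B + (B + B) by ring.
rewrite /corners big_cat; apply: lerD.
  case: ifP => k1; last by rewrite big_nil.
  by have h := Ele k1; rewrite -BE; apply: sum_rect; lra.
case: ifP => k2; last by rewrite big_nil addr_ge0.
have g2 := Egap2 k2; rewrite big_cat; apply: lerD.
  by rewrite -BE; apply: sum_rect; lra.
by rewrite -BE; apply: sum_rect; lra.
Qed.

(** The unit squares that may meet A form one particular covering. *)
Lemma shell_content_corners k rho (A : set (R * R)) (B : pred (R * R)) :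
  (forall p, A p -> expR 1 < p.2) ->
  (forall z, z \in corners k -> ~~ B z -> forall p, square z 1 p -> ~ A p) ->
  (shell_content rho k.+1 A <= (expR (- (k.+2%:R * rho)) * \sum_(z <- corners k) (B z)%:R)%:E)%E.
Proof.
move=> Ae HB; apply: ereal_inf_lbound.
pose s := [seq z <- corners k | B z].
exists (size s), (fun i => nth (0, 0) s i), (fun=> 1); split.
  split.
    move=> i; split=> //.
    have : nth (0, 0) s i \in s by rewrite mem_nth.
    by rewrite mem_filter => /andP[_ /corners_shell[]].
  move=> p [Ap Sp]; have [z zs zp] := corners_cover Sp (Ae p Ap).
  have Bz : B z by apply/negPn/negP => nB; exact: (HB z zs nB p zp Ap).
  have zS : z \in s by rewrite mem_filter Bz.
  have zi : (index z s < size s)%N by rewrite index_mem.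
  by exists (Ordinal zi) => //=; rewrite nth_index.
congr (_%:E).
rewrite sumr_const card_ord -[RHS]mulr_natl mulrC; congr (_ * _).
  by rewrite /s size_filter -sum1_count natr_sum [RHS]big_mkcond; apply: eq_bigr => z _; case: (B z).
by rewrite div1r -expRN -expRM mulNr.
Qed.

End corners.

(** * Summability of the contents *)

Section first_moment.
Context d (T : measurableType d) (R : realType) (P : probability T R).

Lemma nneseries_geometric_lty (D r : R) : 0 <= D -> 0 <= r -> r < 1 ->
  (\sum_(k <oo) (D * r ^+ k)%:E < +oo)%E.
Proof.
move=> D0 r0 r1.
have t0 k : (0 <= (D * r ^+ k)%:E)%E by rewrite lee_fin mulr_ge0// exprn_ge0.
apply: (@le_lt_trans _ _ (D / (1 - r))%:E); last by rewrite ltry.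
apply: lime_le; first by apply: is_cvg_nneseries => n _ _; exact: t0.
near=> n; rewrite sumEFin lee_fin -mulr_sumr ler_wpM2l//.
have r10 : 0 < 1 - r by lra.
rewrite -[leRHS]mul1r ler_pdivlMr//.
have : \sum_(0 <= i < n) r ^+ i * (1 - r) = 1 - r ^+ n.
  elim: {+}n => [|m IH]; first by rewrite big_nil expr0; ring.
  by rewrite big_nat_recr//= IH exprS; ring.
by rewrite -mulr_suml => ->; rewrite lerBlDr lerDl exprn_ge0.
Unshelve. all: by end_near. Qed.

(** First-moment form of the Borel-Cantelli lemma: a series of nonnegative variables
with summable means converges almost surely. *)
Lemma ae_summable (F : nat -> T -> R) (D r : R) : 0 <= D -> 0 <= r -> r < 1 ->
  (forall k, measurable_fun setT (F k)) -> (forall k w, 0 <= F k w) ->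
  (forall k, (\int[P]_w (F k w)%:E <= (D * r ^+ k)%:E)%E) ->
  {ae P, forall w, (\sum_(k <oo) (F k w)%:E < +oo)%E}.
Proof.
move=> D0 r0 r1 mF F0 HF.
pose S w := (\sum_(k <oo) (F k w)%:E)%E.
have S0 w : (0 <= S w)%E by apply: nneseries_ge0 => k _ _; rewrite lee_fin.
have mS : measurable_fun setT S.
  by apply: ge0_emeasurable_sum => [k x _ _|k _]; [rewrite lee_fin|exact/measurable_EFinP].
have iS : P.-integrable setT S.
  apply/integrableP; split => //.
  under eq_integral do rewrite gee0_abs//.
  rewrite /S (@integral_nneseries _ _ R P setT measurableT (fun k w => (F k w)%:E)
    (fun k => (measurable_EFinP _ _).2 (mF k)) (fun k w _ => F0 k w)).
  apply: (le_lt_trans _ (nneseries_geometric_lty D0 r0 r1)).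
  apply: lee_nneseries => [n _ _|n _]; last exact: HF.
  by apply: integral_ge0 => w _; rewrite lee_fin.
apply: filterS (integrable_ae measurableT iS) => w /(_ I).
by rewrite ge0_fin_numE.
Qed.

End first_moment.

Section upper.
Context d (T : measurableType d) (R : realType) (P : probability T R).
Variables (xi : (R * R -> R) -> {RV P >-> R}) (Z : R -> R -> {RV P >-> R}).
Hypotheses (hxi : white_noise xi) (hZ : continuous_mild_solution xi Z).
Variables (beta eps : R).
Hypotheses (hbeta : 0 < beta) (heps : 0 < eps).

Lemma shell_content_ge0 rho k (A : set (R * R)) : (0 <= shell_content rho k A)%E.
Proof.
apply: le_ereal_inf_tmp => _ [m [c [r [_ ->]]]]; rewrite lee_fin.
by apply: sumr_ge0 => i _; exact: powR_ge0.
Qed.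

(** The mean of the covering sum over shell k+1 is at most, up to a factor k,
exp (- k rho) exp k exp (k (1 - gam)), which is geometric since rho > 2 - gam. *)
Lemma summable_content gam rho : 0 <= gam -> gam < beta ^+ 2 / 2 -> gam <= 1 ->
  2 - gam < rho ->
  {ae P, forall w, (\sum_(1 <= k <oo)
     shell_content rho k (tall_peaks (fun t x => Z t x w) beta eps) < +oo)%E}.
Proof.
move=> g0 gb g1 grho.
have [C C0 HC] := square_prob hxi hZ hbeta heps g0 gb.
have /choice[E HE] : forall z : R * R, exists E : set T, measurable E /\
   (expR 1 <= z.2 -> (P E <= (C * z.2 `^ (- gam))%:E)%E /\
   forall w, continuous_path Z w -> ~ E w -> forall p, square z 1 p ->
     ~ tall_peaks (fun t x => Z t x w) beta eps p).
  move=> [x y]; have [ye|ye] := leP (expR 1) y.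
    by have [E [mE PE H]] := HC x y ye; exists E; split.
  by exists set0; split => //; rewrite /= leNgt ye.
pose F k w : R := expR (- (k.+2%:R * rho)) * \sum_(z <- corners k) \1_(E z) w.
pose ka := rho - (2 - gam).
have ka0 : 0 < ka by rewrite /ka; lra.
have mE z : measurable (E z) by case: (HE z).
have mF k : measurable_fun setT (F k).
  apply: measurable_funM => //; apply: measurable_sum => z.
  exact: measurable_indic.
have F0 k w : 0 <= F k w.
  by rewrite mulr_ge0 ?expR_ge0// sumr_ge0// => z _; rewrite indicE.
have IF k : (\int[P]_w (F k w)%:E <=
    (6 * C * expR (1 + ka) / ka * (expR (- (ka / 2))) ^+ k)%:E)%E.
  rewrite /F; under eq_integral do rewrite EFinM.
  have mN : measurable_fun setT (fun w => (\sum_(z <- corners k) \1_(E z) w)%:E : \bar R).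
    by apply/measurable_EFinP; apply: measurable_sum => z; exact: measurable_indic.
  have N0 w : setT w -> (0 <= (\sum_(z <- corners k) \1_(E z) w)%:E :> \bar R)%E.
    by move=> _; rewrite lee_fin sumr_ge0// => z _; rewrite indicE.
  have e0 : (0 <= (expR (- (k.+2%:R * rho)))%:E :> \bar R)%E by rewrite lee_fin expR_ge0.
  rewrite ge0_integralZl//.
  under eq_integral do rewrite -sumEFin.
  have mI z : measurable_fun setT (fun w => (\1_(E z) w)%:E : \bar R).
    by apply/measurable_EFinP; exact: measurable_indic.
  have I0 z w : setT w -> (0 <= (\1_(E z) w)%:E :> \bar R)%E.
    by move=> _; rewrite lee_fin indicE.
  rewrite ge0_integral_sum//.
  have S1 : (\sum_(z <- corners k) \int[P]_w (\1_(E z) w)%:E <=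
      \sum_(z <- corners k) (C * z.2 `^ (- gam))%:E)%E.
    rewrite big_seq [leRHS]big_seq; apply: lee_sum => z zk.
    rewrite integral_indic// setIT.
    by have [_ H] := HE z; have [//|] := H _; case: (corners_shell zk).
  apply: (@le_trans _ _ ((expR (- (k.+2%:R * rho)))%:E *
      \sum_(z <- corners k) (C * z.2 `^ (- gam))%:E)%E).
    by rewrite lee_pmul2l// lte_fin expR_gt0.
  rewrite sumEFin -EFinM lee_fin -mulr_sumr.
  have cs := @corners_sum R k gam g0 g1.
  apply: (@le_trans _ _ (expR (- (k.+2%:R * rho)) * (C *
     (3 * (expR k.+3%:R * (expR (k.+2%:R * (1 - gam)) * k.+3%:R)))))).
    by rewrite ler_wpM2l ?expR_ge0// ler_wpM2l.
  have k3 : k.+3%:R <= 2 / ka * expR (ka / 2 * k.+3%:R).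
    have : ka / 2 * k.+3%:R <= expR (ka / 2 * k.+3%:R).
      by apply: le_trans (expR_ge1Dx _); rewrite lerDr.
    have kp : 0 < 2 / ka by rewrite divr_gt0.
    rewrite -(ler_pM2l kp); apply: le_trans.
    by rewrite mulrA (_ : 2 / ka * (ka / 2) = 1) ?mul1r//; field; rewrite gt_eqF.
  apply: (@le_trans _ _ (expR (- (k.+2%:R * rho)) * (C *
     (3 * (expR k.+3%:R * (expR (k.+2%:R * (1 - gam)) * (2 / ka * expR (ka / 2 * k.+3%:R)))))))).
    by do 5!(apply: ler_wpM2l; rewrite ?expR_ge0//).
  have -> : expR (- (k.+2%:R * rho)) * (C *
     (3 * (expR k.+3%:R * (expR (k.+2%:R * (1 - gam)) * (2 / ka * expR (ka / 2 * k.+3%:R)))))) =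
    6 * C / ka * (expR (- (k.+2%:R * rho)) * expR k.+3%:R * expR (k.+2%:R * (1 - gam)) * expR (ka / 2 * k.+3%:R)).
    by field; rewrite gt_eqF.
  have -> : 6 * C * expR (1 + ka) / ka * expR (- (ka / 2)) ^+ k =
     6 * C / ka * (expR (1 + ka) * expR (- (ka / 2)) ^+ k).
    by field; rewrite gt_eqF.
  apply: ler_wpM2l; first by rewrite divr_ge0 ?mulr_ge0// ltW.
  rewrite -expRM_natl -!expRD ler_expR.
  rewrite -[k.+3%:R]natr1 -[k.+2%:R]natr1 -[k.+1%:R]natr1 /ka.
  set K := k%:R; have K0 : 0 <= K by exact: ler0n.
  by lra.
have r0 : 0 <= expR (- (ka / 2)) by exact: expR_ge0.
have r1 : expR (- (ka / 2)) < 1 by rewrite -[ltRHS]expR0 ltr_expR oppr_lt0 divr_gt0.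
have D0 : 0 <= 6 * C * expR (1 + ka) / ka.
  by apply: divr_ge0; [apply: mulr_ge0; [exact: mulr_ge0|exact: expR_ge0]|exact: ltW].
have [_ _ hcont] := hZ.
apply: filterS2 hcont (ae_summable D0 r0 r1 mF F0 IF) => w cw Sw.
rewrite -nneseries_addn; last by move=> k; exact: shell_content_ge0.
apply: le_lt_trans Sw; apply: lee_nneseries => [k _ _|k _]; first exact: shell_content_ge0.
rewrite addn1 /F.
have := @shell_content_corners R k rho (tall_peaks (fun t x => Z t x w) beta eps)
  (fun z => w \in E z).
have -> : \sum_(z <- corners k) (w \in E z)%:R = \sum_(z <- corners k) (\1_(E z) w : R).
  by apply: eq_bigr => z _; rewrite indicE.
apply.
- by move=> p [t [x [_ -> ]]].
- move=> z zk nE p zp; have [_ ze] := corners_shell zk.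
  have [_ /(_ ze)[_]] := HE z; apply => //.
  by move: nE; rewrite notin_setE.
Qed.

End upper.

(** * Content of a set spread over cells *)

Section frostman.
Context {R : realType}.
Implicit Types (u len : R).
Local Notation E k := (expR k%:R : R).

(** Counts the rows and the columns of cells that meet an interval. *)
Lemma card_itv_le n u len (S : {set 'I_n}) : 0 <= len ->
  (forall i, i \in S -> u < (i : nat)%:R <= u + len) -> #|S|%:R <= len + 1.
Proof.
move=> len0 HS.
have [->|[i0 i0S]] := set_0Vmem S; first by rewrite cards0; lra.
pose m := [arg min_(i < i0 in S) (i : nat)].
have [mS mmin] : m \in S /\ forall i, i \in S -> (m <= i)%N.
  by rewrite /m; case: arg_minnP.
pose t := Num.truncn len.
have H : (#|S| <= t.+1)%N.
  have -> : #|S| = size [seq nat_of_ord i | i <- enum S] by rewrite size_map -cardE.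
  rewrite -(size_iota m t.+1); apply: uniq_leq_size.
    by rewrite map_inj_uniq ?enum_uniq//; exact: ord_inj.
  move=> _ /mapP[i iS ->]; rewrite mem_enum in iS.
  rewrite mem_iota (mmin i iS)/= addnS ltnS -leq_subLR.
  have /andP[_ h1] := HS i iS; have /andP[h2 _] := HS m mS.
  by rewrite truncn_ge_nat// natrB ?mmin//; lra.
apply: (@le_trans _ _ t.+1%:R); first by rewrite ler_nat.
by rewrite -natr1 lerD2r truncn_le.
Qed.

Variables (k : nat) (th : R) (b : bool).
Hypotheses (th0 : 0 < th) (th1 : th < 1).

Let l : R := expR (k%:R * th).
(** A square of side r in shell k+1 meets at most 2 r^b rows and r/l + 2 columns
of cells; since r^th <= 4 e l, the product is at most this constant times r^(1 + b - th). *)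
Definition frostman_const : R := 2 * (4 * expR 1 + 2).

(** Mass distribution principle: give unit mass to each marked point, at most one in
each cell.  A square of side r carries at most a constant times r^(1 + b - th), so the
sum over a covering is at least the total mass over that constant. *)
Lemma content_ge (J I : nat) (A : set (R * R)) (G : {set 'I_J * 'I_I})
    (yb : R) (xp : 'I_J * 'I_I -> R) :
  (~~ b -> J = 1%N) ->
  (forall p, p \in G -> A (xp p, yb + (p.1 : nat)%:R)) ->
  (forall p, p \in G -> shell k.+1 (xp p, yb + (p.1 : nat)%:R)) ->
  (forall p, p \in G -> E k + (p.2 : nat)%:R * l < xp p <= E k + (p.2 : nat).+1%:R * l) ->
  ((#|G|%:R / (frostman_const * expR (k.+2%:R * (1 + b%:R - th))))%:E <=
   shell_content (1 + b%:R - th) k.+1 A)%E.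
Proof.
move=> HJ HA HS Hx.
have l0 : 0 < l by exact: expR_gt0.
set rho := 1 + b%:R - th.
have fc0 : 0 < frostman_const.
  by rewrite /frostman_const; have := @expR_gt0 R 1; lra.
apply: le_ereal_inf_tmp => _ [m [c [r [[Hsq Hcov] ->]]]]; rewrite lee_fin.
have -> : \sum_(i < m) (r i / E k.+2) `^ rho = (\sum_(i < m) r i `^ rho) / expR (k.+2%:R * rho).
  rewrite mulr_suml; apply: eq_bigr => i _.
  have [r1 _] := Hsq i.
  by rewrite powRM ?invr_ge0 ?expR_ge0 ?(le_trans ler01 r1)// -expRN -expRM mulNr expRN.
rewrite invfM mulrA ler_pM2r ?invr_gt0 ?expR_gt0// ler_pdivrMr// mulr_suml.
pose Gq (q : 'I_m) := [set p in G | `[< square (c q) (r q) (xp p, yb + (p.1 : nat)%:R) >]].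
have GU : G \subset (\bigcup_(q in 'I_m) Gq q)%SET.
  apply/fintype.subsetP => p pG.
  have [q _ sq] := Hcov _ (conj (HA p pG) (HS p pG)).
  by apply/finset.bigcupP; exists q => //; rewrite inE pG; apply/asboolP.
have Gcard : (#|G| <= \sum_(q < m) #|Gq q|)%N.
  apply: (leq_trans (subset_leq_card GU)).
  elim/big_rec2: _ => [|i x n _ le]; first by rewrite cards0.
  by rewrite (leq_trans (leq_card_setU _ _))// leq_add2l.
apply: (@le_trans _ _ (\sum_(q < m) #|Gq q|%:R)).
  by rewrite -natr_sum ler_nat.
apply: ler_sum => q _.
have [r1 sub] := Hsq q.
have r0 : 0 < r q by lra.
have r4 : r q <= 4 * E k.+1.
  have i1 : shell k.+1 ((c q).1 + r q, (c q).2 + r q).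
    by apply: sub; split; rewrite /= in_itv/=; apply/andP; split; lra.
  have i2 : shell k.+1 ((c q).1 + r q / 2, (c q).2 + r q).
    by apply: sub; split; rewrite /= in_itv/=; apply/andP; split; lra.
  move: i1 => [[/= h1 _] _]; move: i2 => [[/= h2 _] _].
  move: h1 h2; rewrite !in_itv/= => /andP[_ ?] /andP[? _]; lra.
pose S1 : {set _} := imset fst (mem (Gq q)).
pose S2 : {set _} := imset snd (mem (Gq q)).
have GS : (#|Gq q| <= #|S1| * #|S2|)%N.
  rewrite -cardsX; apply: subset_leq_card; apply/fintype.subsetP => -[j i] ji.
  by rewrite inE /=; apply/andP; split; apply/imsetP; exists (j, i).
have C1 : #|S1|%:R <= 2 * r q `^ b%:R.
  case: (boolP b) => hb.
    rewrite powRr1 ?(ltW r0)//.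
    apply: (@le_trans _ _ (r q + 1)); last by lra.
    apply: (@card_itv_le _ ((c q).2 - yb)); first exact: ltW.
    move=> j /imsetP[p]; rewrite inE => /andP[pG /asboolP[_ /=]] + ->.
    by rewrite in_itv/= => /andP[? ?]; apply/andP; split; lra.
  rewrite powRr0 mulr1; apply: (@le_trans _ _ (1%N%:R)); last by rewrite ler_nat.
  by rewrite ler_nat -(HJ hb) -[X in (_ <= X)%N]card_ord max_card.
have C2 : #|S2|%:R <= r q / l + 2.
  have -> : r q / l + 2 = (r q / l + 1) + 1 by ring.
  apply: (@card_itv_le _ (((c q).1 - E k) / l - 1)).
    by rewrite addr_ge0// divr_ge0// ltW.
  move=> i /imsetP[p]; rewrite inE => /andP[pG /asboolP[/= + _]] ->.
  rewrite in_itv/= => /andP[h1 h2]; have /andP[h3 h4] := Hx p pG.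
  have -> : ((c q).1 - E k) / l - 1 + (r q / l + 1) = ((c q).1 + r q - E k) / l.
    by field; rewrite gt_eqF.
  rewrite -natr1 in h4.
  by rewrite ltrBlDr ltr_pdivrMr// ler_pdivlMr//; apply/andP; split; lra.
have rth : r q `^ th <= 4 * expR 1 * l.
  apply: (@le_trans _ _ ((4 * E k.+1) `^ th)).
    by apply: ge0_ler_powR; rewrite ?nnegrE ?(ltW r0) ?(ltW th0) ?mulr_ge0 ?expR_ge0.
  have -> : 4 * E k.+1 = (4 * expR 1) * E k.
    by rewrite -mulrA -expRD [1 + _]addrC natr1.
  rewrite powRM ?mulr_ge0 ?expR_ge0// -expRM ler_pM2r ?expR_gt0//.
  have e1 : 1 <= 4 * expR 1 :> R by have := @expR_ge1Dx R 1; lra.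
  rewrite -[leRHS]powRr1 ?(le_trans ler01)//.
  by apply: ler_powR => //; exact: ltW.
have pth : 0 < r q `^ (1 - th) by exact: powR_gt0.
have rE : r q = r q `^ (1 - th) * r q `^ th.
  rewrite -powRD; first by rewrite subrK powRr1// ltW.
  by rewrite (gt_eqF r0) implybT.
have C3 : r q / l + 2 <= (4 * expR 1 + 2) * r q `^ (1 - th).
  have one : 1 <= r q `^ (1 - th).
    have h := th1; by rewrite -[leLHS](powRr0 (r q)); apply: ler_powR => //; lra.
  have : r q / l <= 4 * expR 1 * r q `^ (1 - th).
    rewrite ler_pdivrMr// {1}rE mulrC [leRHS]mulrAC; rewrite ler_pM2r//.
  lra.
apply: (@le_trans _ _ ((#|S1| * #|S2|)%:R)); first by rewrite ler_nat.
rewrite natrM.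
have -> : r q `^ rho * frostman_const = (2 * r q `^ b%:R) * ((4 * expR 1 + 2) * r q `^ (1 - th)).
  have -> : rho = b%:R + (1 - th) by rewrite /rho; ring.
  rewrite powRD; last by rewrite (gt_eqF r0) implybT.
  by rewrite /frostman_const; ring.
by apply: ler_pM => //; exact: le_trans C2 C3.
Qed.

End frostman.

(** * Second moments of weakly correlated normal variables *)

Section trig_polynomial.
Context {R : realType}.

Lemma cosM_avg (x y : R) : cos x * cos y = (cos (x + y) + cos (x - y)) / 2.
Proof. by rewrite cosD cosB; field. Qed.

(** A power of the cosine is an average of cosines of integer frequencies, since
2 cos x cos (c x) = cos ((c + 1) x) + cos ((c - 1) x). *)
Lemma cos_pow_avg n : exists s : seq R, [/\ size s = (2 ^ n)%N,
  forall c, c \in s -> `|c| <= n%:R &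
  forall x, cos x ^+ n = (2 ^+ n)^-1 * \sum_(c <- s) cos (c * x)].
Proof.
elim: n => [|n [s [sz sn E]]].
  exists [:: 0]; split => //.
  - by move=> c; rewrite inE => /eqP ->; rewrite normr0.
  - by move=> x; rewrite !expr0 invr1 mul1r big_seq1 mul0r cos0.
exists ([seq c + 1 | c <- s] ++ [seq c - 1 | c <- s]); split.
- by rewrite size_cat !size_map sz expnS mul2n addnn.
- move=> c; rewrite mem_cat => /orP[] /mapP[c' /sn c'n ->].
    by rewrite (le_trans (ler_normD _ _))// normr1 -natr1 lerD2r.
  by rewrite (le_trans (ler_normB _ _))// normr1 -natr1 lerD2r.
- move=> x; rewrite exprSr E big_cat /= !big_map -big_split /= exprS invfM -!mulrA.
  rewrite [RHS]mulrCA; congr (_ * _); rewrite mulr_suml mulr_sumr; apply: eq_bigr => c _.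
  by rewrite cosM_avg mulrC; congr (_ * (cos _ + cos _)); ring.
Qed.

Lemma expRN_lip (u v : R) : 0 <= u -> 0 <= v -> `|expR (- u) - expR (- v)| <= `|u - v|.
Proof.
wlog uv : u v / u <= v => [H u0 v0|u0 v0].
  have [uv|/ltW vu] := leP u v; first exact: H.
  by rewrite distrC [leRHS]distrC; exact: H.
rewrite ger0_norm ?subr_ge0 ?ler_expR ?lerN2// ler0_norm ?subr_le0// opprB.
have -> : expR (- v) = expR (- u) * expR (- (v - u)) by rewrite -expRD; congr expR; ring.
have h1 := expR_ge1Dx (- (v - u)).
have h2 : expR (- u) <= 1 by rewrite -[leRHS]expR0 ler_expR oppr_le0.
have h3 := expR_ge0 (- u).
have h4 : expR (- (v - u)) <= 1 by rewrite -[leRHS]expR0 ler_expR oppr_le0 subr_ge0.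
by nra.
Qed.

End trig_polynomial.

Section sums.
Context d (T : measurableType d) (R : realType) (P : probability T R).

Lemma integrableR_sum (I : eqType) (s : seq I) (F : I -> T -> R) :
  (forall i, i \in s -> integrableR P (F i)) -> integrableR P (fun w => \sum_(i <- s) F i w).
Proof.
elim: s => [|i s IH] H.
  rewrite (_ : (fun w => _) = (fun=> 0)); first exact: integrableR_cst.
  by apply/funext => w; rewrite big_nil.
rewrite (_ : (fun w => _) = (fun w => F i w + \sum_(j <- s) F j w)).
  apply: integrableR_D; first by apply: H; rewrite mem_head.
  by apply: IH => j js; apply: H; rewrite inE js orbT.
by apply/funext => w; rewrite big_cons.
Qed.

Lemma Ex_sum (I : eqType) (s : seq I) (F : I -> T -> R) :
  (forall i, i \in s -> integrableR P (F i)) ->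
  Ex P (fun w => \sum_(i <- s) F i w) = \sum_(i <- s) Ex P (F i).
Proof.
elim: s => [|i s IH] H.
  rewrite big_nil (_ : (fun w => _) = (fun=> 0)) ?Ex_cst//.
  by apply/funext => w; rewrite big_nil.
have H' j : j \in s -> integrableR P (F j) by move=> js; apply: H; rewrite inE js orbT.
rewrite (_ : (fun w => _) = (fun w => F i w + \sum_(j <- s) F j w)).
  by rewrite ExD ?IH ?big_cons//; [apply: H; rewrite mem_head|exact: integrableR_sum].
by apply/funext => w; rewrite big_cons.
Qed.

End sums.

Section two_point.
Context d (T : measurableType d) (R : realType) (P : probability T R).
Variables (X Y : T -> R) (r : R).
Hypothesis HXY : forall a b, centered_normal P (fun w => a * X w + b * Y w)
   (a ^+ 2 + b ^+ 2 + 2 * (a * b) * r).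

Let Icos (V : T -> R) v (b : R) : centered_normal P V v ->
  integrableR P (fun w => cos (V w + b)).
Proof.
move=> [mV _]; apply: (@bounded_integrable _ _ _ _ _ 1) => [|w]; last exact: cos_max.
apply: (measurableT_comp (continuous_measurable_fun (@continuous_cos R))).
exact: measurable_funD.
Qed.

(** A product of cosines is an average of two cosines, whose expectations are known.
The correlation r enters only through exp (- a b r), which is Lipschitz in r. *)
Lemma two_point_cos (a b p q : R) :
  `|Ex P (fun w => cos (a * X w + p) * cos (b * Y w + q)) -
    expR (- (a ^+ 2 / 2)) * cos p * (expR (- (b ^+ 2 / 2)) * cos q)| <= `|a * b| * `|r|.
Proof.
have E w : cos (a * X w + p) * cos (b * Y w + q) =
  2^-1 * cos ((a * X w + b * Y w) + (p + q)) + 2^-1 * cos ((a * X w + (- b) * Y w) + (p - q)).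
  have -> : (a * X w + b * Y w) + (p + q) = (a * X w + p) + (b * Y w + q) by ring.
  have -> : (a * X w + (- b) * Y w) + (p - q) = (a * X w + p) - (b * Y w + q) by ring.
  by rewrite cosM_avg; field.
rewrite (_ : (fun w => _) = (fun w => 2^-1 * cos ((a * X w + b * Y w) + (p + q)) +
   2^-1 * cos ((a * X w + (- b) * Y w) + (p - q)))); last by apply/funext => w.
have H1 := HXY a b; have H2 := HXY a (- b).
have I1 := Icos (p + q) H1; have I2 := Icos (p - q) H2.
rewrite ExD ?ExZ//; try exact: integrableR_Z.
rewrite (centered_normal_cos H1) (centered_normal_cos H2).
have v1 := centered_normal_var_ge0 H1; have v2 := centered_normal_var_ge0 H2.
set V1 := a ^+ 2 + _ + _ in v1 *; set V2 := a ^+ 2 + _ + _ in v2 *.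
have -> : expR (- (a ^+ 2 / 2)) * cos p * (expR (- (b ^+ 2 / 2)) * cos q) =
  expR (- ((a ^+ 2 + b ^+ 2) / 2)) * (2^-1 * (cos (p + q) + cos (p - q))).
  have -> : 2^-1 * (cos (p + q) + cos (p - q)) = cos p * cos q by rewrite cosM_avg mulrC.
  have -> : - ((a ^+ 2 + b ^+ 2) / 2) = - (a ^+ 2 / 2) + - (b ^+ 2 / 2) by ring.
  by rewrite expRD; ring.
set V0 := (a ^+ 2 + b ^+ 2) / 2.
have v0 : 0 <= V0 by rewrite divr_ge0// addr_ge0// sqr_ge0.
have -> : 2^-1 * (expR (- (V1 / 2)) * cos (p + q)) + 2^-1 * (expR (- (V2 / 2)) * cos (p - q)) -
  expR (- V0) * (2^-1 * (cos (p + q) + cos (p - q))) =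
  2^-1 * ((expR (- (V1 / 2)) - expR (- V0)) * cos (p + q) + (expR (- (V2 / 2)) - expR (- V0)) * cos (p - q)).
  by ring.
have v12 : 0 <= V1 / 2 by rewrite divr_ge0.
have v22 : 0 <= V2 / 2 by rewrite divr_ge0.
have L1 : `|(expR (- (V1 / 2)) - expR (- V0)) * cos (p + q)| <= `|a * b| * `|r|.
  rewrite normrM (le_trans (ler_piMr _ (cos_max _)))// (le_trans (expRN_lip v12 v0))//.
  by rewrite -normrM /V1 /V0 le_eqVlt; apply/orP; left; apply/eqP; congr (`|_|); field.
have L2 : `|(expR (- (V2 / 2)) - expR (- V0)) * cos (p - q)| <= `|a * b| * `|r|.
  rewrite normrM (le_trans (ler_piMr _ (cos_max _)))// (le_trans (expRN_lip v22 v0))//.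
  rewrite -normrM /V2 /V0 le_eqVlt; apply/orP; left; apply/eqP.
  by rewrite -[RHS]normrN; congr (`|_|); field.
rewrite normrM ger0_norm//.
have := ler_normD ((expR (- (V1 / 2)) - expR (- V0)) * cos (p + q)) ((expR (- (V2 / 2)) - expR (- V0)) * cos (p - q)).
by lra.
Qed.

End two_point.

Section second_moment.
Context d (T : measurableType d) (R : realType) (P : probability T R).
Variables (N : nat) (X : 'I_N -> T -> R) (r0 : R).
Hypothesis N0 : (0 < N)%N.
Hypothesis H1 : forall i a, centered_normal P (fun w => a * X i w) (a ^+ 2).
Hypothesis H2 : forall i j, i != j -> exists2 r, `|r| <= r0 &
  forall a b, centered_normal P (fun w => a * X i w + b * X j w)
   (a ^+ 2 + b ^+ 2 + 2 * (a * b) * r).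
Variables (n : nat) (u D M h : R).
Hypotheses (u0 : 0 <= u) (D0 : 0 < D) (M0 : 0 < M) (h0 : 0 < h) (r00 : 0 <= r0).

Let m := u + D.
Let f (x : R) : R := (cos ((x - m) / M) ^+ 2) ^+ n.

Let f_ge0 x : 0 <= f x. Proof. by rewrite /f exprn_ge0// sqr_ge0. Qed.

Let f_le1 x : f x <= 1.
Proof.
apply: exprn_ile1; first exact: sqr_ge0.
by rewrite -real_normK ?num_real// exprn_ile1// cos_max.
Qed.

Let mX i : measurable_fun setT (X i).
Proof.
have [mX _] := H1 i 1.
by move: mX; congr (measurable_fun _ _); apply/funext => w; rewrite mul1r.
Qed.

Let cf : continuous f.
Proof.
move=> x; rewrite /f; apply: (@continuous_comp _ _ _ (fun x => cos ((x - m) / M)) (fun y => (y ^+ 2) ^+ n)).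
  apply: (@continuous_comp _ _ _ (fun x => (x - m) / M) cos); last exact: continuous_cos.
  by apply: cvgM; [apply: cvgB; [exact: cvg_id|exact: cvg_cst]|exact: cvg_cst].
have -> : (fun y : R => (y ^+ 2) ^+ n) = (fun y => y ^+ (2 * n)) by apply/funext => y; rewrite exprM.
exact: exprn_continuous.
Qed.

Let mf i : measurable_fun setT (fun w => f (X i w)).
Proof. by apply: (measurableT_comp (continuous_measurable_fun cf)). Qed.

Let If i : integrableR P (fun w => f (X i w)).
Proof.
by apply: (@bounded_integrable _ _ _ _ _ 1) => // w; rewrite ger0_norm.
Qed.

Let Iff i j : integrableR P (fun w => f (X i w) * f (X j w)).
Proof.
apply: (@bounded_integrable _ _ _ _ _ 1) => [|w]; first exact: measurable_funM.
by rewrite ger0_norm ?mulr_ge0// mulr_ile1.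
Qed.

Let mean_cov : exists mu : R, (forall i, Ex P (fun w => f (X i w)) = mu) /\
  (forall i j, i != j -> Ex P (fun w => f (X i w) * f (X j w)) <=
     mu ^+ 2 + ((2 * n)%:R / M) ^+ 2 * r0).
Proof.
have [s [sz sn E]] := @cos_pow_avg R (2 * n)%N.
pose q : R := (2 ^+ (2 * n))^-1.
pose al c : R := c / M.
pose ph c : R := - (c * m / M).
have fE x : f x = q * \sum_(c <- s) cos (al c * x + ph c).
  rewrite /f -exprM E; congr (_ * _); apply: eq_bigr => c _; congr cos.
  by rewrite /al /ph; field; rewrite gt_eqF.
have q0 : 0 <= q by rewrite invr_ge0 exprn_ge0.
have IC i c p : integrableR P (fun w => cos (c * X i w + p)).
  apply: (@bounded_integrable _ _ _ _ _ 1) => [|w]; last exact: cos_max.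
  apply: (measurableT_comp (continuous_measurable_fun (@continuous_cos R))).
  by apply: measurable_funD => //; exact: measurable_funM.
have ICC i j c p c' p' : integrableR P (fun w => cos (c * X i w + p) * cos (c' * X j w + p')).
  apply: (@bounded_integrable _ _ _ _ _ 1) => [|w].
    by apply: measurable_funM; apply: (measurableT_comp (continuous_measurable_fun (@continuous_cos R)));
      apply: measurable_funD => //; exact: measurable_funM.
  by rewrite normrM mulr_ile1// cos_max.
pose g c := expR (- (al c ^+ 2 / 2)) * cos (ph c).
exists (q * \sum_(c <- s) g c); split.
  move=> i; rewrite (_ : (fun w => _) = (fun w => q * \sum_(c <- s) cos (al c * X i w + ph c))); last first.
    by apply/funext => w; rewrite fE.
  rewrite ExZ; last by apply: integrableR_sum => c _; exact: IC.
  rewrite (@Ex_sum _ _ _ _ _ s (fun c w => cos (al c * X i w + ph c))); last by move=> c _; exact: IC.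
  by congr (_ * _); apply: eq_bigr => c _; rewrite (centered_normal_cos (H1 i (al c))).
move=> i j ij; have [r rr0 Hr] := H2 ij.
rewrite (_ : (fun w => _) = (fun w => q * (q * \sum_(c <- s) \sum_(c' <- s)
   cos (al c * X i w + ph c) * cos (al c' * X j w + ph c')))); last first.
  apply/funext => w; rewrite !fE mulrACA -mulrA big_distrl/=; congr (_ * (_ * _)).
  by apply: eq_bigr => c _; rewrite big_distrr.
rewrite ExZ; last first.
  by apply: integrableR_Z; apply: integrableR_sum => c _; apply: integrableR_sum => c' _; exact: ICC.
rewrite ExZ; last first.
  by apply: integrableR_sum => c _; apply: integrableR_sum => c' _; exact: ICC.
rewrite (@Ex_sum _ _ _ _ _ s (fun c w => \sum_(c' <- s)
   cos (al c * X i w + ph c) * cos (al c' * X j w + ph c'))); last first.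
  by move=> c _; apply: integrableR_sum => c' _; exact: ICC.
have -> : (q * \sum_(c <- s) g c) ^+ 2 = q * (q * \sum_(c <- s) \sum_(c' <- s) g c * g c').
  rewrite expr2 mulrACA -mulrA big_distrl/=; congr (_ * (_ * _)).
  by apply: eq_bigr => c _; rewrite big_distrr.
have bnd c c' : c \in s -> c' \in s ->
  Ex P (fun w => cos (al c * X i w + ph c) * cos (al c' * X j w + ph c')) <=
  g c * g c' + ((2 * n)%:R / M) ^+ 2 * r0.
  move=> /sn cn /sn c'n.
  have := two_point_cos Hr (al c) (al c') (ph c) (ph c').
  rewrite -/(g c) -/(g c') ler_norml => /andP[_ H].
  have : `|al c * al c'| * `|r| <= ((2 * n)%:R / M) ^+ 2 * r0.
    apply: ler_pM => //; rewrite expr2 normrM; apply: ler_pM => //;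
    by rewrite /al normrM normfV (gtr0_norm M0) ler_pM2r ?invr_gt0.
  by lra.
set e := ((2 * n)%:R / M) ^+ 2 * r0 in bnd *.
have : \sum_(c <- s) Ex P (fun w => \sum_(c' <- s) cos (al c * X i w + ph c) * cos (al c' * X j w + ph c'))
  <= \sum_(c <- s) \sum_(c' <- s) (g c * g c' + e).
  rewrite big_seq [leRHS]big_seq; apply: ler_sum => c cs.
  rewrite (@Ex_sum _ _ _ _ _ s (fun c' w => cos (al c * X i w + ph c) * cos (al c' * X j w + ph c'))); last first.
    by move=> c' _; exact: ICC.
  by rewrite big_seq [leRHS]big_seq; apply: ler_sum => c' cs'; exact: bnd.
have -> : \sum_(c <- s) \sum_(c' <- s) (g c * g c' + e) =
  \sum_(c <- s) \sum_(c' <- s) g c * g c' + (2 ^ (2 * n))%:R * ((2 ^ (2 * n))%:R * e).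
  rewrite -sz; rewrite (eq_bigr (fun c => \sum_(c' <- s) g c * g c' + (size s)%:R * e)).
    rewrite big_split/=; congr (_ + _).
    by rewrite big_const_seq count_predT iter_addr_0 -[LHS]mulr_natl.
  move=> c _; rewrite big_split/=; congr (_ + _).
  by rewrite big_const_seq count_predT iter_addr_0 -[LHS]mulr_natl.
move=> H.
have qN : q * (2 ^ (2 * n))%:R = 1.
  by rewrite /q natrX mulVf// expf_neq0.
apply: (@le_trans _ _ (q * (q * (\sum_(c <- s) \sum_(c' <- s) g c * g c' + (2 ^ (2 * n))%:R * ((2 ^ (2 * n))%:R * e))))).
  by rewrite !ler_wpM2l.
by rewrite !mulrDr lerD2l [q * ((2 ^ _)%:R * _)]mulrA qN mul1r mulrA qN mul1r.
Qed.

Let mu0 := h / (2 * Num.sqrt (2 * pi)) * expR (- ((u + D + h) ^+ 2 / 2)).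

Hypothesis mM : u + D <= M / 2.
Hypothesis nh : n%:R * (h / M) ^+ 2 <= 1 / 2.
Hypothesis nD : expR (- (n%:R * (D / M) ^+ 2 / 4)) <= mu0 / 2.

Let mu0_gt0 : 0 < mu0.
Proof.
rewrite /mu0 mulr_gt0 ?expR_gt0// divr_gt0// mulr_gt0// sqrtr_gt0 mulr_gt0//.
exact: pi_gt0.
Qed.

Let f_peak x : m <= x -> x <= m + h -> 2^-1 <= f x.
Proof.
move=> mx xm; rewrite /f.
have c1 := cos2_ge ((x - m) / M).
have w0 : 0 <= (x - m) / M by rewrite divr_ge0 ?subr_ge0// ltW.
have w1 : (x - m) / M <= h / M by rewrite ler_pM2r ?invr_gt0//; lra.
have w2 : ((x - m) / M) ^+ 2 <= (h / M) ^+ 2.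
  by rewrite ler_sqr ?nnegrE ?divr_ge0 ?subr_ge0 ?(ltW M0) ?(ltW h0).
have Bern (z : R) k : 0 <= z -> z <= 1 -> 1 - k%:R * z <= (1 - z) ^+ k.
  move=> z0 z1; elim: k => [|k IH]; first by rewrite expr0 mul0r subr0.
  rewrite exprS -natr1.
  have : (1 - z) * (1 - k%:R * z) <= (1 - z) * (1 - z) ^+ k by rewrite ler_wpM2l// subr_ge0.
  have : 0 <= k%:R * z * z by rewrite !mulr_ge0.
  lra.
have nh' := nh.
have [n0|n0] := posnP n.
  by rewrite n0 expr0 invf_le1//; lra.
have n1 : 1 <= n%:R :> R by rewrite ler1n.
set z := ((x - m) / M) ^+ 2 in c1 w2.
have z0 : 0 <= z by exact: sqr_ge0.
have hz : n%:R * z <= 1 / 2 by apply: le_trans nh'; rewrite ler_wpM2l.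
have z1 : z <= 1 by nra.
apply: (@le_trans _ _ ((1 - z) ^+ n)); last first.
  by apply: lerXn2r; rewrite ?nnegrE ?sqr_ge0 ?subr_ge0.
by apply: le_trans (Bern z n z0 z1); lra.
Qed.

(* The bound on |x| keeps (x - m)/M in [-1, 1], away from the other maxima of f. *)
Let f_small x : `|x| <= M / 2 -> x <= u -> f x <= mu0 / 2.
Proof.
move=> xM xu; apply: le_trans nD.
have mM' := mM; have D0' := D0; have u0' := u0.
move: xM; rewrite ler_norml => /andP[x1 x2].
have wM : `|(x - m) / M| <= 1.
  rewrite normrM normfV (gtr0_norm M0) ler_pdivrMr// mul1r ler_norml /m.
  by apply/andP; split; lra.
have c1 := cos2_le wM.
have -> : n%:R * (D / M) ^+ 2 / 4 = n%:R * ((D / M) ^+ 2 / 4) by rewrite mulrA.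
rewrite -mulrN expRM_natl /f; apply: lerXn2r; rewrite ?nnegrE ?expR_ge0 ?sqr_ge0//.
apply: (le_trans c1); rewrite ler_expR lerN2 ler_pM2r ?invr_gt0//.
rewrite -[leRHS]real_normK ?num_real// ler_sqr ?nnegrE ?divr_ge0 ?(ltW D0) ?(ltW M0)//.
rewrite normrM normfV (gtr0_norm M0) ler_pM2r ?invr_gt0// ler0_norm /m; lra.
Qed.

Let mle (g : T -> R) c : measurable_fun setT g -> measurable [set w | (g w <= c)%R].
Proof. by move=> mg; rewrite -[X in measurable X]setTI; apply: measurable_fun_le. Qed.

Let mge (g : T -> R) c : measurable_fun setT g -> measurable [set w | (c <= g w)%R].
Proof. by move=> mg; rewrite -[X in measurable X]setTI; apply: measurable_fun_le. Qed.

Lemma measurable_all_below : measurable [set w | forall i, X i w <= u].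
Proof.
have -> : [set w | forall i, X i w <= u] = \bigcap_(i in [set: 'I_N]) [set w | X i w <= u].
  by apply/seteqP; split => w /= H i; [move=> _; exact: H|exact: (H i I)].
by apply: fin_bigcap_measurable => // i _; exact: mle.
Qed.

(** Second moment method for the sum of the bumps f(X_i), of common mean mu >= mu0.
If no X_i exceeds u then either some |X_i| is above M/2, where the periodicity
of f spoils it, or every f(X_i) is below mu/2 and their sum is at most half of its mean;
the latter is unlikely by the Chebyshev inequality, as the covariances are small. *)
Lemma all_below_prob :
  (P [set w | forall i, (X i w <= u)%R] <=
   (N%:R * (2 * expR (- (M ^+ 2 / 8))) +
    (4 / (N%:R * mu0) + 4 * (((2 * n)%:R / M) ^+ 2 * r0) / mu0 ^+ 2))%:E)%E.
Proof.
have [mu [Emu Ecov]] := mean_cov.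
set e := ((2 * n)%:R / M) ^+ 2 * r0 in Ecov *.
have e0 : 0 <= e by rewrite mulr_ge0// sqr_ge0.
have muge : mu0 <= mu.
  pose i0 := Ordinal N0.
  have L := centered_normal_lower (H1 i0 1).
  have m0 : 0 <= m by rewrite addr_ge0// ltW.
  have := L m h; rewrite expr1n !mulr1 => /(_ ltr01 m0 (ltW h0)).
  set A := [set w | _ <= 1 * X i0 w <= _] => LA.
  have mA : measurable A.
    have -> : A = [set w | m <= 1 * X i0 w] `&` [set w | 1 * X i0 w <= m + h].
      by apply/seteqP; split => w /= => [/andP[]//|[? ?]]; apply/andP.
    by apply: measurableI; [apply: mge|apply: mle]; apply: measurable_funM.
  have IA : integrableR P (\1_A : T -> R).
    by apply: integrable_indic => //.
  have : 2^-1 * Ex P (\1_A : T -> R) <= mu.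
    rewrite -(Emu i0) -ExZ//; apply: Ex_le => //; first exact: integrableR_Z.
    move=> w; rewrite indicE; case: (boolP (w \in A)) => [|_]; last by rewrite mulr0.
    rewrite inE mulr1 => /=; rewrite /A/= mul1r => /andP[? ?].
    exact: f_peak.
  have PA : P A = (Ex P (\1_A : T -> R))%:E by rewrite -ExE// integral_indic// setIT.
  rewrite PA lee_fin in LA.
  apply: le_trans; rewrite /mu0.
  have -> : h / (2 * Num.sqrt (2 * pi)) * expR (- ((u + D + h) ^+ 2 / 2)) =
    2^-1 * (h / Num.sqrt (2 * pi) * expR (- ((m + h) ^+ 2 / 2))).
    by rewrite invfM /m; ring.
  by rewrite ler_pM2l.
have mu_gt0 : 0 < mu by exact: lt_le_trans muge.
pose S w := \sum_(i < N) (f (X i w) - mu).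
have NR : 0 < N%:R :> R by rewrite ltr0n.
have ISS : integrableR P (fun w => S w ^+ 2).
  rewrite (_ : (fun w => _) = (fun w => \sum_(i < N) \sum_(j < N) (f (X i w) - mu) * (f (X j w) - mu))).
    apply: integrableR_sum => i _; apply: integrableR_sum => j _.
    apply: (@bounded_integrable _ _ _ _ _ ((1 + `|mu|) * (1 + `|mu|))) => [|w].
      by apply: measurable_funM; exact: measurable_funB.
    have B k : `|f (X k w) - mu| <= 1 + `|mu|.
      by rewrite (le_trans (ler_normB _ _))// lerD2r ger0_norm.
    by rewrite normrM ler_pM.
  by apply/funext => w; rewrite expr2 /S big_distrl/=; apply: eq_bigr => i _; rewrite big_distrr.
have Icross i j : integrableR P (fun w => (f (X i w) - mu) * (f (X j w) - mu)).
  apply: (@bounded_integrable _ _ _ _ _ ((1 + `|mu|) * (1 + `|mu|))) => [|w].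
    by apply: measurable_funM; exact: measurable_funB.
  have B k : `|f (X k w) - mu| <= 1 + `|mu|.
    by rewrite (le_trans (ler_normB _ _))// lerD2r ger0_norm.
  by rewrite normrM ler_pM.
have Ecross i j : Ex P (fun w => (f (X i w) - mu) * (f (X j w) - mu)) =
   Ex P (fun w => f (X i w) * f (X j w)) - mu ^+ 2.
  rewrite (_ : (fun w => _) = (fun w => f (X i w) * f (X j w) - (mu * f (X i w) + mu * f (X j w)  - mu ^+ 2))); last first.
    by apply/funext => w; ring.
  rewrite ExB//; last first.
    by apply: integrableR_B; [apply: integrableR_D; exact: integrableR_Z|exact: integrableR_cst].
  rewrite ExB; [|by apply: integrableR_D; exact: integrableR_Z|exact: integrableR_cst].
  rewrite ExD; [|exact: integrableR_Z|exact: integrableR_Z].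
  rewrite Ex_cst (ExZ mu (If i)) (ExZ mu (If j)) !Emu; ring.
have VS : Ex P (fun w => S w ^+ 2) <= N%:R * mu + N%:R * (N%:R * e).
  rewrite (_ : (fun w => _) = (fun w => \sum_(i < N) \sum_(j < N) (f (X i w) - mu) * (f (X j w) - mu))); last first.
    by apply/funext => w; rewrite expr2 /S big_distrl/=; apply: eq_bigr => i _; rewrite big_distrr.
  rewrite Ex_sum; last by move=> i _; apply: integrableR_sum => j _.
  apply: (@le_trans _ _ (\sum_(i < N) (mu + N%:R * e))); last first.
    by rewrite sumr_const card_ord -[leLHS]mulr_natl mulrDr.
  apply: ler_sum => i _; rewrite Ex_sum// (bigD1 i)//=; apply: lerD.
    rewrite Ecross.
    apply: (@le_trans _ _ (Ex P (fun w => f (X i w) * f (X i w)))); first by rewrite gerBl sqr_ge0.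
    rewrite -[leRHS](Emu i); apply: Ex_le => // w.
    by rewrite ler_piMl.
  apply: (@le_trans _ _ (\sum_(j < N | j != i) e)).
    apply: ler_sum => j ji; rewrite Ecross lerBlDl; apply: Ecov.
    by rewrite eq_sym.
  rewrite sumr_const -[leLHS]mulr_natl ler_wpM2r// ler_nat.
  by rewrite -[X in (_ <= X)%N]card_ord max_card.
pose B := [set w | ((N%:R * mu / 2) ^+ 2 <= S w ^+ 2)%R].
have mS : measurable_fun setT S.
  by apply: measurable_sum => i; exact: measurable_funB.
have mB : measurable B by apply: mge; exact: measurable_funX.
have PB : (P B <= (4 / (N%:R * mu0) + 4 * e / mu0 ^+ 2)%:E)%E.
  have IB : integrableR P (\1_B : T -> R) by apply: integrable_indic.
  have -> : P B = (Ex P (\1_B : T -> R))%:E by rewrite -ExE// integral_indic// setIT.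
  rewrite lee_fin.
  have K0 : 0 < (N%:R * mu / 2) ^+ 2 by rewrite exprn_gt0// divr_gt0// mulr_gt0.
  have : (N%:R * mu / 2) ^+ 2 * Ex P (\1_B : T -> R) <= N%:R * mu + N%:R * (N%:R * e).
    apply: le_trans VS; rewrite -ExZ//; apply: Ex_le => //; first exact: integrableR_Z.
    move=> w; rewrite indicE; case: (boolP (w \in B)) => [|_].
      by rewrite inE mulr1.
    by rewrite mulr0 sqr_ge0.
  rewrite mulrC -ler_pdivlMr// => H; apply: (le_trans H).
  have -> : (N%:R * mu + N%:R * (N%:R * e)) / (N%:R * mu / 2) ^+ 2 = 4 / (N%:R * mu) + 4 * e / mu ^+ 2.
    by field; rewrite !gt_eqF.
  apply: lerD.
    have a1 : 0 < N%:R * mu by exact: mulr_gt0.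
    have a2 : 0 < N%:R * mu0 by exact: mulr_gt0.
    by apply: ler_wpM2l => //; rewrite lef_pV2 ?posrE//; apply: ler_wpM2l => //; exact: ltW.
  apply: ler_wpM2l; first by rewrite mulr_ge0.
  rewrite lef_pV2 ?posrE ?exprn_gt0//.
  by rewrite ler_sqr ?nnegrE ?(ltW mu_gt0) ?(ltW mu0_gt0).
pose Bi i := [set w | (M / 2 <= 1 * X i w)%R] `|` [set w | (M / 2 <= -1 * X i w)%R].
have mBi i : measurable (Bi i).
  by apply: measurableU; apply: mge; apply: measurable_funM.
have PBi i : (P (Bi i) <= (2 * expR (- (M ^+ 2 / 8)))%:E)%E.
  have M20 : 0 <= M / 2 by rewrite divr_ge0// ltW.
  apply: (le_trans (@measureU2 _ _ _ P _ _ _ _)); [by apply: mge; apply: measurable_funM|by apply: mge; apply: measurable_funM|].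
  have T1 := @centered_normal_tail _ _ _ _ _ _ (H1 i 1) 1 (M / 2).
  have T2 := @centered_normal_tail _ _ _ _ _ _ (H1 i (-1)) 1 (M / 2).
  have eM : (M / 2) ^+ 2 / (2 * 1) = M ^+ 2 / 8 by field.
  rewrite eM in T1 T2.
  rewrite mulr_natl mulr2n EFinD; apply: leeD.
    by apply: T1 => //; rewrite expr1n.
  by apply: T2 => //; rewrite sqrrN expr1n.
pose BB := \big[setU/set0]_(i < N) Bi i.
have mBB : measurable BB by apply: bigsetU_measurable.
have PBB : (P BB <= (N%:R * (2 * expR (- (M ^+ 2 / 8))))%:E)%E.
  pose Bn k := if insub k is Some i then Bi i else set0.
  have BnE (i : 'I_N) : Bn i = Bi i by rewrite /Bn valK.
  have -> : BB = \big[setU/set0]_(i < N) Bn i by apply: eq_bigr => i _; rewrite BnE.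
  apply: (le_trans (@Boole_inequality _ _ _ P Bn N _)).
    by move=> k kN; rewrite -[k]/(val (Ordinal kN)) BnE.
  apply: (@le_trans _ _ (\sum_(i < N) (2 * expR (- (M ^+ 2 / 8)))%:E)%E).
    by apply: lee_sum => i _; rewrite BnE; exact: PBi.
  by rewrite sumEFin lee_fin sumr_const card_ord -[leLHS]mulr_natl.
rewrite EFinD.
apply: (@le_trans _ _ (P BB + P B)%E); last exact: leeD.
apply: (@le_trans _ _ (P (BB `|` B))); last exact: measureU2.
apply: le_measure; rewrite ?inE; [exact: measurable_all_below|exact: measurableU|].
move=> w /= Hw.
have [[i Hi]|nb] := pselect (exists i, Bi i w).
  by left; rewrite /BB (bigD1 i)//=; left.
right; rewrite /B /=.
have fs i : f (X i w) <= mu / 2.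
  apply: (@le_trans _ _ (mu0 / 2)); last by rewrite ler_pM2r.
  apply: f_small => //; rewrite leNgt; apply/negP => H; apply: nb; exists i.
  rewrite /Bi/=; move: H; rewrite ltr_normr mul1r mulN1r => /orP[] /ltW; [left|right]; done.
have SN : S w <= - (N%:R * mu / 2).
  have -> : - (N%:R * mu / 2) = \sum_(i < N) (- (mu / 2)).
    by rewrite sumr_const card_ord -[RHS]mulr_natl; ring.
  by apply: ler_sum => i _; have := fs i; lra.
have K0 : 0 <= N%:R * mu / 2 by rewrite divr_ge0// mulr_ge0// ltW.
by rewrite -[S w ^+ 2]sqrrN ler_sqr ?nnegrE//; lra.
Qed.

End second_moment.

(** * Cells without a peak *)

Section asymptotics.
Context {R : realType}.

Lemma expR_dominates (c C : R) : 0 < c -> exists K : nat, forall k : nat, (K <= k)%N -> C <= expR (c * k%:R).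
Proof.
move=> c0; exists (Num.truncn (`|C| / c)).+1 => k Kk.
have h1 : `|C| / c <= k%:R.
  apply/ltW; apply: (@lt_le_trans _ _ (Num.truncn (`|C| / c)).+1%:R); last by rewrite ler_nat.
  exact: truncnS_gt.
rewrite ler_pdivrMr// in h1.
have h2 := expR_ge1Dx (c * k%:R); have h3 := ler_norm C; lra.
Qed.

Lemma powR_le_expR (p z : R) : 0 < p -> 0 < z ->
  exists2 C : R, 0 < C & forall x : R, 0 < x -> x `^ p <= C * expR (z * x).
Proof.
move=> p0 z0; exists (expR (p * ln (p / z) - p)); first exact: expR_gt0.
move=> x x0; rewrite /powR gt_eqF// -expRD ler_expR.
have pz : 0 < p / z by exact: divr_gt0.
have q0 : 0 < x / (p / z) by exact: divr_gt0.
have := @le_ln1Dx R (x / (p / z) - 1); rewrite [1 + _]addrC subrK => H.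
have {}H : ln (x / (p / z)) <= x / (p / z) - 1 by apply: H; lra.
rewrite ln_div ?posrE// in H.
have : p * (ln x - ln (p / z)) <= p * (x / (p / z) - 1) by rewrite ler_pM2l.
have -> : p * (x / (p / z) - 1) = z * x - p by field; rewrite !gt_eqF.
by lra.
Qed.

Variables (beta th : R) (b : bool).
Hypotheses (hbeta : 0 < beta) (th1 : th < 1) (hth : b%:R * (beta ^+ 2 / 2) < th).

(** The slack in the exponents at our disposal: a cell has exp (k (th - gap)) sample
points, and this beats the reciprocal exp (k b beta^2/2) of the probability of a peak. *)
Definition gap : R := (th - b%:R * (beta ^+ 2 / 2)) / 4.

Lemma gap_gt0 : 0 < gap. Proof. by rewrite divr_gt0// subr_gt0. Qed.

Let b0 : 0 <= b%:R :> R. Proof. exact: ler0n. Qed.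
Let b1 : b%:R <= 1 :> R. Proof. by case: b. Qed.
Let beta2 : 0 < beta ^+ 2. Proof. exact: exprn_gt0. Qed.

Lemma gap_lt : gap < 1 / 4.
Proof.
have h := th1; have h2 : 0 <= b%:R * (beta ^+ 2 / 2) by rewrite mulr_ge0// divr_ge0// ltW.
by rewrite /gap; lra.
Qed.

(* dl keeps (u + D + h)^2 below beta^2 b k + gap k + c1; B makes u + D <= M/2 and the Gaussian
   tail at M/2 beat N; A exceeds the exponent of 1/mu0^2 with room to spare; c0 makes f
   below mu0/2 on the left of u; h makes f at least 1/2 between m and m + h. *)
Let dl : R := gap / (beta ^+ 2 + 4).
Let B : R := 4 * beta + 12.
Let A : R := beta ^+ 2 + 4.
Let c0 : nat := (Num.truncn (4 * A * B ^+ 2 / dl ^+ 2)).+1.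
Let h : R := B / (2 * c0%:R).
Let c1 : R := 2 * (1 + dl) * beta ^+ 2 + (1 + dl^-1) * (2 * h ^+ 2).
Let c2 : R := h / (2 * Num.sqrt (2 * pi)) * expR (- (c1 / 2)).

Let dl0 : 0 < dl. Proof. by rewrite divr_gt0 ?gap_gt0// addr_gt0. Qed.
Let dl1 : dl <= 1.
Proof.
have g := gap_lt; have := beta2 => h2.
by rewrite /dl ler_pdivrMr; lra.
Qed.
Let B0 : 0 < B. Proof. by rewrite /B; have := hbeta; lra. Qed.
Let A0 : 0 < A. Proof. by rewrite /A; have := beta2; lra. Qed.
Let c00 : 0 < c0%:R :> R. Proof. by rewrite ltr0n. Qed.
Let h0 : 0 < h. Proof. by rewrite /h divr_gt0// mulr_gt0. Qed.
Let s2p : 0 < Num.sqrt (2 * pi) :> R. Proof. by rewrite sqrtr_gt0 mulr_gt0// pi_gt0. Qed.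
Let c20 : 0 < c2. Proof. by rewrite /c2 mulr_gt0 ?expR_gt0// divr_gt0// mulr_gt0. Qed.

Definition block_size k : nat := Num.truncn (expR (k%:R * (th - gap)) : R).
Definition spacing k : R := expR (k%:R * gap).

Lemma th_gap : 0 < th - gap.
Proof.
have hh := hth; have h2 : 0 <= b%:R * (beta ^+ 2 / 2) by rewrite mulr_ge0// divr_ge0// ltW.
by rewrite /gap; lra.
Qed.

Lemma block_size_bounds k : expR (k%:R * (th - gap)) / 2 <= (block_size k)%:R <= expR (k%:R * (th - gap)).
Proof.
set x := expR _.
have x1 : 1 <= x by rewrite -[leLHS]expR0 ler_expR mulr_ge0// ltW// th_gap.
have /andP[l1 l2] := truncn_itv (le_trans ler01 x1).
rewrite -/(block_size k) in l1 l2; apply/andP; split => //.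
have : (1 <= block_size k)%N by rewrite truncn_ge_nat ?(le_trans ler01 x1).
rewrite -(ler_nat R) => ?; rewrite -natr1 in l2; lra.
Qed.

Lemma block_size_gt0 k : (0 < block_size k)%N.
Proof.
have /andP[l1 _] := block_size_bounds k.
rewrite -(ltr_nat R); apply: lt_le_trans l1; by rewrite divr_gt0// expR_gt0.
Qed.

(** In the application u^2 is beta^2 ln y, for heights y <= exp (b k + 2).  With D = dl sqrt k,
M = B sqrt k and n = c0 k, mu0 is at least a constant times exp (- k (b beta^2/2 + gap/2)),
and the three terms of the second moment bound are all at most a constant times
exp (- gap k). *)
Lemma second_moment_parameters (d : measure_display) (T : measurableType d) (P : probability T R) :
  exists C : R, 0 <= C /\ exists K : nat, forall k, (K <= k)%N ->
  forall (u r0 : R) (X : 'I_(block_size k) -> T -> R),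
  0 <= u -> u ^+ 2 <= beta ^+ 2 * (b%:R * k%:R + 2) -> 0 <= r0 -> r0 <= expR (- (A * k%:R)) ->
  (forall i a, centered_normal P (fun w => a * X i w) (a ^+ 2)) ->
  (forall i j, i != j -> exists2 r, `|r| <= r0 &
    forall a b, centered_normal P (fun w => a * X i w + b * X j w)
      (a ^+ 2 + b ^+ 2 + 2 * (a * b) * r)) ->
  (P [set w | forall i, (X i w <= u)%R] <= (C * expR (- (gap * k%:R)))%:E)%E.
Proof.
have [K1 HK1] := @expR_dominates 3 (2 / c2) (ltr0n R 3).
exists (2 + (8 / c2 + 4 * (4 * c0%:R ^+ 2 / B ^+ 2) / c2 ^+ 2)); split.
  rewrite addr_ge0// addr_ge0//; first by rewrite divr_ge0// ltW.
  by rewrite divr_ge0 ?sqr_ge0// mulr_ge0// divr_ge0 ?sqr_ge0// mulr_ge0// sqr_ge0.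
exists (maxn 1 K1) => k; rewrite geq_max => /andP[k1 kK] u r0 X u0 u2 r00 r0A H1 H2.
have kR : 1 <= k%:R :> R by rewrite ler1n.
have k0 : 0 <= k%:R :> R by lra.
pose s := Num.sqrt (k%:R : R).
have s0 : 0 < s by rewrite sqrtr_gt0; lra.
have s2 : s ^+ 2 = k%:R by rewrite sqr_sqrtr.
pose D := dl * s; pose M := B * s; pose n := (c0 * k)%N.
have D0 : 0 < D by exact: mulr_gt0.
have M0 : 0 < M by exact: mulr_gt0.
have hb := hbeta; have hb2 := beta2; have g0 := gap_gt0; have g1 := gap_lt; have hdl0 := dl0; have hdl1 := dl1.
have u2s : u <= 2 * beta * s.
  rewrite -ler_sqr ?nnegrE ?mulr_ge0 ?(ltW s0) ?(ltW hb)//.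
  apply: (le_trans u2); rewrite !exprMn s2.
  have -> : 2 ^+ 2 * beta ^+ 2 * k%:R = beta ^+ 2 * (4 * k%:R) :> R by ring.
  rewrite ler_pM2l//.
  have : b%:R * k%:R <= 1 * k%:R :> R by rewrite ler_wpM2r.
  by lra.
have mM : u + D <= M / 2.
  have : dl * s <= 1 * s by rewrite ler_wpM2r// ltW.
  by rewrite /D /M /B; nra.
have nh : n%:R * (h / M) ^+ 2 <= 1 / 2.
  have -> : n%:R * (h / M) ^+ 2 = 1 / (4 * c0%:R).
    rewrite /n natrM -s2 /h /M; field.
    by rewrite !gt_eqF.
  have c01 : 1 <= c0%:R :> R by rewrite ler1n.
  by rewrite ler_pdivrMr; lra.
pose mu0 := h / (2 * Num.sqrt (2 * pi)) * expR (- ((u + D + h) ^+ 2 / 2)).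
have muE : c2 * expR (- (k%:R * (b%:R * (beta ^+ 2 / 2) + gap / 2))) <= mu0.
  rewrite /c2 /mu0 -mulrA -expRD; apply: ler_wpM2l.
    by rewrite divr_ge0 ?(ltW h0)// mulr_ge0.
  rewrite ler_expR.
  suff : (u + D + h) ^+ 2 <= c1 + 2 * (k%:R * (b%:R * (beta ^+ 2 / 2) + gap / 2)) by lra.
  (* (u + v)^2 <= (1 + dl) u^2 + (1 + 1/dl) v^2 *)
  have e1 : (u + D + h) ^+ 2 <= (1 + dl) * u ^+ 2 + (1 + dl^-1) * (D + h) ^+ 2.
    have -> : (1 + dl) * u ^+ 2 + (1 + dl^-1) * (D + h) ^+ 2 =
      (u + D + h) ^+ 2 + (dl * u - (D + h)) ^+ 2 / dl by field; rewrite gt_eqF.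
    by rewrite lerDl divr_ge0 ?sqr_ge0// ltW.
  have e2 : (D + h) ^+ 2 <= 2 * dl ^+ 2 * k%:R + 2 * h ^+ 2.
    have := sqr_ge0 (D - h); have : D ^+ 2 = dl ^+ 2 * k%:R by rewrite /D exprMn s2.
    by lra.
  have e3 : (1 + dl) * u ^+ 2 <= (1 + dl) * (beta ^+ 2 * (b%:R * k%:R + 2)).
    by rewrite ler_wpM2l//; lra.
  have e4 : (1 + dl^-1) * (D + h) ^+ 2 <= (1 + dl^-1) * (2 * dl ^+ 2 * k%:R + 2 * h ^+ 2).
    by rewrite ler_wpM2l// addr_ge0// invr_ge0 ltW.
  have e5 : dl * b%:R * beta ^+ 2 * k%:R + (1 + dl^-1) * (2 * dl ^+ 2) * k%:R <= gap * k%:R.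
    rewrite -mulrDl ler_wpM2r//.
    have -> : (1 + dl^-1) * (2 * dl ^+ 2) = 2 * dl ^+ 2 + 2 * dl by field; rewrite gt_eqF.
    have -> : gap = dl * (beta ^+ 2 + 4) by rewrite /dl divfK// gt_eqF// addr_gt0.
    have : b%:R * beta ^+ 2 <= 1 * beta ^+ 2 by rewrite ler_wpM2r// ltW.
    by nra.
  rewrite /c1; lra.
have mu00 : 0 < mu0 by apply: lt_le_trans muE; rewrite mulr_gt0 ?expR_gt0.
have nD : expR (- (n%:R * (D / M) ^+ 2 / 4)) <= mu0 / 2.
  have cA : A * k%:R <= n%:R * (D / M) ^+ 2 / 4.
    have -> : n%:R * (D / M) ^+ 2 / 4 = c0%:R * (dl ^+ 2 / (4 * B ^+ 2)) * k%:R.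
      by rewrite /n natrM /D /M; field; rewrite !gt_eqF.
    rewrite ler_wpM2r//.
    have q0 : 0 < dl ^+ 2 / (4 * B ^+ 2) by rewrite divr_gt0 ?exprn_gt0// mulr_gt0// exprn_gt0.
    rewrite -ler_pdivrMr//.
    have -> : A / (dl ^+ 2 / (4 * B ^+ 2)) = 4 * A * B ^+ 2 / dl ^+ 2 by field; rewrite !gt_eqF.
    by apply/ltW; exact: truncnS_gt.
  apply: (@le_trans _ _ (expR (- (A * k%:R)))); first by rewrite ler_expR lerN2.
  apply: (@le_trans _ _ (c2 * expR (- (k%:R * (b%:R * (beta ^+ 2 / 2) + gap / 2))) / 2)); last first.
    by rewrite ler_pM2r.
  have -> : expR (- (A * k%:R)) = expR (- (3 * k%:R)) * expR (- ((A - 3) * k%:R)).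
    by rewrite -expRD; congr expR; ring.
  have -> : c2 * expR (- (k%:R * (b%:R * (beta ^+ 2 / 2) + gap / 2))) / 2 =
    c2 / 2 * expR (- (k%:R * (b%:R * (beta ^+ 2 / 2) + gap / 2))) by ring.
  apply: ler_pM; rewrite ?expR_ge0//.
    rewrite expRN -[leRHS]invrK lef_pV2 ?posrE ?expR_gt0 ?invr_gt0 ?divr_gt0//.
    by rewrite invf_div; exact: HK1.
  rewrite ler_expR lerN2 [leRHS]mulrC ler_wpM2l//.
  have : b%:R * (beta ^+ 2 / 2) <= 1 * (beta ^+ 2 / 2) by rewrite ler_wpM2r// divr_ge0// ltW.
  by rewrite /A; lra.
have N0 := block_size_gt0 k.
apply: (le_trans (all_below_prob N0 H1 H2 u0 D0 M0 h0 r00 mM nh nD)).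
rewrite lee_fin -/mu0 [leRHS]mulrDl [X in _ <= _ + X]mulrDl; apply: lerD; last apply: lerD.
- have /andP[_ NU] := block_size_bounds k.
  rewrite mulrCA ler_pM2l//.
  apply: (@le_trans _ _ (expR (k%:R * (th - gap)) * expR (- (M ^+ 2 / 8)))).
    by rewrite ler_wpM2r ?expR_ge0.
  rewrite -expRD ler_expR /M exprMn s2.
  have B2 : 144 <= B ^+ 2 by rewrite /B; nra.
  have ht := th1.
  have : k%:R * (th - gap) <= k%:R * 1 by rewrite ler_wpM2l//; lra.
  have : gap * k%:R <= 1 * k%:R by rewrite ler_wpM2r//; lra.
  have : 144 * k%:R <= B ^+ 2 * k%:R by rewrite ler_wpM2r.
  by lra.
- have /andP[NL _] := block_size_bounds k.
  have Nmu : c2 / 2 * expR (gap * k%:R) <= (block_size k)%:R * mu0.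
    apply: (@le_trans _ _ ((expR (k%:R * (th - gap)) / 2) * (c2 * expR (- (k%:R * (b%:R * (beta ^+ 2 / 2) + gap / 2)))))); last first.
      by apply: ler_pM => //; rewrite ?divr_ge0 ?mulr_ge0 ?expR_ge0// ltW.
    have -> : expR (k%:R * (th - gap)) / 2 * (c2 * expR (- (k%:R * (b%:R * (beta ^+ 2 / 2) + gap / 2)))) =
      c2 / 2 * (expR (k%:R * (th - gap)) * expR (- (k%:R * (b%:R * (beta ^+ 2 / 2) + gap / 2)))) by ring.
    rewrite ler_pM2l ?divr_gt0// -expRD ler_expR.
    have -> : th = 4 * gap + b%:R * (beta ^+ 2 / 2) by rewrite /gap; field.
    by nra.
  have -> : 8 / c2 * expR (- (gap * k%:R)) = 4 / (c2 / 2 * expR (gap * k%:R)).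
    by rewrite expRN; field; rewrite !gt_eqF// expR_gt0.
  apply: ler_wpM2l => //; rewrite lef_pV2 ?posrE//.
    by rewrite mulr_gt0// ltr0n.
  by apply: mulr_gt0; [exact: divr_gt0|exact: expR_gt0].
- have E1 : ((2 * n)%:R / M) ^+ 2 = 4 * c0%:R ^+ 2 / B ^+ 2 * k%:R.
    have -> : (2 * n)%:R = 2 * c0%:R * s ^+ 2 :> R by rewrite s2 /n !natrM mulrA.
    by rewrite -s2 /M; field; rewrite !gt_eqF.
  rewrite E1.
  have kE : k%:R <= expR k%:R :> R by apply: le_trans (expR_ge1Dx _); rewrite lerDr.
  set q := 4 * c0%:R ^+ 2 / B ^+ 2.
  have q0 : 0 <= q by rewrite divr_ge0 ?sqr_ge0// mulr_ge0// sqr_ge0.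
  set m := c2 * expR _ in muE.
  have m0 : 0 < m by rewrite mulr_gt0 ?expR_gt0.
  apply: (@le_trans _ _ (4 * (q * expR k%:R * expR (- (A * k%:R))) / m ^+ 2)).
    have qk : 0 <= q * k%:R by exact: mulr_ge0.
    apply: ler_pM.
    - by apply: mulr_ge0 => //; apply: mulr_ge0.
    - by rewrite invr_ge0 sqr_ge0.
    - rewrite ler_pM2l//; apply: ler_pM => //.
      exact: ler_wpM2l.
    - rewrite lef_pV2 ?posrE ?exprn_gt0// ler_sqr ?nnegrE//; exact: ltW.
  have -> : 4 * (q * expR k%:R * expR (- (A * k%:R))) / m ^+ 2 =
    4 * q / c2 ^+ 2 * (expR k%:R * expR (- (A * k%:R)) * expR (2%:R * (k%:R * (b%:R * (beta ^+ 2 / 2) + gap / 2)))).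
    rewrite expRM_natl /m [expR (- (k%:R * _))]expRN; field.
    by rewrite !gt_eqF// expR_gt0.
  apply: ler_wpM2l; first by rewrite divr_ge0 ?sqr_ge0// mulr_ge0.
  rewrite -!expRD ler_expR /A.
  have : b%:R * (beta ^+ 2 / 2) <= 1 * (beta ^+ 2 / 2) by rewrite ler_wpM2r// divr_ge0// ltW.
  by nra.
Qed.

End asymptotics.

Section bad_block.
Context d (T : measurableType d) (R : realType) (P : probability T R).
Variables (xi : (R * R -> R) -> {RV P >-> R}) (Z : R -> R -> {RV P >-> R}).
Hypotheses (hxi : white_noise xi) (hZ : continuous_mild_solution xi Z).
Variables (beta eps th : R) (b : bool).
Hypotheses (hbeta : 0 < beta) (heps : 0 < eps).
Hypotheses (th1 : th < 1) (hth : b%:R * (beta ^+ 2 / 2) < th).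

Local Notation gap := (gap beta th b).
Local Notation spacing := (spacing beta th b).
Local Notation block_size := (block_size beta th b).

Definition bad_block (x0 y : R) k : set T :=
  [set w | forall i : 'I_(block_size k),
     Z (height_time eps y) (x0 + (i : nat).+1%:R * spacing k) w <=
       level beta eps (height_time eps y)].

Lemma measurable_bad_block x0 y k : measurable (bad_block x0 y k).
Proof.
have -> : bad_block x0 y k = \bigcap_(i in [set: 'I_(block_size k)])
    [set w | Z (height_time eps y) (x0 + (i : nat).+1%:R * spacing k) w <=
       level beta eps (height_time eps y)].
  by apply/seteqP; split => w /= H i; [move=> _; exact: H|exact: (H i I)].
apply: fin_bigcap_measurable => // i _.
rewrite -[X in measurable X]setTI; apply: measurable_fun_le => //.
Qed.

(** The sample points are exp (k gap) apart and t is at most a power of k, so the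
correlations exp (- h^2/(4 t)) are smaller than any exponential in k, as
[second_moment_parameters] asks.  The finitely many small k only enlarge C. *)
Lemma bad_block_prob : exists2 C : R, 0 <= C & forall k x0 y,
  expR 1 < y -> ln y <= b%:R * k%:R + 2 ->
  (P (bad_block x0 y k) <= (C * expR (- (gap * k%:R)))%:E)%E.
Proof.
have g0 := gap_gt0 hth.
have [C [C0 [K HK]]] := second_moment_parameters hbeta th1 hth P.
have e20 : 0 < 1 / (2 * eps) by rewrite divr_gt0// mulr_gt0.
have [Ct Ct0 HCt] := powR_le_expR e20 g0.
have g20 : 0 < gap / 2 by rewrite divr_gt0.
have [K' HK'] := expR_dominates (4 * Ct * expR (2 * gap) * (beta ^+ 2 + 4) * (2 / gap)) g20.
exists (C + expR (gap * (maxn K K')%:R)); first by rewrite addr_ge0// expR_ge0.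
move=> k x0 y ye yk.
have [kK|kK] := leqP (maxn K K') k; last first.
  apply: le_trans (probability_le1 P (measurable_bad_block x0 y k)) _.
  rewrite lee_fin mulrDl -expRD.
  have : 1 <= expR (gap * (maxn K K')%:R + - (gap * k%:R)).
    rewrite -[leLHS]expR0 ler_expR -mulrBr mulr_ge0 ?(ltW g0)// subr_ge0 ler_nat.
    exact: ltnW.
  have : 0 <= C * expR (- (gap * k%:R)) by rewrite mulr_ge0// expR_ge0.
  by lra.
move: (kK); rewrite geq_max => /andP[kK1 kK2].
set t := height_time eps y.
have y1 : 1 < y by apply: le_lt_trans ye; rewrite -[leLHS]expR0 ler_expR.
have t0 : 0 < t by exact: height_time_gt0.
pose s2 := Num.sqrt (t / pi).
have s20 : 0 < s2 by rewrite sqrtr_gt0 divr_gt0// pi_gt0.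
pose s := Num.sqrt s2.
have s0 : 0 < s by rewrite sqrtr_gt0.
have sE : s ^+ 2 = s2 by rewrite sqr_sqrtr// ltW.
pose x i := x0 + i.+1%:R * spacing k.
pose X (i : 'I_(block_size k)) w := Z t (x i) w / s.
have -> : bad_block x0 y k = [set w | forall i, X i w <= level beta eps t / s].
  apply/seteqP; split => w /= H i; first by rewrite ler_pM2r ?invr_gt0//; exact: H.
  by have := H i; rewrite ler_pM2r ?invr_gt0.
have L0 : 0 < spacing k by exact: expR_gt0.
apply: (@le_trans _ _ (C * expR (- (gap * k%:R)))%:E); last first.
  by rewrite lee_fin ler_wpM2r ?expR_ge0// lerDl expR_ge0.
apply: (HK k kK1 (level beta eps t / s) (expR (- ((beta ^+ 2 + 4) * k%:R))) X).
- by rewrite divr_ge0 ?level_ge0// ltW.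
- rewrite expr_div_n sE level_sqr// -/s2 mulfK ?gt_eqF// height_time_pow//.
  by rewrite ler_wpM2l// sqr_ge0.
- exact: expR_ge0.
- exact: lexx.
- move=> i a; have := heat_pair hxi hZ (x i) (x i) (a / s) 0 t0 (lexx t).
  rewrite heat_cov_diag// -/s2 -sE expr0n/= mul0r addr0 mulr0 mulr0 mul0r addr0.
  rewrite expr_div_n divfK; last by rewrite expf_neq0// gt_eqF.
  congr (centered_normal P _ _); apply/funext => w.
  by rewrite /X mul0r addr0; ring.
move=> i j ij; exists (heat_cov t t (x i - x j) / s2).
  rewrite ger0_norm; last by rewrite divr_ge0 ?heat_cov_ge0// ltW.
  rewrite ler_pdivrMr//; apply: (le_trans (heat_cov_le (x i - x j) t0)).
  rewrite ler_pM2r// ler_expR mulNr lerN2.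
  have d1 : spacing k ^+ 2 <= (x i - x j) ^+ 2.
    have -> : x i - x j = ((i : nat)%:R - (j : nat)%:R) * spacing k.
      by rewrite /x -!natr1; ring.
    rewrite exprMn -[leLHS]mul1r ler_wpM2r ?sqr_ge0//.
    have : (i : nat) != j by [].
    rewrite neq_ltn => /orP[] ij'.
      have : (i : nat)%:R + 1 <= (j : nat)%:R :> R by rewrite natr1 ler_nat.
      by nra.
    have : (j : nat)%:R + 1 <= (i : nat)%:R :> R by rewrite natr1 ler_nat.
    by nra.
  have tle : t <= Ct * expR (gap * (k%:R + 2)).
    apply: (@le_trans _ _ (Ct * expR (gap * ln y))); first by apply: HCt; exact: ln_gt0.
    rewrite ler_pM2l// ler_expR ler_pM2l//; apply: (le_trans yk).
    by rewrite lerD2r ler_piMl//; case: {+}b.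
  rewrite ler_pdivlMr ?mulr_gt0//.
  apply: le_trans d1.
  have kk : k%:R <= 2 / gap * expR (gap / 2 * k%:R).
    have {1}-> : k%:R = 2 / gap * (gap / 2 * k%:R) by field; rewrite gt_eqF.
    apply: ler_wpM2l; first by rewrite divr_ge0// ltW.
    by apply: le_trans (expR_ge1Dx _); rewrite lerDr.
  have B0 : 0 < beta ^+ 2 + 4 by rewrite addr_gt0// exprn_gt0.
  apply: (@le_trans _ _ ((beta ^+ 2 + 4) * (2 / gap * expR (gap / 2 * k%:R)) * (4 * (Ct * expR (gap * (k%:R + 2)))))).
    apply: ler_pM.
    - by rewrite mulr_ge0// ltW.
    - by rewrite mulr_ge0// ltW.
    - by rewrite ler_pM2l.
    - by rewrite ler_pM2l.
  have -> : spacing k ^+ 2 = expR (gap / 2 * k%:R) * expR (gap / 2 * k%:R + gap * k%:R).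
    rewrite /spacing -expRM_natl -expRD; congr expR.
    by field.
  have -> : (beta ^+ 2 + 4) * (2 / gap * expR (gap / 2 * k%:R)) * (4 * (Ct * expR (gap * (k%:R + 2)))) =
     4 * Ct * expR (2 * gap) * (beta ^+ 2 + 4) * (2 / gap) * expR (gap / 2 * k%:R + gap * k%:R).
    have -> : gap * (k%:R + 2) = gap * k%:R + 2 * gap by ring.
    by rewrite !expRD; ring.
  by rewrite ler_pM2r ?expR_gt0//; exact: HK'.
move=> a a'; have := heat_pair hxi hZ (x i) (x j) (a / s) (a' / s) t0 (lexx t).
rewrite heat_cov_diag// -/s2.
have -> : (a / s) ^+ 2 * s2 + (a' / s) ^+ 2 * s2 + 2 * (a / s * (a' / s)) * heat_cov t t (x i - x j)
  = a ^+ 2 + a' ^+ 2 + 2 * (a * a') * (heat_cov t t (x i - x j) / s2).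
  by rewrite -sE; field; rewrite gt_eqF.
congr (centered_normal P _ _); apply/funext => w; rewrite /X; ring.
Qed.

End bad_block.

(** * Divergence of the contents *)

Section dimension_tools.
Context {R : realType}.

Lemma summable_eventually_lt (u : nat -> \bar R) (c : R) : 0 < c ->
  (forall k, (0 <= u k)%E) -> (\sum_(k <oo) u k < +oo)%E ->
  exists K : nat, forall k, (K <= k)%N -> (u k < c%:E)%E.
Proof.
move=> c0 u0 su.
have := nneseries_tail_cvg su (fun k _ => u0 k).
move=> /fine_cvgP[[N1 _ H1]] /cvgrPdist_lt /(_ c c0)[N2 _ H2].
exists (maxn N1 N2) => k; rewrite geq_max => /andP[k1 k2].
have f1 := H1 k k1; have := H2 k k2.
set S := (\sum_(k <= i <oo) u i)%E in f1 *.
rewrite /= sub0r normrN => /(le_lt_trans (ler_norm _)); rewrite -lte_fin.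
rewrite /comp fineK//; apply: le_lt_trans.
have := @nneseries_lim_ge R u xpredT k k.+1; rewrite big_nat1; apply.
by move=> i _ _; exact: u0.
Qed.

Lemma shell_square_side (k : nat) (z : R * R) (r : R) : 0 < r ->
  square z r `<=` shell k -> r <= expR k.+1%:R.
Proof.
move=> r0 sub.
have kb p : shell k p -> - expR k%:R < p.1 <= expR k%:R.
  by case: k {sub} => [|k] /= => [[]|[[]]]; rewrite /= in_itv.
have /kb/=/andP[_ h1] : shell k (z.1 + r, z.2 + r).
  by apply: sub; split; rewrite /= in_itv/=; apply/andP; split; lra.
have [//|h] := leP r (expR k.+1%:R).
have e2 : 2 <= expR 1 :> R by have := @expR_ge1Dx R 1; lra.
have E0 := @expR_gt0 R k%:R.
have e3 : expR k.+1%:R = expR k%:R * expR 1 :> R by rewrite -natr1 expRD.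
rewrite e3 in h.
have h2 : 2 * expR k%:R < r by nra.
have /kb/=/andP[h3 _] : shell k (z.1 + (r - 2 * expR k%:R), z.2 + r).
  by apply: sub; split; rewrite /= in_itv/=; apply/andP; split; lra.
lra.
Qed.

(** A square inside shell k has side at most exp (k + 1), so its normalised side is
at most 1. *)
Lemma shell_content_anti (rho rho' : R) k (A : set (R * R)) : rho <= rho' ->
  (shell_content rho' k A <= shell_content rho k A)%E.
Proof.
move=> rr; apply: le_ereal_inf_tmp => _ [m [c [r [Hc ->]]]].
apply: (@le_trans _ _ (\sum_(i < m) (r i / expR k.+1%:R) `^ rho')%:E).
  by apply: ereal_inf_lbound; exists m, c, r.
rewrite lee_fin; apply: ler_sum => i _.
have [[r1 sub] _] := (Hc.1 i, tt).
have r0 : 0 < r i by lra.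
apply: ger_powR => //; rewrite divr_gt0 ?expR_gt0//= ler_pdivrMr ?expR_gt0// mul1r.
exact: shell_square_side sub.
Qed.

End dimension_tools.

Section lower.
Context d (T : measurableType d) (R : realType) (P : probability T R).
Variables (xi : (R * R -> R) -> {RV P >-> R}) (Z : R -> R -> {RV P >-> R}).
Hypotheses (hxi : white_noise xi) (hZ : continuous_mild_solution xi Z).
Variables (beta eps th : R) (b : bool).
Hypotheses (hbeta : 0 < beta) (heps : 0 < eps).
Hypotheses (th0 : 0 < th) (th1 : th < 1) (hth : b%:R * (beta ^+ 2 / 2) < th).

Local Notation E k := (expR k%:R : R).
Local Notation peaks w := (tall_peaks (fun t x => Z t x w) beta eps).

Definition row_count k : nat := if b then Num.truncn (E k) else 1.
Definition column_count k : nat := Num.truncn (expR (k%:R * (1 - th)) : R).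
(** The offset e + 1 keeps the rows strictly above height e, where peaks live, and
the single row of the bottom edge (b = 0) below height e^2. *)
Definition row_base k : R := b%:R * E k + expR 1 + 1.
Definition bad_cell k (p : 'I_(row_count k) * 'I_(column_count k)) : set T :=
  bad_block Z beta eps th b (E k + (p.2 : nat)%:R * expR (k%:R * th))
    (row_base k + (p.1 : nat)%:R) k.

Let truncn_half (x : R) : 1 <= x -> x / 2 <= (Num.truncn x)%:R <= x.
Proof.
move=> x1; have /andP[l1 l2] := truncn_itv (le_trans ler01 x1).
rewrite l1 andbT.
have : (1 <= Num.truncn x)%N by rewrite truncn_ge_nat ?(le_trans ler01 x1).
by rewrite -(ler_nat R) -natr1 in l2 *; lra.
Qed.

Let E1 k : 1 <= E k. Proof. by rewrite -[leLHS]expR0 ler_expR. Qed.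
Let e94 : 9 / 4 <= expR 1 :> R.
Proof.
have -> : expR 1 = expR 2^-1 * expR 2^-1 :> R by rewrite -expRD -div1r -splitr.
by have := @expR_ge1Dx R 2^-1; nra.
Qed.

Lemma row_count_bounds k :
  (expR (b%:R * k%:R) : R) / 2 <= (row_count k)%:R <= (expR (b%:R * k%:R) : R).
Proof.
rewrite /row_count; case: b; first by rewrite mul1r; exact: truncn_half.
by rewrite mul0r expR0; lra.
Qed.

Lemma column_count_bounds k :
  expR (k%:R * (1 - th)) / 2 <= (column_count k)%:R <= expR (k%:R * (1 - th)).
Proof.
by apply: truncn_half; rewrite -[leLHS]expR0 ler_expR mulr_ge0// subr_ge0 ltW.
Qed.

Lemma cell_count_bounds k : expR (k%:R * (1 + b%:R - th)) / 4 <=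
  (row_count k)%:R * (column_count k)%:R.
Proof.
have /andP[r1 _] := row_count_bounds k; have /andP[c1 _] := column_count_bounds k.
have -> : k%:R * (1 + b%:R - th) = b%:R * k%:R + k%:R * (1 - th) by ring.
have -> : expR (b%:R * k%:R + k%:R * (1 - th)) / 4 =
  (expR (b%:R * k%:R) / 2) * (expR (k%:R * (1 - th)) / 2) by rewrite expRD; field.
by apply: ler_pM; rewrite ?divr_ge0 ?expR_ge0.
Qed.

Lemma row_height k (j : 'I_(row_count k)) :
  [/\ expR 1 < row_base k + (j : nat)%:R,
      ln (row_base k + (j : nat)%:R) <= b%:R * k%:R + 2 &
      (3 < k)%N -> row_base k + (j : nat)%:R <= E k.+1].
Proof.
have e := e94; have Ek := E1 k.
have j0 : 0 <= (j : nat)%:R :> R by exact: ler0n.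
have j1 : (j : nat)%:R + 1 <= (row_count k)%:R :> R by rewrite natr1 ler_nat.
have /andP[_ j2] := row_count_bounds k.
have b0 : 0 <= b%:R * E k by rewrite mulr_ge0 ?ler0n// expR_ge0.
have y0 : 0 < row_base k + (j : nat)%:R by rewrite /row_base; lra.
have bk : b%:R * E k + expR (b%:R * k%:R) <= expR (b%:R * k%:R) * (1 + b%:R).
  by case: {+}b; rewrite ?mulr0n ?mulr1n ?mul1r ?mul0r ?expR0; lra.
have b1 : b%:R <= 1 :> R by case: b.
have eb : expR (b%:R * k%:R) <= E k by rewrite ler_expR ler_piMl.
have eb1 : 1 <= expR (b%:R * k%:R) :> R by rewrite -[leLHS]expR0 ler_expR mulr_ge0 ?ler0n.
split; first by rewrite /row_base; lra.
- rewrite -[leRHS]expRK ler_ln ?posrE ?expR_gt0// expRD.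
  have -> : expR 2 = expR 1 * expR 1 :> R by rewrite -expRD.
  rewrite /row_base; set x := expR (b%:R * k%:R) in bk eb eb1 j2 *.
  have : expR 1 * 1 <= expR 1 * x by rewrite ler_pM2l ?expR_gt0.
  have : x * (2 + expR 1) <= x * (expR 1 * expR 1) by apply: ler_wpM2l; nra.
  have : x * (1 + b%:R) <= x * 2 by rewrite ler_wpM2l//; lra.
  by lra.
- move=> k3; rewrite -natr1 expRD /row_base.
  have k4 : 4 <= expR (k%:R - 1) :> R.
    apply: le_trans (expR_ge1Dx _).
    by have : 4 <= k%:R :> R; [rewrite ler_nat|lra].
  have Ek1 : E k = expR (k%:R - 1) * expR 1 :> R by rewrite -expRD subrK.
  have : 4 * expR 1 <= expR (k%:R - 1) * expR 1 :> R by rewrite ler_pM2r ?expR_gt0.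
  have : E k * (9 / 4) <= E k * expR 1 by rewrite ler_pM2l ?expR_gt0.
  have : expR (b%:R * k%:R) * (1 + b%:R) <= E k * 2 by apply: ler_pM => //; lra.
  by rewrite -Ek1; lra.
Qed.

Lemma good_cell_point k (w : T) (p : 'I_(row_count k) * 'I_(column_count k)) :
  (3 < k)%N -> ~ bad_cell p w ->
  exists x : R, [/\ peaks w (x, row_base k + (p.1 : nat)%:R),
    shell k.+1 (x, row_base k + (p.1 : nat)%:R) &
    E k + (p.2 : nat)%:R * expR (k%:R * th) < x <=
      E k + (p.2 : nat).+1%:R * expR (k%:R * th)].
Proof.
move=> k3; have [y1 y2 y3] := row_height p.1.
have y31 := y3 k3.
set y := row_base k + _ in y1 y2 y31 *.
rewrite /bad_cell /bad_block/= => /existsNP[i /negP]; rewrite -ltNge => Hi.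
pose x := E k + (p.2 : nat)%:R * expR (k%:R * th) + (i : nat).+1%:R * spacing beta th b k.
exists x.
have y11 : 1 < y by apply: le_lt_trans y1; rewrite -[leLHS]expR0 ler_expR.
have L0 : 0 < spacing beta th b k by exact: expR_gt0.
have l0 : 0 < expR (k%:R * th) by exact: expR_gt0.
have xb : E k + (p.2 : nat)%:R * expR (k%:R * th) < x <=
    E k + (p.2 : nat).+1%:R * expR (k%:R * th).
  rewrite /x ltrDl mulr_gt0//= -[(p.2 : nat).+1%:R]natr1.
  suff : (i : nat).+1%:R * spacing beta th b k <= expR (k%:R * th) by lra.
  have /andP[_ NU] := block_size_bounds hbeta hth k.
  apply: (@le_trans _ _ (expR (k%:R * (th - gap beta th b)) * spacing beta th b k)).
    by rewrite ler_pM2r//; apply: le_trans NU; rewrite ler_nat.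
  by rewrite /spacing -expRD ler_expR; lra.
split => //.
  exists (height_time eps y), x; split.
  - exact: height_time_gt0.
  - by rewrite height_time_pow// lnK// posrE; lra.
  - by rewrite height_time_pow// lnK// posrE; lra.
  - exact: Hi.
have /andP[x1 x2] := xb.
have x3 : E k < x by apply: le_lt_trans x1; rewrite lerDl mulr_ge0// ltW.
have x4 : x <= E k.+1.
  apply: (le_trans x2).
  have /andP[_ c2] := column_count_bounds k.
  have : (p.2 : nat).+1%:R * expR (k%:R * th) <= expR (k%:R * (1 - th)) * expR (k%:R * th).
    by rewrite ler_pM2r//; apply: le_trans c2; rewrite ler_nat.
  rewrite -expRD (_ : k%:R * (1 - th) + k%:R * th = k%:R); last by ring.
  have e := e94; rewrite -[k.+1%:R]natr1 expRD.
  have : E k * (9 / 4) <= E k * expR 1 by rewrite ler_pM2l ?expR_gt0.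
  by have := E1 k; lra.
have Ek1 := @expR_gt0 R k%:R; have Ek2 := @expR_gt0 R k.+1%:R.
split; first by split; rewrite /= in_itv/=; apply/andP; split; lra.
by move=> [/= + _]; rewrite in_itv/= => /andP[_]; lra.
Qed.

Lemma many_good_content k w : (3 < k)%N ->
  \sum_(p : 'I_(row_count k) * 'I_(column_count k)) \1_(bad_cell p) w <=
    ((row_count k)%:R * (column_count k)%:R) / 2 :> R ->
  ((8 * frostman_const * expR (2 * (1 + b%:R - th)))^-1%:E <=
    shell_content (1 + b%:R - th) k.+1 (peaks w))%E.
Proof.
move=> k3 few.
pose G : {set 'I_(row_count k) * 'I_(column_count k)} := finset (fun p => w \notin bad_cell p).
have /choice[xp Hxp] : forall p : 'I_(row_count k) * 'I_(column_count k), exists x : R,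
   p \in G -> [/\ peaks w (x, row_base k + (p.1 : nat)%:R),
    shell k.+1 (x, row_base k + (p.1 : nat)%:R) &
    E k + (p.2 : nat)%:R * expR (k%:R * th) < x <=
      E k + (p.2 : nat).+1%:R * expR (k%:R * th)].
  move=> p; case: (boolP (p \in G)) => [|_]; last by exists 0.
  rewrite inE => /negP; rewrite inE => nb.
  by have [x Hx] := good_cell_point k3 nb; exists x.
have fc0 : 0 < frostman_const :> R.
  by rewrite /frostman_const; have := @expR_gt0 R 1; lra.
have HJ : ~~ b -> row_count k = 1%N by rewrite /row_count; case: {+}b.
apply: le_trans (@content_ge R k th b th0 th1 _ _ (peaks w) G (row_base k) xp HJ _ _ _); last 3 first.
- by move=> p /Hxp[].
- by move=> p /Hxp[].
- by move=> p /Hxp[].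
rewrite lee_fin.
have cardG : ((row_count k)%:R * (column_count k)%:R) / 2 <= #|G|%:R :> R.
  have : #|G|%:R = (row_count k)%:R * (column_count k)%:R -
     \sum_(p : 'I_(row_count k) * 'I_(column_count k)) \1_(bad_cell p) w :> R.
    have -> : (row_count k)%:R * (column_count k)%:R =
        \sum_(p : 'I_(row_count k) * 'I_(column_count k)) 1 :> R.
      by rewrite sumr_const card_prod !card_ord -natrM.
    rewrite -sumrB -sum1_card natr_sum big_mkcond/=; apply: eq_bigr => p _.
    by rewrite inE indicE; case: (w \in bad_cell p); rewrite ?subrr ?subr0.
  by lra.
have c4 := cell_count_bounds k.
rewrite ler_pdivlMr; last by rewrite mulr_gt0// expR_gt0.
have -> : k.+2%:R * (1 + b%:R - th) = k%:R * (1 + b%:R - th) + 2 * (1 + b%:R - th).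
  by rewrite -addn2 natrD; ring.
rewrite expRD.
have -> : (8 * frostman_const * expR (2 * (1 + b%:R - th)))^-1 *
  (frostman_const * (expR (k%:R * (1 + b%:R - th)) * expR (2 * (1 + b%:R - th)))) =
  expR (k%:R * (1 + b%:R - th)) / 8.
  by field; rewrite !gt_eqF// expR_gt0.
by lra.
Qed.

(** The proportion of cells without a peak has mean at most C exp (- gap k), so it is
almost surely summable and eventually below 1/2.  From then on the contents are bounded
below by a positive constant, uniformly in the shell. *)
Lemma infinite_content : {ae P, forall w, forall rho, rho <= 1 + b%:R - th ->
  ~ (\sum_(1 <= k <oo) shell_content rho k (peaks w) < +oo)%E}.
Proof.
have [C C0 HC] := bad_block_prob hxi hZ hbeta heps th1 hth.
pose r := expR (- gap beta th b).
have r0 : 0 <= r by exact: expR_ge0.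
have r1 : r < 1 by rewrite -[ltRHS]expR0 ltr_expR oppr_lt0 gap_gt0.
pose JI k : R := (row_count k)%:R * (column_count k)%:R.
have JI0 k : 0 < JI k.
  by apply: lt_le_trans (cell_count_bounds k); rewrite divr_gt0 ?expR_gt0.
pose F k w : R := (JI k)^-1 *
  \sum_(p : 'I_(row_count k) * 'I_(column_count k)) \1_(bad_cell p) w.
have mB k (p : 'I_(row_count k) * 'I_(column_count k)) : measurable (bad_cell p).
  exact: measurable_bad_block.
have mF k : measurable_fun setT (F k).
  apply: measurable_funM => //; apply: measurable_sum => p.
  exact: measurable_indic.
have S0 k w : 0 <= \sum_(p : 'I_(row_count k) * 'I_(column_count k)) \1_(bad_cell p) w :> R.
  by apply: sumr_ge0 => p _; rewrite indicE.
have F0 k w : 0 <= F k w by rewrite mulr_ge0// invr_ge0 ltW.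
have IF k : (\int[P]_w (F k w)%:E <= (C * r ^+ k)%:E)%E.
  rewrite /F; under eq_integral do rewrite EFinM.
  rewrite ge0_integralZl//; last 3 first.
  - by apply/measurable_EFinP; apply: measurable_sum => p; exact: measurable_indic.
  - by move=> w _; rewrite lee_fin.
  - by rewrite lee_fin invr_ge0 ltW.
  under eq_integral do rewrite -sumEFin.
  have mI (p : 'I_(row_count k) * 'I_(column_count k)) :
      measurable_fun setT (fun w => (\1_(bad_cell p) w)%:E : \bar R).
    by apply/measurable_EFinP; exact: measurable_indic.
  have I0 (p : 'I_(row_count k) * 'I_(column_count k)) w :
      setT w -> (0 <= (\1_(bad_cell p) w)%:E :> \bar R)%E.
    by move=> _; rewrite lee_fin indicE.
  rewrite ge0_integral_sum//.
  apply: (@le_trans _ _ ((JI k)^-1%:E * \sum_(p : 'I_(row_count k) * 'I_(column_count k))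
      (C * r ^+ k)%:E)%E).
    rewrite lee_pmul2l//; last by rewrite lte_fin invr_gt0.
    apply: lee_sum => p _; rewrite integral_indic// setIT.
    have [y1 y2 _] := row_height p.1.
    have -> : r ^+ k = expR (- (gap beta th b * k%:R)).
      by rewrite /r -expRM_natl; congr expR; ring.
    exact: HC.
  rewrite sumEFin -EFinM lee_fin sumr_const card_prod !card_ord -[_ *+ _]mulr_natl natrM.
  by rewrite mulrA -/(JI k) mulVf ?mul1r// gt_eqF.
apply: filterS (ae_summable C0 r0 r1 mF F0 IF) => w Sw rho hrho.
have h20 : 0 < 2^-1 :> R by [].
have Fw0 k : (0 <= (F k w)%:E)%E by rewrite lee_fin.
have [K1 HK1] := summable_eventually_lt h20 Fw0 Sw.
rewrite -nneseries_addn; last by move=> k; exact: shell_content_ge0.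
pose c : R := (8 * frostman_const * expR (2 * (1 + b%:R - th)))^-1.
have c0 : 0 < c.
  rewrite invr_gt0 mulr_gt0 ?expR_gt0// mulr_gt0// /frostman_const.
  by have := @expR_gt0 R 1; lra.
move=> /(summable_eventually_lt c0 (fun k => shell_content_ge0 _ _ _))[K2 HK2].
pose k := maxn 4 (maxn K1 K2).
have k4 : (3 < k)%N by rewrite /k leq_maxl.
have kK1 : (K1 <= k)%N by rewrite /k !leq_max leqnn !orbT.
have kK2 : (K2 <= k)%N by rewrite /k !leq_max leqnn !orbT.
have := HK1 k kK1; rewrite lte_fin /F mulrC ltr_pdivrMr// => few.
have := HK2 k kK2; rewrite addn1; apply/negP; rewrite -leNgt.
apply: le_trans (shell_content_anti _ _ hrho).
apply: many_good_content => //; rewrite mulrC -/(JI k).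
exact: ltW.
Qed.

End lower.

(** * The dimension *)

Lemma inv_succ_lt (R : realType) (e : R) : 0 < e -> exists n : nat, n.+1%:R^-1 < e.
Proof.
move=> e0; exists (Num.truncn e^-1).
by rewrite invf_plt ?posrE// truncnS_gt.
Qed.

Theorem theorem4p1 (d : measure_display) (T : measurableType d) (R : realType)
    (P : probability T R)
    (xi : (R * R -> R) -> {RV P >-> R}) (Z : R -> R -> {RV P >-> R})
    (hxi : white_noise xi) (hZ : continuous_mild_solution xi Z)
    (beta eps : R) (hbeta : 0 < beta) (heps : 0 < eps) :
  {ae P, forall w,
    macro_dimH (tall_peaks (fun t x => Z t x w) beta eps)
    = (Num.max 1 (2 - beta ^+ 2 / 2))%:E}.
Proof.
set D := Num.max _ _; pose b := beta ^+ 2 / 2 < 1.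
pose m : R := b%:R * (beta ^+ 2 / 2).
have beta2 : 0 < beta ^+ 2 / 2 by rewrite divr_gt0// exprn_gt0.
have DE : D = 1 + b%:R - m.
  rewrite /D /m /b; case: ltP => h /=; rewrite ?mulr1n ?mulr0n.
    by rewrite max_r; lra.
  by rewrite max_l; lra.
have m0 : 0 <= m by apply: mulr_ge0; [exact: ler0n|exact: ltW].
have m1 : m < 1 by rewrite /m /b; case: (ltP (beta ^+ 2 / 2)) => h /=; rewrite ?mulr1n ?mulr0n; lra.
have D1 : 1 <= D by rewrite /D le_max lexx.
have up (n : nat) : {ae P, forall w, (\sum_(1 <= k <oo) shell_content (D + n.+1%:R^-1) k
    (tall_peaks (fun t x => Z t x w) beta eps) < +oo)%E}.
  have n0 : 0 < n.+1%:R^-1 :> R by rewrite invr_gt0.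
  set e := n.+1%:R^-1 in n0 *.
  have gb : Num.max 0 (2 - D - e / 2) < beta ^+ 2 / 2.
    rewrite gt_max beta2/=; have : 2 - beta ^+ 2 / 2 <= D by rewrite /D le_max lexx orbT.
    lra.
  apply: (summable_content hxi hZ hbeta heps _ gb).
  - by rewrite le_max lexx.
  - by rewrite ge_max ler01/=; lra.
  - have : 2 - D - e / 2 <= Num.max 0 (2 - D - e / 2) by rewrite le_max lexx orbT.
    lra.
have low (n : nat) : {ae P, forall w, forall rho, rho <= D - (1 - m) / n.+2%:R ->
  ~ (\sum_(1 <= k <oo) shell_content rho k
    (tall_peaks (fun t x => Z t x w) beta eps) < +oo)%E}.
  have e0 : 0 < (1 - m) / n.+2%:R by rewrite divr_gt0// subr_gt0.
  have e1 : (1 - m) / n.+2%:R < 1 - m.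
    by rewrite ltr_pdivrMr// ltr_pMr ?subr_gt0// ltr1n.
  set e := (1 - m) / _ in e0 e1 *.
  have -> : D - e = 1 + b%:R - (m + e) by rewrite DE; ring.
  apply: (infinite_content hxi hZ hbeta heps); first by lra.
    by lra.
  by rewrite -/m; lra.
apply: filterS2 (ae_foralln up) (ae_foralln low) => w upw loww.
apply/eqP; rewrite eq_le; apply/andP; split.
  apply/lee_addgt0Pr => e e0; have [n ne] := inv_succ_lt e0.
  apply: (@le_trans _ _ (D + n.+1%:R^-1)%:E).
    apply: ereal_inf_lbound; exists (D + n.+1%:R^-1) => //; split; last exact: upw.
    by rewrite addr_gt0 ?invr_gt0//; lra.
  by rewrite -EFinD lee_fin lerD2l ltW.
apply: le_ereal_inf_tmp => _ [rho [rho0 srho] <-]; rewrite lee_fin leNgt.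
apply/negP => rD.
have q0 : 0 < (D - rho) / (1 - m) by rewrite divr_gt0 ?subr_gt0.
have [n ne] := inv_succ_lt q0.
apply: (loww n rho) => //.
have h1 : (1 - m) / n.+2%:R <= (1 - m) * n.+1%:R^-1.
  by rewrite ler_pM2l ?subr_gt0// lef_pV2 ?posrE// ler_nat.
have h2 : (1 - m) * n.+1%:R^-1 < D - rho.
  by rewrite -ltr_pdivlMl ?subr_gt0// mulrC.
by rewrite lerBrDr -lerBrDl; exact: le_trans h1 (ltW h2).
Qed.
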